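(* Let $\alpha,\beta\in\mathbb R$, $\theta=e^{-2\pi i\alpha}$, $\phi=e^{-2\pi i\beta}$ with $(\theta,\phi)\neq(1,1)$, let $\tau$ be in the complex upper half plane, and let $m_1,\dots,m_r,n_1,\dots,n_s\ge0$ be integers with $\sum_{i=1}^rm_i=\sum_{j=1}^sn_j$. For complex variables $x_1,\dots,x_r,y_1,\dots,y_s$ let $\mathbf M$ be the block matrix $$\mathbf M=\left(\begin{array}{ccc}\mathbf D^{(11)}&\cdots&\mathbf D^{(1s)}\\ \vdots&\ddots&\vdots\\ \mathbf D^{(r1)}&\cdots&\mathbf D^{(rs)}\end{array}\right),$$ with $\mathbf D^{(ab)}$ the $m_a\times n_b$ matrix $$\mathbf D^{(ab)}(i,j)=D\!\left[\begin{array}{c}\theta\\ \phi\end{array}\right](i,j,\tau,x_a-y_b)\qquad(1\le i\le m_a,\ 1\le j\le n_b),\quad 1\le a\le r,\ 1\le b\le s.$$ Then $$\det(\mathbf M)=\frac{\vartheta\!\left[\begin{array}{c}-\beta+\frac12\\ \alpha+\frac12\end{array}\right]\big(\sum_{i=1}^rm_ix_i-\sum_{j=1}^sn_jy_j,\tau\big)}{\vartheta\!\left[\begin{array}{c}-\beta+\frac12\\ \alpha+\frac12\end{array}\right](0,\tau)}\cdot\frac{\prod_{1\le i<k\le r}K(x_i-x_k,\tau)^{m_im_k}\prod_{1\le j<l\le s}K(y_j-y_l,\tau)^{n_jn_l}}{\prod_{1\le i\le r,1\le j\le s}K(x_i-y_j,\tau)^{m_in_j}}.$$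
   Context: $q=e^{2\pi i\tau}$, $q^n=e^{2\pi in\tau}$. Twisted Weierstrass functions: for $\phi=e^{2\pi i\lambda}$, $0\le\lambda<1$, $(\theta,\phi)\neq(1,1)$, $k\ge1$, $$P_k\!\left[\begin{array}{c}\theta\\ \phi\end{array}\right](z,\tau)=\frac{(-1)^k}{(k-1)!}\sum_{n\in\mathbb Z+\lambda}\frac{n^{k-1}e^{nz}}{1-\theta^{-1}q^n}\quad(|q|<|e^z|<1),$$ continued meromorphically to $z\in\mathbb C$ ($0^0=1$). For $k,l\ge1$, $$D\!\left[\begin{array}{c}\theta\\ \phi\end{array}\right](k,l,\tau,z)=(-1)^{k+1}\binom{k+l-2}{k-1}P_{k+l-1}\!\left[\begin{array}{c}\theta\\ \phi\end{array}\right](z,\tau).$$ Theta function: $\vartheta\!\left[\begin{array}{c}a\\ b\end{array}\right](z,\tau)=\sum_{n\in\mathbb Z}\exp[i\pi(n+a)^2\tau+(n+a)(z+2\pi ib)]$. Prime form: $K(z,\tau)=\exp(-P_0(z,\tau))$, $P_0(z,\tau)=-\log z+\sum_{k\ge2}\frac1kE_k(\tau)z^k$ (continued to an entire function of $z$), with $E_k=0$ for odd $k$ and $E_k(\tau)=-\frac{B_k}{k!}+\frac2{(k-1)!}\sum_{r\ge1}\frac{r^{k-1}q^r}{1-q^r}$ for even $k$ ($B_k$ Bernoulli numbers); equivalently $K(z,\tau)=\vartheta\!\left[\begin{array}{c}1/2\\1/2\end{array}\right](z,\tau)\big/\partial_z\vartheta\!\left[\begin{array}{c}1/2\\1/2\end{array}\right](0,\tau)$.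 Blocks with $m_a=0$ or $n_b=0$ are empty, and the determinant of the empty matrix is $1$.
   Formalization: The printed identity is off by a sign (e.g. r=s=1, m_1=n_1=2 gives det M ~ -z^{-4}, right side ~ +z^{-4}); the formal right side carries the extra factor (-1)^{C(N,2)+Σ C(m_a,2)+Σ C(n_b,2)}, N=Σ m_i. *)

(* Defs.v *)
From HB Require Import structures.
From mathcomp Require Import all_boot all_order all_algebra.
From mathcomp Require Import all_classical all_reals all_analysis.
From mathcomp Require Import complex.

Set Implicit Arguments.
Unset Strict Implicit.
Unset Printing Implicit Defensive.

Import Order.TTheory GRing.Theory Num.Theory.
Import numFieldNormedType.Exports.

Local Open Scope classical_set_scope.
Local Open Scope complex_scope.
Local Open Scope ring_scope.

(* MathComp-Analysis does not transfer the norm topology of a numFieldType to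
   the concrete type R[i]; this instance does. *)
HB.instance Definition _ (R : realType) := NormedModule.copy R[i] R[i]^o.

(* After the import of Num.Theory, Re and Im denote the operators of
   numClosedFieldType, with values in the field itself. The R-valued
   projections of R[i] are complex.Re and complex.Im. *)

Definition cexp (R : realType) (z : R[i]) : R[i] :=
  (expR (complex.Re z) * cos (complex.Im z))
    +i* (expR (complex.Re z) * sin (complex.Im z)).

Definition two_pi_i (R : realType) : R[i] := 0 +i* (pi *+ 2).

(* q^x = exp(2 pi i x tau). *)
Definition qexp (R : realType) (tau : R[i]) (x : R) : R[i] :=
  cexp (two_pi_i R * x%:C * tau).

(* A sum over the integers; Negz n is the integer - (n + 1). *)
Definition zsum (R : realType) (f : int -> R[i]) : R[i] :=
  limn (series (fun n : nat => f (Posz n)))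
  + limn (series (fun n : nat => f (Negz n))).

Definition analytic_at (R : realType) (f : R[i] -> R[i]) (z0 : R[i]) : Prop :=
  exists c : nat -> R[i],
    \forall z \near z0,
      series (fun n : nat => c n * (z - z0) ^+ n) @ \oo --> f z.

Definition pole_at (R : realType) (f : R[i] -> R[i]) (z0 : R[i]) : Prop :=
  exists (N : nat) (c : nat -> R[i]),
    [/\ (0 < N)%N, c 0%N != 0 &
        \forall z \near z0^',
          series (fun n : nat => c n * (z - z0) ^+ n) @ \oo
            --> (z - z0) ^+ N * f z].

Definition entire (R : realType) (f : R[i] -> R[i]) : Prop :=
  forall z0 : R[i], analytic_at f z0.

(* Functions are total, so a meromorphic function is given the value 0 at its
   poles. With this convention, and removable singularities filled in, a
   meromorphic continuation is unique as a function. *)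
Definition meromorphic (R : realType) (f : R[i] -> R[i]) : Prop :=
  forall z0 : R[i], analytic_at f z0 \/ (pole_at f z0 /\ f z0 = 0).

(* For phi on the unit circle, the unique lambda in [0, 1[ such that
   phi = exp(2 pi i lambda). *)
Definition twist_exponent (R : realType) (phi : R[i]) : R :=
  xget 0 [set lambda : R |
    0 <= lambda < 1 /\ phi = cexp (two_pi_i R * lambda%:C)].

(* The series of P_k[theta; phi](z, tau); the summation variable
   n in Z + lambda is written l + lambda with l : int. *)
Definition twisted_weierstrass_series (R : realType) (theta phi : R[i])
    (k : nat) (z tau : R[i]) : R[i] :=
  let lambda := twist_exponent phi in
  (-1) ^+ k / (k.-1)`!%:R *
  zsum (fun l : int =>
    let n : R := l%:~R + lambda in
    (n%:C) ^+ k.-1 * cexp (n%:C * z) / (1 - theta^-1 * qexp tau n)).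

Definition twisted_weierstrass (R : realType) (theta phi : R[i])
    (k : nat) (z tau : R[i]) : R[i] :=
  xget (fun=> 0)
    [set f : R[i] -> R[i] |
      meromorphic f /\
      (forall w : R[i], `|qexp tau 1| < `|cexp w| < 1 ->
         f w = twisted_weierstrass_series theta phi k w tau)] z.

Definition twisted_D (R : realType) (theta phi : R[i]) (k l : nat)
    (tau z : R[i]) : R[i] :=
  (-1) ^+ k.+1 * 'C(k + l - 2, k - 1)%:R *
  twisted_weierstrass theta phi (k + l - 1) z tau.

Definition vartheta (R : realType) (a b : R) (z tau : R[i]) : R[i] :=
  zsum (fun n : int =>
    let na : R[i] := (n%:~R + a)%:C in
    cexp ((0 +i* pi) * na ^+ 2 * tau + na * (z + two_pi_i R * b%:C))).

(* [:: B_0; ...; B_(n-1)], by the recursion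
   \sum_(j <= n) 'C(n+1, j) B_j = (n == 0). *)
Fixpoint bernoulli_seq (n : nat) : seq rat :=
  if n is n'.+1 then
    let s := bernoulli_seq n' in
    rcons s (((n' == 0%N)%:R - \sum_(j < n') 'C(n'.+1, j)%:R * s`_j)
             / n'.+1%:R)
  else [::].

Definition bernoulli (n : nat) : rat := (bernoulli_seq n.+1)`_n.

(* The series is indexed by r.+1, with r starting from 0. *)
Definition eisenstein (R : realType) (k : nat) (tau : R[i]) : R[i] :=
  if odd k then 0
  else - ratr (bernoulli k) / k`!%:R
       + 2 / (k.-1)`!%:R *
         limn (series (fun r : nat =>
           r.+1%:R ^+ k.-1 * qexp tau r.+1%:R / (1 - qexp tau r.+1%:R))).

(* P_0(z, tau) + log z = \sum_(k >= 2) E_k(tau) z^k / k. *)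
Definition P0_plus_log (R : realType) (z tau : R[i]) : R[i] :=
  limn (series (fun k : nat =>
    k.+2%:R^-1 * eisenstein k.+2 tau * z ^+ k.+2)).

(* For every branch of log, exp (- P_0) = z * exp (- (P_0 + log z)). *)
Definition prime_form (R : realType) (z tau : R[i]) : R[i] :=
  xget (fun=> 0)
    [set f : R[i] -> R[i] |
      entire f /\
      \forall w \near (0 : R[i]), f w = w * cexp (- P0_plus_log w tau)] z.

(* The lattice 2 pi i (Z + Z tau), which is both the set of poles of
   P_k[theta; phi](-, tau), for k >= 1, |theta| = |phi| = 1 and
   (theta, phi) <> (1, 1), and the set of zeros of K(-, tau). *)
Definition period_lattice (R : realType) (tau : R[i]) : set R[i] :=
  [set z | exists u v : int, z = two_pi_i R * (u%:~R + v%:~R * tau)].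

(* Main.v *)
(** Let [K] be the prime form and [q = e^{2 pi i tau}].  Partial fractions of the reciprocal of the
    theta series give Kronecker's expansion, that is [P_1(z) = e^{lambda z} K(z + a) / (K(a) K(z))]
    for [|q| < |e^z| < 1], where [a] depends on the twist only; the same expansion,
    degenerated at [a = 0], is the logarithmic derivative of the theta series and identifies [K].
    Up to sign [P_{k+1}(z)] is the [k]-th Taylor coefficient of [P_1] at [z], so the entries of the
    matrix are Taylor coefficients of [P_1] with binomial factors.

    When all [m_a] and [n_b] are [1] the determinant is that of Frobenius, which follows from the
    three-term identity of theta functions.  In general replace [x_a] by the points [x_a + p h],
    [p < m_a], and [y_b] by [y_b + u h], [u < n_b].  Finite differences of rows and columns, which
    do not change the determinant, make the entries asymptotic to [p! u! h^{p+u}] times those of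
    the given matrix as [h -> 0], while the factors [K] between points of the same block contribute
    the same factorials and powers of [h], and a sign. *)

Require Import Defs.
From mathcomp Require Import all_boot all_order all_algebra.
From mathcomp Require Import all_classical all_reals all_analysis.
From mathcomp Require Import complex ring lra zify.

Set Implicit Arguments.
Unset Strict Implicit.
Unset Printing Implicit Defensive.

Import Order.TTheory GRing.Theory Num.Theory.
Import numFieldNormedType.Exports.

Local Open Scope classical_set_scope.
Local Open Scope complex_scope.
Local Open Scope ring_scope.

(** The zeros of the theta series are located without being counted. The partial fraction identity
    says that [Theta b] times a sum is a constant, so [Theta b] cannot vanish off the lattice once
    that constant, up to sign the derivative of [halfTheta] at [0], is nonzero. It is nonzero
    because the expansion of the logarithmic derivative is a recursion making every Taylor
    coefficient a multiple of the first, while a theta series that vanished identically would have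
    zero Fourier coefficients.

    Both [twisted_weierstrass] and [prime_form] pick some function with a local property. Each
    identification therefore needs existence, for which quotients of entire functions and their
    Taylor coefficients are shown to be meromorphic, and uniqueness, which is the identity theorem.

    In the sign, ['C(N, 2)], with [N] the size of the matrix, comes from the Frobenius determinant,
    where factors [K(x_k - x_i)] stand beside [K(y_i - y_k)]. Each ['C(m_a, 2)] and ['C(n_b, 2)]
    comes from the negative differences between colliding points of one block. *)

Lemma addr_subl (V : zmodType) (x y : V) : x + y - x = y.
Proof. by rewrite addrAC subrr add0r. Qed.

(** * Real-valued norm on the complex numbers, and limits in terms of it *)

Section RealNorm.
Context {R : realType}.
Implicit Types z w : R[i].

(* The norm of R[i] has its values in R[i]; this is the same number in R. *)
Definition nm z : R := complex.Re `|z|.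

Lemma nmE z : `|z| = (nm z)%:C.
Proof. by rewrite /nm normc_def. Qed.

Lemma nm_ge0 z : 0 <= nm z.
Proof. by rewrite -ler0c -nmE. Qed.

Lemma nm0 : nm 0 = 0.
Proof. by rewrite /nm normr0. Qed.

Lemma nm1 : nm 1 = 1.
Proof. by rewrite /nm normr1. Qed.

Lemma nmD z w : nm (z + w) <= nm z + nm w.
Proof. by rewrite -lecR rmorphD /= -!nmE ler_normD. Qed.

Lemma nmN z : nm (- z) = nm z.
Proof. by rewrite /nm normrN. Qed.

Lemma nm_distC z w : nm (z - w) = nm (w - z).
Proof. by rewrite -nmN opprB. Qed.

Lemma nm_triangle z w v : nm (z - v) <= nm (z - w) + nm (w - v).
Proof. by have := nmD (z - w) (w - v); rewrite addrA subrK. Qed.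

Lemma nmBr z w : nm z - nm w <= nm (z - w).
Proof. by have := nmD (z - w) w; rewrite subrK; lra. Qed.

Lemma nmM z w : nm (z * w) = nm z * nm w.
Proof. by apply: complexI; rewrite rmorphM /= -!nmE normrM. Qed.

Lemma nmX z n : nm (z ^+ n) = nm z ^+ n.
Proof. by apply: complexI; rewrite rmorphXn /= -!nmE normrX. Qed.

Lemma nmV z : nm z^-1 = (nm z)^-1.
Proof. by apply: complexI; rewrite fmorphV /= -!nmE normfV. Qed.

Lemma nm_eq0 z : (nm z == 0) = (z == 0).
Proof.
rewrite -(normr_eq0 z) nmE; apply/eqP/eqP => [-> //|].
by move=> /(congr1 (@complex.Re R)).
Qed.

Lemma nm_gt0 z : (0 < nm z) = (z != 0).
Proof. by rewrite lt_neqAle nm_ge0 andbT eq_sym nm_eq0. Qed.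

Lemma nm_real (x : R) : nm x%:C = `|x|.
Proof. by rewrite /nm normc_def /= expr0n addr0 sqrtr_sqr. Qed.

Lemma nm_nat n : nm n%:R = n%:R.
Proof. by rewrite -(rmorph_nat (real_complex R)) /= nm_real ger0_norm. Qed.

Lemma nm_Re z : `|complex.Re z| <= nm z.
Proof. by rewrite -lecR -nmE normc_ge_Re. Qed.

Lemma nm_Im z : `|complex.Im z| <= nm z.
Proof.
have := nm_Re (z * - 'i%C); rewrite mulrN raddfN /= ReiNIm opprK => /le_trans; apply.
by rewrite nmN nmM -[X in _ * X](_ : 1 = _) ?mulr1 // /nm normc_def /= expr0n expr1n add0r sqrtr1.
Qed.

Lemma nm_sum (I : Type) (s : seq I) (P : pred I) (f : I -> R[i]) :
  nm (\sum_(i <- s | P i) f i) <= \sum_(i <- s | P i) nm (f i).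
Proof.
elim/big_rec2 : _ => [|i y z _ IH]; first by rewrite nm0.
by rewrite (le_trans (nmD _ _))// lerD2l.
Qed.

Lemma nm_i : nm 'i%C = 1.
Proof. by rewrite /nm normc_def /= expr0n expr1n add0r sqrtr1. Qed.

Lemma complexRI z : z = (complex.Re z)%:C + 'i%C * (complex.Im z)%:C.
Proof. exact: complexE. Qed.

(** Radii of balls live in [R[i]], but there [0 < e] forces [e] to have imaginary part [0], so real
    radii suffice. *)
Lemma nbhsC_P (z0 : R[i]) (P : R[i] -> Prop) :
  (\forall z \near z0, P z) <->
  exists2 d : R, 0 < d & forall z, nm (z - z0) < d -> P z.
Proof.
split.
  move=> /nbhs_ballP[e /= e0 he]; have e0' := e0.
  rewrite ltcE /= in e0; case/andP: e0 => /eqP ime re0.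
  exists (complex.Re e) => // z hz; apply: he; rewrite /ball/= -normrN opprB.
  by rewrite nmE ltcE /= ime eqxx.
move=> [d d0 hd]; apply/nbhs_ballP; exists d%:C => /=; first by rewrite ltcR.
move=> z; rewrite /ball /= -normrN opprB nmE ltcR; exact: hd.
Qed.

Lemma nbhsC_dP (z0 : R[i]) (P : R[i] -> Prop) :
  (\forall z \near z0^', P z) <->
  exists2 d : R, 0 < d & forall z, z != z0 -> nm (z - z0) < d -> P z.
Proof.
rewrite /dnbhs /within /=; split.
  move=> /nbhsC_P[d d0 hd]; exists d => // z zz0 hz; exact: hd.
by move=> [d d0 hd]; apply/nbhsC_P; exists d => // z hz zz0; exact: hd.
Qed.

Lemma cvgC_P (u : nat -> R[i]) (l : R[i]) :
  (u @ \oo --> l) <->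
  forall e : R, 0 < e -> exists N, forall n, (N <= n)%N -> nm (u n - l) < e.
Proof.
split.
  move=> /cvgrPdist_lt h e e0.
  have /h : (0 : R[i]) < e%:C by rewrite ltcR.
  move=> [N _ hN]; exists N => n /hN /=; rewrite nmE ltcR nm_distC //.
move=> h; apply/cvgrPdist_lt => e e0; have e0' := e0.
rewrite ltcE /= in e0; case/andP: e0 => /eqP ime /h [N hN].
exists N => // n /= /hN; rewrite nm_distC => hn.
by rewrite nmE ltcE /= ime eqxx.
Qed.

End RealNorm.

(** * Unconditional summation *)

Section Bounded.
Context {R : realType}.

(** For nonnegative [f] this is summability, in a form that needs no enumeration of [I] and is
    stable under injective reindexing. *)
Definition rbdd (I : eqType) (f : I -> R) :=
  exists B : R, forall s : seq I, uniq s -> \sum_(i <- s) f i <= B.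

Lemma sum_sub (I : eqType) (f : I -> R) (s s' : seq I) :
  (forall i, 0 <= f i) -> uniq s -> {subset s <= s'} ->
  \sum_(i <- s) f i <= \sum_(i <- s') f i.
Proof.
move=> f0; elim: s s' => [|a s IH] s' /=; first by rewrite big_nil sumr_ge0.
case/andP=> nas us sub; rewrite big_cons.
have /perm_to_rem hp : a \in s' by apply: sub; rewrite mem_head.
rewrite (perm_big _ hp) big_cons lerD2l; apply: IH => // i si.
have : i \in s' by apply: sub; rewrite inE si orbT.
rewrite (perm_mem hp) inE => /orP[/eqP ia|//].
by rewrite ia (negbTE nas) in si.
Qed.

Lemma rbdd_le (I : eqType) (f g : I -> R) :
  (forall i, f i <= g i) -> rbdd g -> rbdd f.
Proof.
move=> fg [B hB]; exists B => s us.
by apply: le_trans (hB s us); apply: ler_sum.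
Qed.

Lemma rbddD (I : eqType) (f g : I -> R) :
  rbdd f -> rbdd g -> rbdd (fun i => f i + g i).
Proof.
move=> [A hA] [B hB]; exists (A + B) => s us.
by rewrite big_split lerD ?hA ?hB.
Qed.

Lemma rbddZ (I : eqType) (a : R) (f : I -> R) :
  0 <= a -> rbdd f -> rbdd (fun i => a * f i).
Proof.
move=> a0 [A hA]; exists (a * A) => s us.
by rewrite -mulr_sumr ler_wpM2l ?hA.
Qed.

Lemma rbdd_comp (I J : eqType) (h : J -> I) (f : I -> R) :
  injective h -> rbdd f -> rbdd (f \o h).
Proof.
move=> hi [A hA]; exists A => s us.
by have := hA [seq h j | j <- s]; rewrite map_inj_uniq// big_map; apply.
Qed.

Lemma rbdd_pair (I J : eqType) (f : I * J -> R) (g : I -> R) :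
  (forall p, 0 <= f p) ->
  (forall i t, uniq t -> \sum_(j <- t) f (i, j) <= g i) ->
  rbdd g -> rbdd f.
Proof.
move=> f0 fg [B hB]; exists B => s us.
pose si := undup [seq p.1 | p <- s]; pose sj := undup [seq p.2 | p <- s].
have sub : {subset s <= [seq (i, j) | i <- si, j <- sj]}.
  move=> [i j] hp; apply/allpairsP; exists (i, j) => /=.
  by split => //; rewrite mem_undup; apply/mapP; exists (i, j).
apply: le_trans (sum_sub f0 us sub) _; rewrite big_allpairs_dep /=.
apply: le_trans (hB si (undup_uniq _)); apply: ler_sum => i _.
by apply: fg; rewrite undup_uniq.
Qed.

Lemma rbdd_prod (I J : eqType) (f : I -> R) (g : J -> R) :
  (forall i, 0 <= f i) -> (forall i, 0 <= g i) ->
  rbdd f -> rbdd g -> rbdd (fun p : I * J => f p.1 * g p.2).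
Proof.
move=> f0 g0 bf [B hB].
apply: (@rbdd_pair _ _ _ (fun i => B * f i)).
- by move=> p; rewrite mulr_ge0.
- by move=> i t ut /=; rewrite -mulr_sumr mulrC ler_wpM2r // hB.
- apply: rbddZ => //; by have := hB [::] erefl; rewrite big_nil.
Qed.

Lemma rbdd_nat (f : nat -> R) (B : R) :
  (forall i, 0 <= f i) -> (forall N, \sum_(i < N) f i <= B) -> rbdd f.
Proof.
move=> f0 hB; exists B => s us.
have sub : {subset s <= iota 0 (\max_(i <- s) i).+1}.
  by move=> i hi; rewrite mem_iota add0n ltnS leq_bigmax_seq.
apply: le_trans (sum_sub f0 us sub) _.
by rewrite -[X in iota 0 X]subn0 -/(index_iota 0 _) big_mkord.
Qed.

End Bounded.

(** A chosen partial inverse lets [pmap] pull a finite sum back along [h] when the summand vanishes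
    off the image of [h]. *)
Lemma partial_inverse (I : eqType) (J : Type) (h : J -> I) :
  {k : I -> option J | ocancel k h & forall i, k i = None -> forall j, h j <> i}.
Proof.
have /choice[k hk] : forall i, exists o : option J,
    match o with Some j => h j = i | None => forall j, h j <> i end.
  move=> i; case: (pselect (exists j, h j = i)) => [[j hj]|nj].
    by exists (Some j).
  by exists None => j hj; apply: nj; exists j.
exists k; first by move=> i; have := hk i; case: (k i).
by move=> i ki; have := hk i; rewrite ki.
Qed.

Lemma big_pmap_inv (V : nmodType) (I J : eqType) (h : J -> I) (k : I -> option J)
    (f : I -> V) (s : seq I) :
  ocancel k h -> (forall i, k i = None -> f i = 0) ->
  \sum_(i <- s) f i = \sum_(j <- pmap k s) f (h j).
Proof.
move=> kh f0; elim: s => [|a s IH] /=; first by rewrite !big_nil.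
rewrite big_cons IH; case ka : (k a) => [j|] /=.
  by rewrite big_cons; have := kh a; rewrite ka /= => ->.
by rewrite f0 // add0r.
Qed.

Section Csum.
Context {R : realType}.
Local Notation C := R[i].

Definition asum (I : eqType) (f : I -> C) := rbdd (fun i => nm (f i)).

(** Convergence of the net of finite partial sums. Sums over [int] and over pairs can then be
    reindexed and exchanged with no ordering to keep track of. *)
Definition hsum (I : eqType) (f : I -> C) (l : C) :=
  forall e : R, 0 < e -> exists2 s : seq I, uniq s & forall s' : seq I, uniq s' ->
    {subset s <= s'} -> nm (\sum_(i <- s') f i - l) < e.

Definition csum (I : eqType) (f : I -> C) : C := xget 0 [set l | hsum f l].

Local Lemma ltr0Sn2 : 0 < 2 :> R. Proof. by []. Qed.

Lemma nm_small_eq0 (z : C) : (forall e, 0 < e -> nm z <= e) -> z = 0.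
Proof.
move=> h; apply/eqP; rewrite -nm_eq0 eq_le nm_ge0 andbT leNgt.
apply/negP => z0; have z2 : 0 < nm z / 2 by rewrite divr_gt0.
by have := h _ z2; lra.
Qed.

Lemma uniq_sup (I : eqType) (s t : seq I) :
  exists2 u, uniq u & {subset s <= u} /\ {subset t <= u}.
Proof.
exists (undup (s ++ t)); first exact: undup_uniq.
by split=> i hi; rewrite mem_undup mem_cat hi ?orbT.
Qed.

Lemma hsum_unique (I : eqType) (f : I -> C) l l' : hsum f l -> hsum f l' -> l = l'.
Proof.
move=> h h'; apply/eqP; rewrite -subr_eq0; apply/eqP/nm_small_eq0 => e e0.
have [s us hs] := h (e / 2) (divr_gt0 e0 ltr0Sn2); have [t ut ht] := h' (e / 2) (divr_gt0 e0 ltr0Sn2).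
have [u uu [su tu]] := uniq_sup s t.
have := hs u uu su; rewrite nm_distC; have := ht u uu tu.
have := nm_triangle l (\sum_(i <- u) f i) l'; lra.
Qed.

Lemma hsum_csum (I : eqType) (f : I -> C) l : hsum f l -> csum f = l.
Proof.
move=> h; apply: (hsum_unique _ h); rewrite /csum.
by case: xgetP => [y _ //|nl]; case: (nl l).
Qed.

Lemma hsumD (I : eqType) (f g : I -> C) l m :
  hsum f l -> hsum g m -> hsum (fun i => f i + g i) (l + m).
Proof.
move=> hf hg e e0.
have [s us hs] := hf (e / 2) (divr_gt0 e0 ltr0Sn2); have [t ut ht] := hg (e / 2) (divr_gt0 e0 ltr0Sn2).
have [u uu [su tu]] := uniq_sup s t; exists u => // v uv sub.
rewrite big_split opprD addrACA; apply: le_lt_trans (nmD _ _) _.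
have := hs v uv (fun i hi => sub i (su i hi)).
have := ht v uv (fun i hi => sub i (tu i hi)); lra.
Qed.

Lemma hsumZ (I : eqType) (a : C) (f : I -> C) l :
  hsum f l -> hsum (fun i => a * f i) (a * l).
Proof.
move=> hf e e0.
have a1 : 0 < nm a + 1 by have := nm_ge0 a; lra.
have [s us hs] := hf (e / (nm a + 1)) (divr_gt0 e0 a1).
exists s => // t ut st; rewrite -mulr_sumr -mulrBr nmM.
have := hs t ut st; rewrite ltr_pdivlMr // => h.
apply: le_lt_trans h; rewrite mulrC ler_wpM2l ?nm_ge0 //; lra.
Qed.

Lemma hsum_nonneg (I : eqType) (f : I -> R) :
  (forall i, 0 <= f i) -> rbdd f -> exists l, hsum (fun i => (f i)%:C) l.
Proof.
move=> f0 [B hB].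
pose S := [set x | exists2 s, uniq s & x = \sum_(i <- s) f i].
have supS : has_sup S.
  split; first by exists 0, [::] => //; rewrite big_nil.
  by exists B => x [s us ->]; exact: hB.
exists (sup S)%:C => e e0.
have [x [s us ->] hx] := sup_adherent e0 supS.
exists s => // t ut st; rewrite -raddf_sum -rmorphB nm_real ltr_norml.
have h1 := sum_sub f0 us st.
have h2 : \sum_(i <- t) f i <= sup S by apply: ub_le_sup; [case: supS|exists t].
by apply/andP; split; lra.
Qed.

(** Only the nonnegative case has a direct proof, by a supremum. The real part of [f] is written as
    [(nm f + Re f) - nm f], the imaginary part likewise, and all these nonnegative families are
    dominated by [2 nm f]. *)
Lemma asum_hsum (I : eqType) (f : I -> C) : asum f -> hsum f (csum f).
Proof.
move=> af.
have [l0 h0] := hsum_nonneg (fun i => nm_ge0 (f i)) af.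
have [l1 h1] : exists l, hsum (fun i => (nm (f i) + complex.Re (f i))%:C) l.
  apply: hsum_nonneg => [i|]; first by have := nm_Re (f i); rewrite ler_norml; lra.
  apply: (rbdd_le (g := fun i => nm (f i) + nm (f i))); last exact: rbddD.
  by move=> i; have := nm_Re (f i); rewrite ler_norml; lra.
have [l2 h2] : exists l, hsum (fun i => (nm (f i) + complex.Im (f i))%:C) l.
  apply: hsum_nonneg => [i|]; first by have := nm_Im (f i); rewrite ler_norml; lra.
  apply: (rbdd_le (g := fun i => nm (f i) + nm (f i))); last exact: rbddD.
  by move=> i; have := nm_Im (f i); rewrite ler_norml; lra.
suff h : hsum f (l1 + (-1) * l0 + 'i%C * (l2 + (-1) * l0)) by rewrite (hsum_csum h).
have -> : f = fun i => (nm (f i) + complex.Re (f i))%:C + (-1) * (nm (f i))%:C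
    + 'i%C * ((nm (f i) + complex.Im (f i))%:C + (-1) * (nm (f i))%:C).
  apply/funext => i; rewrite !rmorphD /= {1}[f i]complexRI; ring.
by apply: hsumD; [|apply: hsumZ]; apply: hsumD => //; apply: hsumZ.
Qed.

Lemma asum_le (I : eqType) (f g : I -> C) :
  (forall i, nm (f i) <= nm (g i)) -> asum g -> asum f.
Proof. exact: rbdd_le. Qed.

Lemma asumD (I : eqType) (f g : I -> C) :
  asum f -> asum g -> asum (fun i => f i + g i).
Proof. by move=> hf hg; apply: rbdd_le (rbddD hf hg) => i; exact: nmD. Qed.

Lemma asumZ (I : eqType) (a : C) (f : I -> C) :
  asum f -> asum (fun i => a * f i).
Proof.
move=> hf; apply: rbdd_le (rbddZ (nm_ge0 a) hf) => i; by rewrite nmM.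
Qed.

Lemma asumZr (I : eqType) (a : C) (f : I -> C) :
  asum f -> asum (fun i => f i * a).
Proof.
by move=> /(asumZ a); congr asum; apply/funext => i; rewrite mulrC.
Qed.

Lemma asum_comp (I J : eqType) (h : J -> I) (f : I -> C) :
  injective h -> asum f -> asum (f \o h).
Proof. by move=> hi; exact: (@rbdd_comp R I J h (fun i => nm (f i))). Qed.

Lemma csumD (I : eqType) (f g : I -> C) :
  asum f -> asum g -> csum (fun i => f i + g i) = csum f + csum g.
Proof. by move=> hf hg; apply/hsum_csum/hsumD; apply: asum_hsum. Qed.

Lemma csumZ (I : eqType) (a : C) (f : I -> C) :
  asum f -> csum (fun i => a * f i) = a * csum f.
Proof. by move=> hf; apply/hsum_csum/hsumZ; apply: asum_hsum. Qed.

Lemma csumZr (I : eqType) (a : C) (f : I -> C) :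
  asum f -> csum (fun i => f i * a) = csum f * a.
Proof.
by move=> /(csumZ a); rewrite mulrC => <-; congr csum; apply/funext => i; rewrite mulrC.
Qed.

Lemma csumB (I : eqType) (f g : I -> C) :
  asum f -> asum g -> csum (fun i => f i - g i) = csum f - csum g.
Proof.
move=> hf hg; rewrite -[- csum g]mulN1r -csumZ // -csumD //; last exact: asumZ.
by congr csum; apply/funext => i; rewrite mulN1r.
Qed.

Lemma eq_csum (I : eqType) (f g : I -> C) : f =1 g -> csum f = csum g.
Proof. by move=> fg; congr csum; apply/funext. Qed.

Lemma eq_asum (I : eqType) (f g : I -> C) : f =1 g -> asum f -> asum g.
Proof. by move=> fg; congr asum; apply/funext. Qed.

Lemma csum0 (I : eqType) : csum (fun _ : I => 0) = 0.
Proof.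
apply: hsum_csum => e e0; exists [::] => // s _ _.
by rewrite big1 // subr0 nm0.
Qed.

Lemma nm_csum_approx (I : eqType) (f : I -> C) (e : R) : asum f -> 0 < e ->
  exists2 s, uniq s & nm (csum f) <= \sum_(i <- s) nm (f i) + e.
Proof.
move=> /asum_hsum h /h[s us hs]; exists s => //.
have := hs s us (fun _ => id); rewrite nm_distC => hl.
have := nmBr (csum f) (\sum_(i <- s) f i).
have := nm_sum s xpredT f; lra.
Qed.

Lemma nm_csum_le (I : eqType) (f : I -> C) (B : R) :
  (forall s, uniq s -> \sum_(i <- s) nm (f i) <= B) -> nm (csum f) <= B.
Proof.
move=> hB; apply/ler_addgt0Pr => e e0.
have [|s us hs] := @nm_csum_approx _ f e _ e0; first by exists B.
by apply: le_trans hs _; rewrite lerD2r hB.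
Qed.

Lemma csum_inj (I J : eqType) (h : J -> I) (f : I -> C) :
  injective h -> (forall i, (forall j, h j <> i) -> f i = 0) ->
  asum (f \o h) -> csum f = csum (f \o h).
Proof.
move=> hi f0 /asum_hsum hl; apply: hsum_csum => e /hl[s us hs].
have [k kh kN] := partial_inverse h.
exists [seq h j | j <- s]; first by rewrite map_inj_uniq.
move=> t ut st; rewrite (big_pmap_inv (h := h) (k := k)) //; last by move=> i /kN /f0.
apply: hs; first exact: (pmap_uniq kh).
move=> j sj; rewrite mem_pmap; apply/mapP; exists (h j); first exact/st/map_f.
case kj : (k (h j)) => [j'|]; last by case: (kN _ kj j).
by have := kh (h j); rewrite kj /= => /hi ->.
Qed.

Lemma asum_inj (I J : eqType) (h : J -> I) (f : I -> C) :
  (forall i, (forall j, h j <> i) -> f i = 0) ->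
  asum (f \o h) -> asum f.
Proof.
move=> f0 [B hB]; exists B => s us.
have [k kh kN] := partial_inverse h.
rewrite (big_pmap_inv (h := h) (k := k)) //.
  by apply: hB; exact: (pmap_uniq kh).
by move=> i /kN /f0 ->; rewrite nm0.
Qed.

Lemma csum_bij (I J : eqType) (h : J -> I) (f : I -> C) :
  bijective h -> asum f -> csum f = csum (f \o h).
Proof.
move=> [k hk kh] af; apply: csum_inj; first exact: can_inj hk.
  by move=> i ni; case: (ni (k i)).
by apply: asum_comp => //; exact: can_inj hk.
Qed.

(** Each half is [f] extended by zero off one of the two images, so the disjoint union becomes a sum
    of two functions on [I]. *)
Lemma csum_split (I J K : eqType) (h : J -> I) (k : K -> I) (f : I -> C) :
  injective h -> injective k -> (forall i j, h i <> k j) ->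
  (forall i, (exists j, h j = i) \/ (exists j, k j = i)) ->
  asum (f \o h) -> asum (f \o k) ->
  asum f /\ csum f = csum (f \o h) + csum (f \o k).
Proof.
move=> hi ki hk cov ah ak.
pose f1 i := if `[< exists j, h j = i >] then f i else 0.
pose f2 i := if `[< exists j, h j = i >] then 0 else f i.
have fE : f = fun i => f1 i + f2 i.
  by apply/funext => i; rewrite /f1 /f2; case: asboolP => _; rewrite ?addr0 ?add0r.
have f1h : f1 \o h = f \o h.
  by apply/funext => j; rewrite /f1 /=; case: asboolP => // -[]; exists j.
have f2k : f2 \o k = f \o k.
  by apply/funext => j; rewrite /f2 /=; case: asboolP => // -[j' /hk].
have f10 i : (forall j, h j <> i) -> f1 i = 0.
  by move=> nj; rewrite /f1; case: asboolP => // -[j /nj].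
have f20 i : (forall j, k j <> i) -> f2 i = 0.
  by move=> nj; rewrite /f2; case: asboolP => // ni; case: (cov i) => // -[j /nj].
have a1 : asum f1 by apply: (asum_inj f10); rewrite f1h.
have a2 : asum f2 by apply: (asum_inj f20); rewrite f2k.
rewrite {1 2}fE; split; first exact: asumD.
by rewrite csumD // (csum_inj hi f10) ?f1h // (csum_inj ki f20) ?f2k.
Qed.

Lemma asum_fst (I J : eqType) (f : I * J -> C) i :
  asum f -> asum (fun j => f (i, j)).
Proof. by move=> /(@asum_comp _ _ (pair i) f); apply => j j' []. Qed.

Lemma asum_csum (I J : eqType) (f : I * J -> C) :
  asum f -> asum (fun i => csum (fun j => f (i, j))).
Proof.
move=> af; have [B hB] := af; exists B => s us; apply/ler_addgt0Pr => e e0.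
(* The error [e] is shared among the rows in [s]; the [+ 1] keeps the denominator positive when [s]
   is empty. *)
have s1 : 0 < (size s)%:R + 1 :> R by rewrite ltr_wpDl.
have /choice[t ht] : forall i, exists t, uniq t /\ nm (csum (fun j => f (i, j))) <=
    \sum_(j <- t) nm (f (i, j)) + e / ((size s)%:R + 1).
  move=> i; have [t ut h] := nm_csum_approx (asum_fst i af) (divr_gt0 e0 s1).
  by exists t.
have : \sum_(i <- s) nm (csum (fun j => f (i, j))) <=
    \sum_(i <- s) (\sum_(j <- t i) nm (f (i, j)) + e / ((size s)%:R + 1)).
  by apply: ler_sum => i _; case: (ht i).
rewrite big_split /= big_const_seq count_predT iter_addr addr0 => h.
apply: le_trans h _; apply: lerD.
  rewrite -(big_allpairs_dep (h := pair) (F := fun p => nm (f p))); apply: hB.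
  by apply: allpairs_uniq_dep => // [i _|]; [case: (ht i)|move=> [i j] [i' j'] _ _ /= [-> ->]].
rewrite -[X in X <= _]mulr_natr mulrAC ler_pdivrMr // ler_pM2l //; lra.
Qed.

(** A finite set [s] that is good for the double sum is enlarged, row by row, until each finite row
    sum is close to its full sum. The result is a finite set of pairs containing [s], so its sum is
    close both to [csum f] and to the sum of the rows. *)
Lemma csum_pair (I J : eqType) (f : I * J -> C) :
  asum f -> csum f = csum (fun i => csum (fun j => f (i, j))).
Proof.
move=> af; apply/esym/hsum_csum => e e0.
have e20 : 0 < e / 2 by lra.
have [s us hs] := asum_hsum af e20.
exists (undup [seq p.1 | p <- s]); first exact: undup_uniq.
move=> s' us' sub.
have s1 : 0 < (size s')%:R + 1 :> R by rewrite ltr_wpDl.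
have e1 := divr_gt0 e20 s1.
have /choice[t ht] : forall i, exists t, [/\ uniq t,
    {subset [seq p.2 | p <- s] <= t} &
    nm (\sum_(j <- t) f (i, j) - csum (fun j => f (i, j))) <= (e / 2) / ((size s')%:R + 1)].
  move=> i; have [t ut h] := asum_hsum (asum_fst i af) e1.
  have [u uu [su tu]] := uniq_sup [seq p.2 | p <- s] t.
  by exists u; split => //; apply/ltW/h.
have : nm (\sum_(i <- s') \sum_(j <- t i) f (i, j)
    - \sum_(i <- s') csum (fun j => f (i, j))) <= e / 2.
  rewrite -sumrB; apply: le_trans (nm_sum _ _ _) _.
  apply: (@le_trans _ _ (\sum_(i <- s') (e / 2) / ((size s')%:R + 1))).
    by apply: ler_sum => i _; case: (ht i).
  rewrite big_const_seq count_predT iter_addr addr0 -[X in X <= _]mulr_natr mulrAC.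
  rewrite ler_pdivrMr // ler_pM2l //; lra.
rewrite -(big_allpairs_dep (h := pair) (F := fun p => f p)).
set A := \sum_(_ <- _) _; set D := \sum_(_ <- _) _.
have hA : nm (A - csum f) < e / 2.
  apply: hs.
    by apply: allpairs_uniq_dep => // [i _|]; [case: (ht i)|move=> [i j] [i' j'] _ _ /= [-> ->]].
  move=> [i j] sij; apply/allpairsPdep; exists i, j; split => //.
    by apply: sub; rewrite mem_undup; apply/mapP; exists (i, j).
  by have [_ h _] := ht i; apply: h; apply/mapP; exists (i, j).
have := nm_triangle D A (csum f); rewrite [nm (D - A)]nm_distC; lra.
Qed.

Lemma asum_swap (I J : eqType) (f : I * J -> C) :
  asum f -> asum (fun p : J * I => f (p.2, p.1)).
Proof. by move=> /(@asum_comp _ _ (fun p : J * I => (p.2, p.1))); apply => -[? ?] [? ?] /= [-> ->]. Qed.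

Lemma csum_exchange (I J : eqType) (f : I * J -> C) :
  asum f ->
  csum (fun i => csum (fun j => f (i, j))) = csum (fun j => csum (fun i => f (i, j))).
Proof.
move=> af; rewrite -csum_pair // -(csum_pair (asum_swap af)).
by apply: csum_bij => //; exists (fun p => (p.2, p.1)) => -[].
Qed.

Lemma asum_prod (I J : eqType) (f : I -> C) (g : J -> C) :
  asum f -> asum g -> asum (fun p => f p.1 * g p.2).
Proof.
move=> hf hg; have := rbdd_prod (fun i => nm_ge0 (f i)) (fun i => nm_ge0 (g i)) hf hg.
by apply: rbdd_le => p; rewrite nmM.
Qed.

Lemma csum_prod (I J : eqType) (f : I -> C) (g : J -> C) :
  asum f -> asum g -> csum f * csum g = csum (fun p => f p.1 * g p.2).
Proof.
move=> hf hg; rewrite csum_pair /=; last exact: asum_prod.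
rewrite -csumZr //; apply: eq_csum => i; by rewrite csumZ.
Qed.

Lemma asum_pair (I J : eqType) (f : I * J -> C) (g : I -> R) :
  (forall i t, uniq t -> \sum_(j <- t) nm (f (i, j)) <= g i) -> rbdd g -> asum f.
Proof. by move=> h; apply: rbdd_pair => // p; exact: nm_ge0. Qed.

Lemma csum_nat (f : nat -> C) : asum f -> series f @ \oo --> csum f.
Proof.
move=> /asum_hsum hf; apply/cvgC_P => e /hf[s us hs].
exists (\max_(i <- s) i).+1 => n hn; rewrite /series /=; apply: hs; first exact: iota_uniq.
move=> i hi; rewrite mem_index_iota /=; apply: leq_trans hn.
by rewrite ltnS leq_bigmax_seq.
Qed.

Lemma limn_csum (f : nat -> C) : asum f -> limn (series f) = csum f.
Proof. by move=> /csum_nat h; apply: cvg_lim h. Qed.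

Lemma asum_int (f : int -> C) :
  asum (f \o Posz) -> asum (f \o Negz) ->
  asum f /\ csum f = csum (f \o Posz) + csum (f \o Negz).
Proof.
by apply: csum_split => [? ? []|? ? []|//|[n|n]] //; [left|right]; exists n.
Qed.

(** Under absolute convergence the two one-sided limits of [zsum] add up to the unordered sum;
    [zsum] is only ever handled through this. *)
Lemma zsum_csum (f : int -> C) : asum f -> zsum f = csum f.
Proof.
move=> af.
have ap : asum (f \o Posz) by apply: asum_comp => // ? ? [].
have an : asum (f \o Negz) by apply: asum_comp => // ? ? [].
have [_ ->] := asum_int ap an.
by rewrite /zsum (limn_csum ap) (limn_csum an).
Qed.

Lemma csum_fin (I : eqType) (f : I -> C) (s : seq I) : uniq s ->
  (forall i, i \notin s -> f i = 0) -> hsum f (\sum_(i <- s) f i) /\ asum f.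
Proof.
move=> us f0; split.
  move=> e e0; exists s => // t ut st.
  rewrite (bigID (mem s)) /= [X in _ + X - _]big1 // addr0 -big_filter.
  rewrite (perm_big s) ?subrr ?nm0 //; apply: uniq_perm => //; first exact: filter_uniq.
  by move=> i; rewrite mem_filter; case: (boolP (i \in s)) => // /st ->.
exists (\sum_(i <- s) nm (f i)) => t ut.
rewrite (bigID (mem s)) /= [X in _ + X]big1 ?addr0; last by move=> i /f0 ->; rewrite nm0.
rewrite -big_filter; apply: sum_sub; first by move=> i; exact: nm_ge0.
  exact: filter_uniq.
by move=> i; rewrite mem_filter => /andP[].
Qed.

End Csum.

Section SeriesTools.
Context {R : realType}.
Local Notation C := R[i].

(** The pairs are embedded in the triangle [p.2 <= p.1] by [(i, j) -> (i + j, i)]. Extended by zero,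
    the family has the antidiagonals as its rows. *)
Lemma csum_antidiag (F : nat * nat -> C) : asum F ->
  asum (fun n => \sum_(i < n.+1) F (val i, (n - i)%N)) /\
  csum F = csum (fun n => \sum_(i < n.+1) F (val i, (n - i)%N)).
Proof.
move=> aF; pose h (p : nat * nat) := ((p.1 + p.2)%N, p.1).
pose G (p : nat * nat) := if (p.2 <= p.1)%N then F (p.2, (p.1 - p.2)%N) else 0.
have hG : G \o h = F.
  by apply/funext => -[i j]; rewrite /G /h /= leq_addr addKn.
have hi : injective h by move=> [i j] [i' j'] [/= h1 h2]; congr pair => //; lia.
have G0 p : (forall q, h q <> p) -> G p = 0.
  case: p => n i hp; rewrite /G /=; case: leqP => // le.
  by case: (hp (i, (n - i)%N)); rewrite /h /= subnKC.
have aG : asum G by apply: (asum_inj G0); rewrite hG.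
have E n : csum (fun i => G (n, i)) = \sum_(i < n.+1) F (val i, (n - i)%N).
  have [|/hsum_csum -> _] := @csum_fin _ _ (fun i => G (n, i)) (index_iota 0 n.+1) (iota_uniq _ _).
    by move=> i; rewrite mem_index_iota /= ltnS /G /=; case: leqP.
  rewrite big_mkord; apply: eq_bigr => i _; rewrite /G /=.
  by have := ltn_ord i; rewrite ltnS => ->.
split; first by apply: eq_asum (asum_csum aG) => n; exact: E.
rewrite -hG -(csum_inj hi G0) ?hG // csum_pair //.
exact: eq_csum.
Qed.

Lemma cvgC_unique (u : nat -> C) (l l' : C) :
  (u @ \oo --> l) -> (u @ \oo --> l') -> l = l'.
Proof.
move=> /cvgC_P h /cvgC_P h'; apply/eqP; rewrite -subr_eq0; apply/eqP/nm_small_eq0.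
move=> e e0; have e2 : 0 < e / 2 by rewrite divr_gt0.
have [N hN] := h _ e2; have [M hM] := h' _ e2.
have := hN (N + M)%N (leq_addr _ _); rewrite nm_distC.
have := hM (N + M)%N (leq_addl _ _).
have := nm_triangle l (u (N + M)%N) l'; lra.
Qed.

Lemma csum_real (u : nat -> R) (l : R) :
  asum (fun n => (u n)%:C) -> series u @ \oo --> l -> csum (fun n => (u n)%:C) = l%:C.
Proof.
move=> /csum_nat h ul; apply: (cvgC_unique h).
apply/cvgC_P => e e0; move/cvgrPdist_lt : ul => /(_ e e0)[N _ hN].
exists N => n /hN /=; rewrite /series /= -raddf_sum -rmorphB nm_real distrC //.
Qed.

Lemma rbdd_series (u : nat -> R) : (forall n, 0 <= u n) -> cvgn (series u) -> rbdd u.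
Proof.
move=> u0 cu; apply: (@rbdd_nat _ _ (limn (series u))) => // N.
rewrite -(big_mkord xpredT) -[X in X <= _]/(series u N).
apply: nondecreasing_cvgn_le => //; exact: nondecreasing_series.
Qed.

End SeriesTools.

(** * The complex exponential and its power series *)

Section Cexp.
Context {R : realType}.
Local Notation C := R[i].
Implicit Types z w : C.

Lemma cexpD z w : cexp (z + w) = cexp z * cexp w.
Proof.
case: z w => a b [c d]; rewrite /cexp /= expRD cosD sinD.
by congr Complex; rewrite /=; ring.
Qed.

Lemma cexp0 : cexp (0 : C) = 1.
Proof. by rewrite /cexp /= expR0 cos0 sin0 mulr1 mulr0. Qed.

Lemma cexpN z : cexp (- z) = (cexp z)^-1.
Proof.
have h : cexp z * cexp (- z) = 1 by rewrite -cexpD subrr cexp0.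
have z0 : cexp z != 0 by apply/eqP => z0; move: h; rewrite z0 mul0r => /esym/eqP; rewrite oner_eq0.
by apply: (mulfI z0); rewrite h divff.
Qed.

Lemma cexp_neq0 z : cexp z != 0.
Proof.
apply/eqP => z0; have : cexp z * cexp (- z) = 1 by rewrite -cexpD subrr cexp0.
by rewrite z0 mul0r => /esym/eqP; rewrite oner_eq0.
Qed.

Lemma cexpB z w : cexp (z - w) = cexp z / cexp w.
Proof. by rewrite cexpD cexpN. Qed.

Lemma cexpM_nat z n : cexp (n%:R * z) = cexp z ^+ n.
Proof.
elim: n => [|n IH]; first by rewrite mul0r cexp0.
by rewrite -addn1 natrD mulrDl mul1r cexpD IH exprD expr1.
Qed.

Lemma cexpM_int z (n : int) : cexp (n%:~R * z) = cexp z ^ n.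
Proof.
case: n => n; first by rewrite -pmulrn cexpM_nat.
by rewrite NegzE mulrNz mulNr cexpN -pmulrn cexpM_nat exprnN.
Qed.

Lemma nm_cexp z : nm (cexp z) = expR (complex.Re z).
Proof.
rewrite /cexp /nm normc_def /= !exprMn -mulrDr cos2Dsin2 mulr1 sqrtr_sqr.
by rewrite ger0_norm // expR_ge0.
Qed.

Definition exp_term z (n : nat) : C := z ^+ n / n`!%:R.

Lemma nm_exp_term z n : nm (exp_term z n) = exp_coeff (nm z) n.
Proof. by rewrite nmM nmX nmV nm_nat. Qed.

Lemma rbdd_exp (x : R) : 0 <= x -> rbdd (exp_coeff x).
Proof.
move=> x0; apply: rbdd_series => [n|]; first exact: exp_coeff_ge0.
exact: is_cvg_series_exp_coeff.
Qed.

Lemma asum_exp z : asum (exp_term z).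
Proof.
by apply: rbdd_le (rbdd_exp (nm_ge0 z)) => n; rewrite nm_exp_term.
Qed.

Lemma sum_exp_coeff_le (x : R) (s : seq nat) : 0 <= x -> uniq s ->
  \sum_(n <- s) exp_coeff x n <= expR x.
Proof.
move=> x0 us.
have sub : {subset s <= iota 0 (\max_(i <- s) i).+1}.
  by move=> i hi; rewrite mem_iota add0n ltnS leq_bigmax_seq.
apply: le_trans (sum_sub (fun i => exp_coeff_ge0 i x0) us sub) _.
rewrite -[X in iota 0 X]subn0 -/(index_iota 0 _).
apply: (@nondecreasing_cvgn_le _ (series (exp_coeff x))).
  by apply: nondecreasing_series => n _ _; exact: exp_coeff_ge0.
exact: is_cvg_series_exp_coeff.
Qed.

Lemma csum_expD z w :
  csum (exp_term (z + w)) = csum (exp_term z) * csum (exp_term w).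
Proof.
rewrite csum_prod; [|exact: asum_exp..].
have [_ ->] := csum_antidiag (asum_prod (asum_exp z) (asum_exp w)).
apply: eq_csum => n; rewrite /exp_term /= addrC exprDn mulr_suml.
apply: eq_bigr => i _; have le : (i <= n)%N by have := ltn_ord i; rewrite ltnS.
have fn k : k`!%:R != 0 :> C by rewrite pnatr_eq0 -lt0n fact_gt0.
rewrite -(bin_fact le) !natrM -mulr_natl; field.
by rewrite !fn pnatr_eq0 -lt0n bin_gt0 le.
Qed.

Lemma csum_exp_real (x : R) : csum (exp_term x%:C) = (expR x)%:C.
Proof.
have E : exp_term x%:C = fun n => (exp_coeff x n)%:C.
  by apply/funext => n; rewrite /exp_term /exp_coeff /= rmorphM rmorphXn fmorphV /= rmorph_nat.
rewrite E; apply: csum_real; first by rewrite -E; exact: asum_exp.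
exact: is_cvg_series_exp_coeff.
Qed.

(** Each term is the cosine coefficient plus ['i] times the sine coefficient, of which at most one
    is nonzero according to the parity of [n]. *)
Lemma csum_exp_imag (y : R) : csum (exp_term ('i%C * y%:C)) = (cos y) +i* (sin y).
Proof.
have E n : exp_term ('i%C * y%:C) n = (cos_coeff y n)%:C + 'i%C * (sin_coeff y n)%:C.
  rewrite /exp_term /cos_coeff /sin_coeff /= exprMn -rmorphXn /=.
  rewrite -(rmorph_nat (real_complex R)) -fmorphV /= -!mulrA -rmorphM /=.
  move: (_ / _) => t; have hn := odd_double_half n; rewrite -{1}hn.
  move: hn; case: (odd n) => /= hn.
    rewrite add1n exprS -mul2n exprM sqr_i !mul0r mul1r add0r -mulrA.
    by rewrite rmorphM rmorphXn rmorphN1 /= (_ : n.-1./2 = n./2) //; lia.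
  rewrite add0n -mul2n exprM sqr_i !mul0r mul1r mulr0 addr0.
  by rewrite -exprnP rmorphM rmorphXn rmorphN1.
have ac : asum (fun n => (cos_coeff y n)%:C).
  apply: asum_le (asum_exp ('i%C * y%:C)) => n; rewrite nm_real.
  by apply: le_trans (nm_Re _); rewrite E /= !(mul0r, mul1r, mulr0, subr0, addr0).
have as_ : asum (fun n => (sin_coeff y n)%:C).
  apply: asum_le (asum_exp ('i%C * y%:C)) => n; rewrite nm_real.
  by apply: le_trans (nm_Im _); rewrite E /= !(mul0r, mul1r, mulr0, add0r, addr0).
rewrite (eq_csum E) csumD //; last exact: asumZ.
rewrite csumZ // (csum_real ac (l := cos y)) ?(csum_real as_ (l := sin y)).
- by rewrite [RHS]complexRI.
- by rewrite unlock; exact: is_cvg_series_sin_coeff.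
- by rewrite unlock; exact: is_cvg_series_cos_coeff.
Qed.

(** The addition law of the series separates real and imaginary arguments, where the known real
    series apply. *)
Lemma cexpE z : cexp z = csum (exp_term z).
Proof.
rewrite {2}[z]complexRI csum_expD csum_exp_real csum_exp_imag.
rewrite {1}/cexp; case: z => a b /=.
by apply/eqP; rewrite eq_complex /= !mul0r subr0 addr0 !eqxx.
Qed.

End Cexp.

(** * Power series *)

Section PowerSeries.
Context {R : realType}.
Local Notation C := R[i].
Implicit Types (c d : nat -> C) (h z w : C) (r : R).

Lemma rbdd_geo r : 0 <= r -> r < 1 -> rbdd (fun n => r ^+ n).
Proof.
move=> r0 r1; apply: rbdd_series => [n|]; first exact: exprn_ge0.
have := @is_cvg_geometric_series R 1 r; rewrite ger0_norm // => /(_ r1).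
by congr (cvgn (series _)); apply/funext => n; rewrite /= mul1r.
Qed.

Lemma sum_fin_le (I : eqType) (f : I -> R) (s t : seq I) : uniq t ->
  (forall i, 0 <= f i) -> (forall i, i \notin s -> f i = 0) ->
  \sum_(i <- t) f i <= \sum_(i <- s) f i.
Proof.
move=> ut f0 fs.
rewrite (bigID (mem s)) /= [X in _ + X]big1 ?addr0; last by move=> i /fs.
rewrite -big_filter; apply: sum_sub => //; first exact: filter_uniq.
by move=> i; rewrite mem_filter => /andP[].
Qed.

Lemma rbdd_inj (I J : eqType) (h : J -> I) (f : I -> R) :
  (forall i, (forall j, h j <> i) -> f i = 0) -> rbdd (f \o h) -> rbdd f.
Proof.
move=> f0 [B hB]; exists B => s us.
have [k kh kN] := partial_inverse h.
rewrite (big_pmap_inv (h := h) (k := k)) //; last by move=> i /kN /f0.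
by apply: hB; exact: (pmap_uniq kh).
Qed.

(* Absolute convergence on the closed disc of radius r. *)
Definition pconv c r := rbdd (fun n => nm (c n) * r ^+ n).

Definition pse c h := csum (fun n => c n * h ^+ n).

Lemma pconv_le c r r' : 0 <= r' -> r' <= r -> pconv c r -> pconv c r'.
Proof.
move=> r0 rr; apply: rbdd_le => n; rewrite ler_wpM2l ?nm_ge0 //.
by rewrite lerXn2r // nnegrE // (le_trans r0).
Qed.

Lemma pconv_asum c r h : pconv c r -> nm h <= r -> asum (fun n => c n * h ^+ n).
Proof.
move=> hc hr; apply: rbdd_le (pconv_le (nm_ge0 h) hr hc) => n.
by rewrite nmM nmX.
Qed.

Lemma pse_bound c r : pconv c r ->
  exists2 B, 0 <= B & forall h, nm h <= r -> nm (pse c h) <= B.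
Proof.
move=> [B hB]; exists B; first by have := hB [::] erefl; rewrite big_nil.
move=> h hr; apply: nm_csum_le => s us; apply: le_trans (hB s us).
apply: ler_sum => n _; rewrite nmM nmX ler_wpM2l ?nm_ge0 //.
by rewrite lerXn2r // nnegrE ?nm_ge0 // (le_trans (nm_ge0 h)).
Qed.

Lemma csum_nat_recl (f : nat -> C) : asum f -> csum f = f 0%N + csum (f \o S).
Proof.
move=> af.
have [E af0] : hsum (fun _ : unit => f 0%N) (f 0%N) /\ asum (fun _ : unit => f 0%N).
  have [|E a] := @csum_fin _ _ (fun _ : unit => f 0%N) [:: tt] erefl; first by case.
  by rewrite big_seq1 in E.
have [||||||_ ->] := @csum_split _ _ _ _ (fun _ : unit => 0%N) S f.
- by case=> -[].
- exact: succn_inj.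
- by [].
- by case=> [|n]; [left; exists tt|right; exists n].
- exact: af0.
- by apply: asum_comp => //; exact: succn_inj.
by rewrite (hsum_csum E).
Qed.

Lemma pconv_shift c r k : 0 < r -> pconv c r -> pconv (fun n => c (n + k)%N) r.
Proof.
move=> r0 hc.
have rk : 0 <= (r ^+ k)^-1 by rewrite invr_ge0 exprn_ge0 // ltW.
apply: rbdd_le (rbddZ rk (rbdd_comp (@addIn k) hc)) => n /=.
by rewrite exprD [X in _ <= X]mulrC !mulrA mulfK // expf_neq0 // gt_eqF.
Qed.

Lemma pse_recl c r h : 0 < r -> pconv c r -> nm h <= r ->
  pse c h = c 0%N + h * pse (fun n => c n.+1) h.
Proof.
move=> r0 hc hr; rewrite /pse csum_nat_recl ?expr0 ?mulr1; last exact: pconv_asum hc hr.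
congr (_ + _); rewrite -csumZ.
  by apply: eq_csum => n /=; rewrite exprS mulrCA.
have := pconv_asum (pconv_shift 1 r0 hc) hr.
by apply: eq_asum => n; rewrite addn1.
Qed.

Lemma pse_take c r h k : 0 < r -> pconv c r -> nm h <= r ->
  pse c h = \sum_(i < k) c i * h ^+ i + h ^+ k * pse (fun n => c (n + k)%N) h.
Proof.
move=> r0 hc hr; elim: k => [|k ->].
  rewrite big_ord0 add0r expr0 mul1r; congr pse.
  by apply/funext => n; rewrite addn0.
rewrite (pse_recl r0 (pconv_shift k r0 hc) hr) big_ord_recr /= add0n -addrA.
have -> : (fun n => c (n.+1 + k)%N) = (fun n => c (n + k.+1)%N).
  by apply/funext => n; rewrite addSnnS.
by rewrite mulrDr [h ^+ k * c k]mulrC exprSr -mulrA.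
Qed.

Lemma pse_remainder c r k : 0 < r -> pconv c r ->
  exists2 B, 0 <= B & forall h, nm h <= r ->
    nm (pse c h - \sum_(i < k) c i * h ^+ i) <= B * nm h ^+ k.
Proof.
move=> r0 hc; have [B B0 hB] := pse_bound (pconv_shift k r0 hc).
exists B => // h hr; rewrite (pse_take k r0 hc hr) addrC addKr nmM nmX mulrC.
by rewrite ler_wpM2r ?exprn_ge0 ?nm_ge0 // hB.
Qed.

Lemma pse0 c : pse c 0 = c 0%N.
Proof.
have [|h _] := @csum_fin _ _ (fun n => c n * 0 ^+ n) [:: 0%N] erefl.
  by move=> [|n] //; rewrite exprS mul0r mulr0.
by rewrite /pse (hsum_csum h) big_seq1 expr0 mulr1.
Qed.

Lemma pse_lim0 c r : 0 < r -> pconv c r ->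
  (forall e, 0 < e -> exists2 h, nm h < e & pse c h = 0) -> c 0%N = 0.
Proof.
move=> r0 hc hz; have [B B0 hB] := pse_remainder 1 r0 hc.
apply: nm_small_eq0 => e e0.
have e1 : 0 < Num.min r (e / (B + 1)) by rewrite lt_min r0 divr_gt0 //; lra.
have [h] := hz _ e1; rewrite lt_min => /andP[/ltW hr he] ph.
have := hB h hr; rewrite ph big_ord1 expr0 mulr1 sub0r nmN expr1 => /le_trans; apply.
have B1 : 0 < B + 1 by lra.
move: he; rewrite ltr_pdivlMr // => he; apply: le_trans (ltW he).
by rewrite mulrDr mulr1 mulrC lerDl nm_ge0.
Qed.

(** Strong induction: when the lower coefficients vanish, dividing by [h ^+ n] leaves a series with
    constant term [c n] and zeros arbitrarily close to [0]. *)
Lemma pse_frequently0 c r : 0 < r -> pconv c r ->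
  (forall e, 0 < e -> exists h, [/\ h != 0, nm h < e & pse c h = 0]) ->
  forall n, c n = 0.
Proof.
move=> r0 hc hz n; have [k] := ubnP n; elim: k n => // k IH n nk.
apply: (pse_lim0 (c := fun i => c (i + n)%N) r0 (pconv_shift n r0 hc)) => e e0.
have [|h [hn0]] := hz (Num.min e r); first by rewrite lt_min e0.
rewrite lt_min => /andP[he /ltW hr] ph; exists h => //.
move: ph; rewrite (pse_take n r0 hc hr) big1 ?add0r; last first.
  by move=> i _; rewrite IH ?mul0r // (leq_trans (ltn_ord i)).
by move=> /eqP; rewrite mulf_eq0 expf_eq0 (negbTE hn0) andbF /= => /eqP.
Qed.

Lemma pseB c d r h : pconv c r -> pconv d r -> nm h <= r ->
  pse (fun n => c n - d n) h = pse c h - pse d h.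
Proof.
move=> hc hd hr; rewrite -csumB; [|exact: pconv_asum hc hr|exact: pconv_asum hd hr].
by apply: eq_csum => n; rewrite mulrBl.
Qed.

Lemma pseD c d r h : pconv c r -> pconv d r -> nm h <= r ->
  pse (fun n => c n + d n) h = pse c h + pse d h.
Proof.
move=> hc hd hr; rewrite -csumD; [|exact: pconv_asum hc hr|exact: pconv_asum hd hr].
by apply: eq_csum => n; rewrite mulrDl.
Qed.

Lemma pseZ a c r h : pconv c r -> nm h <= r ->
  pse (fun n => a * c n) h = a * pse c h.
Proof.
move=> hc hr; rewrite -csumZ; last exact: pconv_asum hc hr.
by apply: eq_csum => n; rewrite mulrA.
Qed.

Lemma pconvD c d r : 0 <= r -> pconv c r -> pconv d r -> pconv (fun n => c n + d n) r.
Proof.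
move=> r0 hc hd; apply: rbdd_le (rbddD hc hd) => n.
by rewrite -mulrDl ler_wpM2r ?exprn_ge0 // nmD.
Qed.

Lemma pconvZ a c r : pconv c r -> pconv (fun n => a * c n) r.
Proof.
by move=> hc; apply: rbdd_le (rbddZ (nm_ge0 a) hc) => n; rewrite nmM mulrA.
Qed.

Lemma pconvB c d r : 0 <= r -> pconv c r -> pconv d r -> pconv (fun n => c n - d n) r.
Proof.
move=> r0 hc hd; have := pconvD r0 hc (pconvZ (-1) hd).
by congr pconv; apply/funext => n; rewrite mulN1r.
Qed.

Lemma pse_unique c d r : 0 < r -> pconv c r -> pconv d r ->
  (forall e, 0 < e -> exists h, [/\ h != 0, nm h < e & pse c h = pse d h]) ->
  c = d.
Proof.
move=> r0 hc hd hz; apply/funext => n; apply/eqP; rewrite -subr_eq0; apply/eqP.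
apply: (pse_frequently0 (c := fun i => c i - d i) r0); first exact: pconvB (ltW r0) hc hd.
move=> e e0; have [|h [hn0]] := hz (Num.min e r); first by rewrite lt_min e0.
rewrite lt_min => /andP[he /ltW hr] ph; exists h; split => //.
by rewrite (pseB hc hd hr) ph subrr.
Qed.

Definition pshift k c n : C := if (n < k)%N then 0 else c (n - k)%N.

Lemma pshift_comp k c : pshift k c \o addn k = c.
Proof. by apply/funext => n; rewrite /pshift /= ltnNge leq_addr /= addKn. Qed.

Lemma pshift_out k c n : (forall m, (k + m)%N <> n) -> pshift k c n = 0.
Proof.
move=> hn; rewrite /pshift; case: ltnP => // kn.
by case: (hn (n - k)%N); rewrite subnKC.
Qed.

Lemma pconv_pshift k c r : 0 <= r -> pconv c r -> pconv (pshift k c) r.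
Proof.
move=> r0 hc.
apply: (@rbdd_inj _ _ (addn k)); first by move=> n hn; rewrite pshift_out // nm0 mul0r.
apply: rbdd_le (rbddZ (exprn_ge0 k r0) hc) => n /=.
have /(congr1 (fun f => f n)) /= -> := pshift_comp k c.
by rewrite exprD mulrCA.
Qed.

Lemma pse_pshift k c r h : pconv c r -> nm h <= r ->
  pse (pshift k c) h = h ^+ k * pse c h.
Proof.
move=> hc hr; rewrite /pse (csum_inj (h := addn k)).
- rewrite -csumZ; last exact: pconv_asum hc hr.
  apply: eq_csum => n /=; have /(congr1 (fun f => f n)) /= -> := pshift_comp k c.
  by rewrite exprD mulrCA.
- by move=> m n /addnI.
- by move=> n /pshift_out ->; rewrite mul0r.
- have := asumZ (h ^+ k) (pconv_asum hc hr); apply: eq_asum => n /=.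
  have /(congr1 (fun f => f n)) /= -> := pshift_comp k c.
  by rewrite exprD mulrCA.
Qed.

Definition pmul c d n : C := \sum_(i < n.+1) c i * d (n - i)%N.

Lemma pconv_pmul c d r : 0 <= r -> pconv c r -> pconv d r -> pconv (pmul c d) r.
Proof.
move=> r0 hc hd; have rb : asum (fun p : nat * nat => ((nm (c p.1) * r ^+ p.1) * (nm (d p.2) * r ^+ p.2))%:C).
  apply: rbdd_le (rbdd_prod _ _ hc hd) => p /=.
  - by rewrite nm_real ger0_norm // !mulr_ge0 ?nm_ge0 ?exprn_ge0.
  - by rewrite mulr_ge0 ?nm_ge0 ?exprn_ge0.
  - by rewrite mulr_ge0 ?nm_ge0 ?exprn_ge0.
have [a _] := csum_antidiag rb; apply: rbdd_le a => n.
rewrite -raddf_sum nm_real ger0_norm; last first.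
  by apply: sumr_ge0 => i _; rewrite !mulr_ge0 ?nm_ge0 ?exprn_ge0.
apply: (@le_trans _ _ ((\sum_(i < n.+1) nm (c i * d (n - i)%N)) * r ^+ n)).
  by rewrite ler_wpM2r ?exprn_ge0 // nm_sum.
rewrite mulr_suml; apply: ler_sum => i _ /=.
have -> : r ^+ n = r ^+ i * r ^+ (n - i) by rewrite -exprD subnKC // -ltnS.
by rewrite nmM mulrACA.
Qed.

Lemma pse_pmul c d r h : pconv c r -> pconv d r -> nm h <= r ->
  pse (pmul c d) h = pse c h * pse d h.
Proof.
move=> hc hd hr; have ac := pconv_asum hc hr; have ad := pconv_asum hd hr.
rewrite csum_prod //; have [_ ->] := csum_antidiag (asum_prod ac ad).
apply: eq_csum => n /=; rewrite mulr_suml; apply: eq_bigr => i _.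
have -> : h ^+ n = h ^+ i * h ^+ (n - i) by rewrite -exprD subnKC // -ltnS.
by rewrite mulrACA.
Qed.

(* Coefficients of the reciprocal of a power series, meaningful when c 0 != 0. *)
Fixpoint prec_seq (c : nat -> C) n : seq C :=
  if n is n'.+1 then
    let s := prec_seq c n' in
    rcons s (((n' == 0%N)%:R - \sum_(j < n') c (n' - j)%N * s`_j) / c 0%N)
  else [::].

Definition prec c n := (prec_seq c n.+1)`_n.

Lemma size_prec_seq c n : size (prec_seq c n) = n.
Proof. by elim: n => //= n IH; rewrite size_rcons IH. Qed.

Lemma nth_prec_seq c n j : (j < n)%N -> (prec_seq c n)`_j = prec c j.
Proof.
elim: n => // n IH; rewrite ltnS leq_eqVlt => /orP[/eqP ->//|jn].
by rewrite /= nth_rcons size_prec_seq jn IH.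
Qed.

Lemma precE c n :
  prec c n = ((n == 0%N)%:R - \sum_(j < n) c (n - j)%N * prec c j) / c 0%N.
Proof.
rewrite {1}/prec /= nth_rcons size_prec_seq ltnn eqxx.
by congr ((_ - _) / _); apply: eq_bigr => j _; rewrite nth_prec_seq.
Qed.

Lemma pmul_prec c n : c 0%N != 0 -> pmul (prec c) c n = (n == 0%N)%:R.
Proof.
move=> c0; rewrite /pmul big_ord_recr /= subnn precE divfK //.
by under eq_bigr do rewrite mulrC; rewrite addrC subrK.
Qed.

Lemma pconv_prec c r : 0 < r -> pconv c r -> c 0%N != 0 ->
  exists2 r', 0 < r' <= r & pconv (prec c) r'.
Proof.
move=> r0 [B hB] c0; have a0 : 0 < nm (c 0%N) by rewrite nm_gt0.
have B0 : 0 <= B by have := hB [::] erefl; rewrite big_nil.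
(* [t] is chosen so that [t <= 1] and [t * B <= a]. The recursion [precE] then preserves the bound
   [a^-1] on the terms at radius [t * r], because each [c (n - j)] in it has positive index and
   contributes a factor at most [t]. *)
set a := nm (c 0%N) in a0; pose t := a / (B + a).
have t0 : 0 < t by rewrite divr_gt0 //; lra.
have t1 : t <= 1 by rewrite ler_pdivrMr; lra.
have tB : t * B <= a by rewrite /t mulrAC ler_pdivrMr; nra.
pose rho := t * r; have rho0 : 0 < rho by rewrite mulr_gt0.
have bnd n : nm (prec c n) * rho ^+ n <= a^-1.
  have [k] := ubnP n; elim: k n => // k IH n nk.
  rewrite precE nmM nmV -/a mulrAC -[X in _ <= X]mul1r ler_pM2r ?invr_gt0 //.
  case: n nk => [|n] nk.
    by rewrite big_ord0 subr0 nm1 mul1r.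
  rewrite sub0r nmN; apply: le_trans (_ : (\sum_(j < n.+1) nm (c (n.+1 - j)%N) * nm (prec c j)) * rho ^+ n.+1 <= _).
    rewrite ler_wpM2r ?exprn_ge0 ?(ltW rho0) //; apply: le_trans (nm_sum _ _ _) _.
    by apply: ler_sum => j _; rewrite nmM.
  rewrite mulr_suml.
  apply: (@le_trans _ _ (\sum_(j < n.+1) (nm (c (n.+1 - j)%N) * r ^+ (n.+1 - j)) * (t * a^-1))).
    apply: ler_sum => j _.
    rewrite -[X in _ ^+ X](subnK (ltnW (ltn_ord j))) exprD mulrACA [X in _ <= X]mulrA.
    apply: ler_pM.
    - by rewrite mulr_ge0 ?nm_ge0 ?exprn_ge0 ?ltW.
    - by rewrite mulr_ge0 ?nm_ge0 ?exprn_ge0 ?ltW.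
    - rewrite -mulrA ler_wpM2l ?nm_ge0 // exprMn mulrC ler_wpM2l ?exprn_ge0 ?(ltW r0) //.
      rewrite -{2}[t]expr1 ler_wiXn2l ?(ltW t0) // subn_gt0; exact: ltn_ord.
    - by apply: IH; apply: leq_trans (ltn_ord j) _.
  rewrite -mulr_suml mulrA ler_pdivrMr // mul1r.
  apply: le_trans tB; rewrite mulrC ler_wpM2l ?(ltW t0) //.
  have := hB [seq (n.+1 - j)%N | j <- index_iota 0 n.+1]; rewrite big_map big_mkord; apply.
  rewrite map_inj_in_uniq ?iota_uniq // => x y; rewrite !mem_index_iota /=; lia.
(* Terms bounded at radius [rho] are dominated by a geometric series at half that radius. *)
exists (rho / 2); first by rewrite divr_gt0 //= ler_pdivrMr // /rho; nra.
have g : rbdd (fun n => a^-1 * (2^-1 : R) ^+ n).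
  by apply: rbddZ; [rewrite invr_ge0 ltW|apply: rbdd_geo; lra].
apply: rbdd_le g => n; rewrite exprMn mulrA ler_wpM2r ?exprn_ge0 ?invr_ge0 //.
Qed.

End PowerSeries.

(** * Analytic and meromorphic functions *)

Section Recenter.
Context {R : realType}.
Local Notation C := R[i].
Implicit Types (c d : nat -> C) (h z w s : C) (r t : R).

(** The [k]-th derivative divided by [k!]: with this normalisation its value at [h] is directly the
    [k]-th Taylor coefficient at [h]. *)
Definition pderiv k c n : C := 'C(n + k, k)%:R * c (n + k)%N.

Let F c h s (p : nat * nat) : C := c p.1 * ('C(p.1, p.2)%:R * h ^+ (p.1 - p.2) * s ^+ p.2).

Lemma binomial_sum_index (h s : C) n (u : seq nat) : uniq u ->
  \sum_(k <- u) nm ('C(n, k)%:R * h ^+ (n - k) * s ^+ k) <= (nm h + nm s) ^+ n.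
Proof.
move=> uu; apply: le_trans (_ : \sum_(k <- index_iota 0 n.+1) nm ('C(n, k)%:R * h ^+ (n - k) * s ^+ k) <= _).
  apply: sum_fin_le => // k; first exact: nm_ge0.
  by rewrite mem_index_iota /= ltnS -ltnNge => nk; rewrite bin_small // !mul0r nm0.
rewrite big_mkord exprDn; apply: ler_sum => k _.
by rewrite !nmM nm_nat !nmX -mulrA mulr_natl.
Qed.

Lemma recenter_asum c r h s : pconv c r -> nm h + nm s <= r -> asum (F c h s).
Proof.
move=> hc hr; apply: (@asum_pair _ _ _ _ (fun n => nm (c n) * r ^+ n)); last exact: hc.
move=> n u uu; rewrite /F /=.
apply: (@le_trans _ _ (nm (c n) * \sum_(k <- u) nm ('C(n, k)%:R * h ^+ (n - k) * s ^+ k))).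
  by rewrite mulr_sumr; apply: ler_sum => k _; rewrite nmM.
rewrite ler_wpM2l ?nm_ge0 //; apply: le_trans (binomial_sum_index h s n uu) _.
by rewrite lerXn2r // nnegrE ?addr_ge0 ?nm_ge0 // (le_trans _ hr) ?addr_ge0 ?nm_ge0.
Qed.

Lemma csum_pderiv c h k : asum (fun n => c n * ('C(n, k)%:R * h ^+ (n - k))) ->
  csum (fun n => c n * ('C(n, k)%:R * h ^+ (n - k))) = pse (pderiv k c) h.
Proof.
move=> a; rewrite (csum_inj (h := addn^~ k)).
- by apply: eq_csum => n; rewrite /= /pderiv addnK mulrCA mulrA mulrC mulrA mulrC.
- exact: addIn.
- move=> n hn; rewrite bin_small ?mul0r ?mulr0 //.
  by rewrite ltnNge; apply/negP => kn; apply: (hn (n - k)%N); rewrite subnK.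
- by apply: asum_comp => //; exact: addIn.
Qed.

Lemma pconv_pderiv c k r r' : 0 <= r' -> r' < r -> pconv c r -> pconv (pderiv k c) r'.
Proof.
move=> r0 rr hc; pose s := (r - r')%:C.
have ns : nm s = r - r' by rewrite nm_real ger0_norm; lra.
have nr : nm r'%:C = r' by rewrite nm_real ger0_norm.
have hr : nm r'%:C + nm s <= r by rewrite ns nr; lra.
have /asum_swap/(asum_fst k) /= a := recenter_asum hc hr.
have sk : s ^+ k != 0 by rewrite expf_neq0 // -nm_gt0 ns; lra.
have := asum_comp (@addIn k) (asumZr (s ^+ k)^-1 a).
apply: rbdd_le => n; rewrite /= /F /= !mulrA mulfK // addnK /pderiv.
by rewrite !nmM [nm (c _) * _]mulrC nmX nr.
Qed.

(** The binomial expansion of [(h + s) ^+ n] is a double series, absolutely convergent because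
    [nm h + nm s <= r], and is summed in the other order. The case [s = 0] is separate since
    summability of a column is obtained after dividing by [s ^+ k]. *)
Lemma recenter c r h : 0 < r -> pconv c r -> nm h < r ->
  let T k := pse (pderiv k c) h in
  pconv T (r - nm h) /\ forall s, nm s <= r - nm h -> pse c (h + s) = pse T s.
Proof.
move=> r0 hc hr T.
have TE s k : nm s <= r - nm h -> s != 0 -> csum (fun n => F c h s (n, k)) = T k * s ^+ k.
  move=> hs s0; have hr' : nm h + nm s <= r by lra.
  have /asum_swap/(asum_fst k) /= a := recenter_asum hc hr'.
  have sk : s ^+ k != 0 by rewrite expf_neq0.
  have a' : asum (fun n => c n * ('C(n, k)%:R * h ^+ (n - k))).
    by have := asumZr (s ^+ k)^-1 a; apply: eq_asum => n; rewrite /F /= !mulrA mulfK.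
  rewrite /T -(csum_pderiv a') -csumZr //.
  by apply: eq_csum => n; rewrite /F /= !mulrA.
split.
  pose s := (r - nm h)%:C; have ns : nm s = r - nm h by rewrite nm_real ger0_norm; lra.
  have hr' : nm h + nm s <= r by rewrite ns; lra.
  have s0 : s != 0 by rewrite -nm_gt0 ns; lra.
  have := asum_csum (asum_swap (recenter_asum hc hr')).
  apply: rbdd_le => k; rewrite /= TE ?ns // nmM nmX ns //.
move=> s hs; have [->|s0] := eqVneq s 0.
  rewrite addr0 pse0 /T; congr pse; apply/funext => n.
  by rewrite /pderiv addn0 bin0 mul1r.
have hr' : nm h + nm s <= r by lra.
rewrite {2}/pse -(eq_csum (fun k => TE s k hs s0)).
rewrite -(csum_exchange (recenter_asum hc hr')).
apply: eq_csum => n.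
have [|/hsum_csum E _] := @csum_fin _ _ (fun k => F c h s (n, k)) (index_iota 0 n.+1) (iota_uniq _ _).
  by move=> k; rewrite mem_index_iota /= ltnS -ltnNge => nk; rewrite /F /= bin_small // !mul0r mulr0.
rewrite E big_mkord /F /= -mulr_sumr exprDn; congr (_ * _); apply: eq_bigr => k _.
by rewrite -mulrA mulr_natl.
Qed.

End Recenter.

Section LocalPowerSeries.
Context {R : realType}.
Local Notation C := R[i].
Implicit Types (c d : nat -> C) (h z w s : C) (r t : R) (f g : C -> C).

Definition has_ps f z c :=
  exists2 r, 0 < r & pconv c r /\ forall h, nm h <= r -> f (z + h) = pse c h.

Definition has_pole f z N c :=
  exists2 r, 0 < r & pconv c r /\
    forall h, h != 0 -> nm h <= r -> h ^+ N * f (z + h) = pse c h.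

(** Abel's lemma: convergence bounds the terms, and half the radius compares them with a geometric
    series. The notions of the statement only speak of convergence, and this makes them absolute. *)
Lemma cvg_pconv c h : h != 0 -> cvgn (series (fun n => c n * h ^+ n)) ->
  pconv c (nm h / 2).
Proof.
move=> h0 /cvg_ex[l /cvgC_P hl]; have [N hN] := hl 1 ltr01.
have bnd n : (N <= n)%N -> nm (c n * h ^+ n) <= 2.
  move=> Nn; have h1 := hN n.+1 (leqW Nn); have h2 := hN n Nn.
  have -> : c n * h ^+ n = series (fun n => c n * h ^+ n) n.+1 - series (fun n => c n * h ^+ n) n.
    by rewrite /series /= big_nat_recr //= [RHS]addrC addKr.
  have := nm_triangle (series (fun n => c n * h ^+ n) n.+1) l (series (fun n => c n * h ^+ n) n).
  rewrite [nm (l - _)]nm_distC; lra.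
pose B := 2 + \sum_(i < N) nm (c i * h ^+ i).
have B0 : 0 <= \sum_(i < N) nm (c i * h ^+ i) by apply: sumr_ge0 => i _; exact: nm_ge0.
have bnd' n : nm (c n) * nm h ^+ n <= B.
  rewrite -nmX -nmM; case: (leqP N n) => [/bnd|nN]; first by rewrite /B; lra.
  rewrite /B (bigD1 (Ordinal nN)) //= addrCA lerDl addr_ge0 //.
  by apply: sumr_ge0 => i _; exact: nm_ge0.
have g : rbdd (fun n => B * (2^-1 : R) ^+ n).
  by apply: rbddZ; [rewrite /B; lra|apply: rbdd_geo; lra].
by apply: rbdd_le g => n; rewrite exprMn mulrA ler_wpM2r ?exprn_ge0.
Qed.

Lemma cvg_has_ps f z c :
  (\forall w \near z, series (fun n => c n * (w - z) ^+ n) @ \oo --> f w) ->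
  has_ps f z c.
Proof.
move=> /nbhsC_P[d d0 hd]; pose h0 : C := (d / 2)%:C.
have nh0 : nm h0 = d / 2 by rewrite nm_real ger0_norm; lra.
have hc : pconv c (d / 2 / 2).
  rewrite -nh0; apply: cvg_pconv; first by rewrite -nm_gt0 nh0; lra.
  apply/cvg_ex; exists (f (z + h0)).
  by have := hd (z + h0); rewrite addr_subl nh0; apply; lra.
exists (d / 2 / 2); first lra.
split=> // h hr; apply: (@cvgC_unique _ (series (fun n => c n * h ^+ n))).
  by have := hd (z + h); rewrite addr_subl; apply; lra.
by apply: csum_nat; exact: pconv_asum hc hr.
Qed.

Lemma has_ps_near f z c : has_ps f z c ->
  \forall w \near z, series (fun n => c n * (w - z) ^+ n) @ \oo --> f w.
Proof.
move=> [r r0 [hc hf]]; apply/nbhsC_P; exists r => // w /ltW hw.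
rewrite -[in f w](subrKC z w) hf //; apply: csum_nat; exact: pconv_asum hc hw.
Qed.

Lemma has_ps_analytic f z c : has_ps f z c -> analytic_at f z.
Proof. by move=> /has_ps_near h; exists c. Qed.

Lemma analytic_has_ps f z : analytic_at f z -> exists c, has_ps f z c.
Proof. by move=> [c h]; exists c; exact: cvg_has_ps. Qed.

Lemma pole_has_pole f z : pole_at f z ->
  exists N c, [/\ (0 < N)%N, c 0%N != 0 & has_pole f z N c].
Proof.
move=> [N [c [N0 c0 hd]]]; exists N, c; split => //.
(* Filling the puncture with [c 0] turns the Laurent condition into an ordinary power series, to
   which [cvg_has_ps] applies. *)
pose g w := if w == z then c 0%N else (w - z) ^+ N * f w.
have /cvg_has_ps[r r0 [hc hg]] :
    \forall w \near z, series (fun n => c n * (w - z) ^+ n) @ \oo --> g w.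
  move/nbhsC_dP : hd => [d d0 hd]; apply/nbhsC_P; exists d => // w hw.
  rewrite /g; case: eqP => [->|/eqP wz]; last exact: hd.
  rewrite -[c 0%N]pse0 subrr; apply: csum_nat.
  have [|_ a //] := @csum_fin _ _ (fun n => c n * (0 : C) ^+ n) [:: 0%N] erefl.
  by move=> [|n] //; rewrite exprS mul0r mulr0.
exists r => //; split => // h h0 hr; rewrite -hg // /g.
rewrite ifF; first by rewrite addr_subl.
by apply/negbTE; rewrite -subr_eq0 addr_subl.
Qed.

Lemma has_pole_pole f z N c : (0 < N)%N -> c 0%N != 0 -> has_pole f z N c -> pole_at f z.
Proof.
move=> N0 c0 [r r0 [hc hf]]; exists N, c; split => //.
apply/nbhsC_dP; exists r => // w wz /ltW hw.
have -> : (w - z) ^+ N * f w = pse c (w - z).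
  by rewrite -hf ?subr_eq0 // subrKC.
by apply: csum_nat; exact: pconv_asum hc hw.
Qed.

Lemma has_ps_unique f z c d : has_ps f z c -> has_ps f z d -> c = d.
Proof.
move=> [r r0 [hc hf]] [r' r0' [hd hf']].
have m0 : 0 < Num.min r r' by rewrite lt_min r0.
apply: (pse_unique m0).
- by apply: pconv_le hc; rewrite ?ge_min ?lexx // ltW.
- by apply: pconv_le hd; rewrite ?ge_min ?lexx ?orbT // ltW.
move=> e e0; pose h : C := (Num.min r (Num.min r' e) / 2)%:C.
have m1 : 0 < Num.min r (Num.min r' e) by rewrite !lt_min r0 r0'.
have nh : nm h = Num.min r (Num.min r' e) / 2 by rewrite nm_real ger0_norm; lra.
have hh : nm h < Num.min r (Num.min r' e) by rewrite nh; lra.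
move: (hh); rewrite !lt_min => /and3P[h1 h2 h3].
exists h; split => //; first by rewrite -nm_gt0 nh; lra.
by rewrite -hf ?hf' // ltW.
Qed.

(** Where [f] has no power series all coefficients are [0], which agrees with the value [0]
    prescribed at poles. *)
Definition taylor f z : nat -> C := xget (fun=> 0) [set c | has_ps f z c].

Lemma taylorE f z c : has_ps f z c -> taylor f z = c.
Proof.
move=> h; rewrite /taylor; case: xgetP => [d _ hd|nh]; last by case: (nh c).
exact: has_ps_unique hd h.
Qed.

Lemma has_ps_val f z c : has_ps f z c -> f z = c 0%N.
Proof.
by move=> [r r0 [hc hf]]; rewrite -[z in LHS]addr0 hf ?pse0 // nm0 ltW.
Qed.

Lemma has_ps_ext f g z c r : 0 < r -> (forall h, nm h <= r -> f (z + h) = g (z + h)) ->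
  has_ps f z c -> has_ps g z c.
Proof.
move=> r0 fg [r' r0' [hc hf]]; exists (Num.min r r'); first by rewrite lt_min r0.
split; first by apply: pconv_le hc; rewrite ?ge_min ?lexx ?orbT // le_min !ltW.
by move=> h; rewrite le_min => /andP[h1 h2]; rewrite -fg // hf.
Qed.

Lemma has_psM f g z c d : has_ps f z c -> has_ps g z d ->
  has_ps (fun w => f w * g w) z (pmul c d).
Proof.
move=> [r r0 [hc hf]] [r' r0' [hd hg]]; exists (Num.min r r'); first by rewrite lt_min r0.
have m0 : 0 <= Num.min r r' by rewrite le_min !ltW.
have hc' : pconv c (Num.min r r') by apply: pconv_le hc; rewrite ?ge_min ?lexx.
have hd' : pconv d (Num.min r r') by apply: pconv_le hd; rewrite ?ge_min ?lexx ?orbT.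
split; first exact: pconv_pmul.
move=> h hr; rewrite (pse_pmul hc' hd' hr).
by move: hr; rewrite le_min => /andP[h1 h2]; rewrite hf // hg.
Qed.

Lemma has_psV f z c : has_ps f z c -> f z != 0 -> exists d, has_ps (fun w => (f w)^-1) z d.
Proof.
move=> hps; have := has_ps_val hps => ->; case: hps => r r0 [hc hf] c0.
have [r' /andP[r0' rr'] hp] := pconv_prec r0 hc c0.
exists (prec c), r' => //; split => // h hr.
have hc' : pconv c r' by apply: pconv_le hc => //; exact: ltW.
have E : pse (prec c) h * pse c h = 1.
  rewrite -(pse_pmul hp hc' hr).
  have [|/hsum_csum E _] := @csum_fin _ _ (fun n => pmul (prec c) c n * h ^+ n) [:: 0%N] erefl.
    by move=> [|n] // _; rewrite pmul_prec // mul0r.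
  by rewrite /pse E big_seq1 pmul_prec // expr0 mulr1.
rewrite hf; last exact: le_trans hr rr'.
have p0 : pse c h != 0 by apply/eqP => p0; move: E; rewrite p0 mulr0 => /esym/eqP; rewrite oner_eq0.
by apply: (mulIf p0); rewrite E mulVf.
Qed.

Lemma has_ps_quot f g z c d : has_ps f z c -> has_ps g z d -> g z != 0 ->
  exists e, has_ps (fun w => f w / g w) z e.
Proof.
by move=> hf hg g0; have [e he] := has_psV hg g0; exists (pmul c e); exact: has_psM.
Qed.

Lemma has_ps_recenter f z c : has_ps f z c -> exists2 r, 0 < r &
  forall h, nm h <= r -> has_ps f (z + h) (fun k => pse (pderiv k c) h).
Proof.
move=> [r r0 [hc hf]]; exists (r / 2); first lra.
move=> h hr; have hr' : nm h < r by lra.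
have [T1 T2] := recenter r0 hc hr'.
exists (r - nm h); first lra.
split=> // s hs; rewrite -T2 // -addrA hf //.
by have := nmD h s; lra.
Qed.

Lemma has_ps_taylor f z c k : has_ps f z c ->
  has_ps (fun w => taylor f w k) z (pderiv k c).
Proof.
move=> hps; have [r r0 hr] := has_ps_recenter hps.
have [r' r0' [hc _]] := hps.
have m0 : 0 < Num.min r (r' / 2) by rewrite lt_min r0; lra.
exists (Num.min r (r' / 2)) => //; split.
  by apply: pconv_pderiv hc; [exact: ltW|rewrite gt_min; apply/orP; right; lra].
by move=> h; rewrite le_min => /andP[h1 _]; rewrite (taylorE (hr h h1)).
Qed.

Lemma has_ps_cont f z c : has_ps f z c -> forall e, 0 < e ->
  exists2 d, 0 < d & forall h, nm h < d -> nm (f (z + h) - f z) < e.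
Proof.
move=> hps e e0; have fz := has_ps_val hps; case: hps => r r0 [hc hf].
have [B B0 hB] := pse_remainder 1 r0 hc; have B1 : 0 < B + 1 by lra.
exists (Num.min r (e / (B + 1))); first by rewrite lt_min r0 divr_gt0.
move=> h; rewrite lt_min => /andP[/ltW h1 h2]; rewrite hf // fz.
have := hB h h1; rewrite big_ord1 expr0 mulr1 expr1 => /le_lt_trans; apply.
move: h2; rewrite ltr_pdivlMr // => h2; apply: le_lt_trans h2.
by rewrite mulrDr mulr1 mulrC lerDl nm_ge0.
Qed.

End LocalPowerSeries.

Section Meromorphic.
Context {R : realType}.
Local Notation C := R[i].
Implicit Types (c d : nat -> C) (h z w s : C) (r t : R) (f g : C -> C).

Lemma small_real r : 0 < r -> exists2 h : C, h != 0 & nm h < r.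
Proof.
move=> r0; have nh : nm (r / 2)%:C = r / 2 by rewrite nm_real ger0_norm; lra.
by exists (r / 2)%:C; rewrite -?nm_gt0 nh; lra.
Qed.

Lemma meromorphicP f : meromorphic f <-> forall z,
  (exists c, has_ps f z c) \/
  (exists N c, [/\ (0 < N)%N, c 0%N != 0, has_pole f z N c & f z = 0]).
Proof.
split=> h z; case: (h z).
- by move=> /analytic_has_ps; left.
- by move=> [/pole_has_pole[N [c [? ? ?]]] ?]; right; exists N, c.
- by move=> [c /has_ps_analytic]; left.
- by move=> [N [c [N0 c0 hp fz]]]; right; split => //; exact: has_pole_pole hp.
Qed.

Lemma entire_meromorphic f : entire f -> meromorphic f.
Proof. by move=> h z; left. Qed.

Lemma has_ps_has_pole0 f z c : has_ps f z c -> has_pole f z 0 c.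
Proof.
by move=> [r r0 [hc hf]]; exists r => //; split=> // h _ hr; rewrite expr0 mul1r hf.
Qed.

Lemma has_pole_ext f g z N c r : 0 < r ->
  (forall h, h != 0 -> nm h <= r -> f (z + h) = g (z + h)) ->
  has_pole f z N c -> has_pole g z N c.
Proof.
move=> r0 fg [r' r0' [hc hf]]; exists (Num.min r r'); first by rewrite lt_min r0.
split; first by apply: pconv_le hc; rewrite ?ge_min ?lexx ?orbT // le_min !ltW.
by move=> h h0; rewrite le_min => /andP[h1 h2]; rewrite -fg // hf.
Qed.

Lemma has_poleZ a f z N c : has_pole f z N c ->
  has_pole (fun w => a * f w) z N (fun n => a * c n).
Proof.
move=> [r r0 [hc hf]]; exists r => //; split; first exact: pconvZ.
by move=> h h0 hr; rewrite (pseZ _ hc hr) -hf // mulrCA.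
Qed.

Lemma has_pole_raise f z N c k : has_pole f z N c -> has_pole f z (N + k) (pshift k c).
Proof.
move=> [r r0 [hc hf]]; exists r => //; split; first exact: pconv_pshift (ltW r0) hc.
by move=> h h0 hr; rewrite (pse_pshift _ hc hr) -hf // addnC exprD mulrA.
Qed.

(** If both held, [h ^+ N * f] would have two expansions, one of them without constant term. *)
Lemma has_ps_not_pole f z c N d : has_ps f z c -> (0 < N)%N -> d 0%N != 0 ->
  ~ has_pole f z N d.
Proof.
move=> [r r0 [hc hf]] N0 d0 [r' r0' [hd hf']].
have hN : pconv (pshift N c) r by exact: pconv_pshift (ltW r0) hc.
have m0 : 0 < Num.min r r' by rewrite lt_min r0.
suff E : d = pshift N c by move: d0; rewrite E /pshift N0 eqxx.
apply: (pse_unique m0).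
- by apply: pconv_le hd; rewrite ?ge_min ?lexx ?orbT // ltW.
- by apply: pconv_le hN; rewrite ?ge_min ?lexx // ltW.
move=> e e0; have [|h h0 hh] := @small_real (Num.min r (Num.min r' e)).
  by rewrite !lt_min r0 r0'.
move: hh; rewrite !lt_min => /and3P[/ltW h1 /ltW h2 h3]; exists h; split => //.
by rewrite -hf' // hf // (pse_pshift _ hc h1).
Qed.

Definition affine_coef (a b : C) n : C := if n is n'.+1 then (if n' is 0%N then b else 0) else a.

Lemma has_ps_affine a b z : has_ps (fun w => a + b * (w - z)) z (affine_coef a b).
Proof.
have c0 n : n \notin [:: 0; 1]%N -> forall h, affine_coef a b n * h ^+ n = 0.
  by case: n => [|[|n]] //= _ h; rewrite mul0r.
exists 1 => //; split.
  have [|_ c] := @csum_fin R _ (fun n => affine_coef a b n * 1 ^+ n) [:: 0; 1]%N erefl.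
    by move=> n /c0.
  by apply: rbdd_le c => n; rewrite nmM nmX nm1.
move=> h _; have [|/hsum_csum E _] :=
    @csum_fin R _ (fun n => affine_coef a b n * h ^+ n) [:: 0; 1]%N erefl.
  by move=> n /c0.
by rewrite /pse E big_cons big_seq1 /= expr0 mulr1 expr1 addr_subl.
Qed.

Lemma has_ps_lin z z' : has_ps (fun w => w - z) z' (affine_coef (z' - z) 1).
Proof.
apply: (has_ps_ext ltr01) (has_ps_affine _ _ _) => h _ /=.
by rewrite mul1r addr_subl addrAC.
Qed.

Lemma has_ps_cst (a : C) z : has_ps (fun=> a) z (affine_coef a 0).
Proof.
by apply: (has_ps_ext ltr01) (has_ps_affine _ _ _) => h _ /=; rewrite mul0r addr0.
Qed.

Lemma has_ps_linX z z' N : exists p, [/\ has_ps (fun w => (w - z) ^+ N) z' p,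
  p 0%N = (z' - z) ^+ N & p 1%N = N%:R * (z' - z) ^+ N.-1].
Proof.
elim: N => [|N [p [hp p0 p1]]].
  exists (affine_coef 1 0); split => //; last by rewrite mul0r.
  by under [X in has_ps X]funext do rewrite expr0; exact: has_ps_cst.
have hm := has_psM (has_ps_lin z z') hp.
eexists; split.
- by under [X in has_ps X]funext do rewrite exprS; exact: hm.
- by rewrite /pmul big_ord1 /= p0 exprS.
- rewrite /pmul big_ord_recr big_ord1 /= p1 p0 mul1r -[N.+1%:R]natr1 [RHS]mulrDl mul1r.
  by congr (_ + _); case: N {hp p0 p1 hm} => [|N]; rewrite ?mul0r ?mulr0 // mulrCA -exprS.
Qed.

Lemma has_ps_pse c r z : 0 < r -> pconv c r -> has_ps (fun w => pse c (w - z)) z c.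
Proof. by move=> r0 hc; exists r => //; split; [exact: hc|move=> h _; rewrite addr_subl]. Qed.

Lemma has_pole_punctured f z N c : has_pole f z N c -> exists2 r, 0 < r &
  forall h, h != 0 -> nm h <= r -> exists d, [/\ has_ps f (z + h) d,
    h ^+ N * d 0%N = pse c h &
    h ^+ N * d 1%N + N%:R * h ^+ N.-1 * d 0%N = pse (pderiv 1 c) h].
Proof.
move=> [r r0 [hc hf]]; have [r1 r10 hT] := has_ps_recenter (has_ps_pse z r0 hc).
exists (Num.min r1 (r / 2)); first by rewrite lt_min r10; lra.
move=> h h0; rewrite le_min => /andP[hr1 hr2].
have {}hT := hT h hr1; have [p [hp p0 p1]] := has_ps_linX z (z + h) N.
have zh : z + h - z = h by rewrite addr_subl.
rewrite zh in p0 p1.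
have nh : 0 < nm h by rewrite nm_gt0.
have [|e he] := has_ps_quot hT hp; first by rewrite zh expf_neq0.
have hfe : has_ps f (z + h) e.
  have m0 : 0 < Num.min (nm h / 2) (r / 2) by rewrite lt_min; lra.
  apply: (has_ps_ext m0) he => s; rewrite le_min => /andP[s1 s2].
  have hs0 : h + s != 0.
    by rewrite -nm_gt0; have := nmBr h (- s); rewrite opprK nmN; lra.
  rewrite -(addrA z) addr_subl -hf //; last by have := nmD h s; lra.
  by rewrite mulrC mulKf // expf_neq0.
have E : pmul p e = fun k => pse (pderiv k c) h.
  apply: has_ps_unique hT; have := has_psM hp hfe.
  have m0 : 0 < Num.min (nm h / 2) (r / 2) by rewrite lt_min; lra.
  apply: (has_ps_ext m0) => s; rewrite le_min => /andP[s1 s2].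
  have hs0 : h + s != 0.
    by rewrite -nm_gt0; have := nmBr h (- s); rewrite opprK nmN; lra.
  by rewrite -(addrA z) addr_subl -hf //; have := nmD h s; lra.
exists e; split => //.
  have /(congr1 (fun u => u 0%N)) := E; rewrite /pmul big_ord1 p0 => ->.
  by congr pse; apply/funext => n; rewrite /pderiv addn0 bin0 mul1r.
have /(congr1 (fun u => u 1%N)) := E; rewrite /pmul big_ord_recr big_ord1 /= p0 p1 => <-.
by [].
Qed.

Lemma pshift_pderiv1 c : pshift 1 (pderiv 1 c) = fun n => n%:R * c n.
Proof.
apply/funext => -[|n]; first by rewrite /pshift /= mul0r.
by rewrite /pshift /pderiv /= subn1 /= addn1 bin1.
Qed.

(** From [h^(N+1) f' = h (h^N f)' - N h^N f]. The leading coefficient is [- N c_0], so the pole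
    survives with its order raised by one. *)
Lemma has_pole_taylor1 f z N c : (0 < N)%N -> has_pole f z N c ->
  has_pole (fun w => taylor f w 1) z N.+1 (fun n => (n%:R - N%:R) * c n).
Proof.
move=> N0 hp; have [r r0 hr] := has_pole_punctured hp; have [r' r0' [hc _]] := hp.
have m0 : 0 < Num.min r (r' / 2) by rewrite lt_min r0; lra.
have hd : pconv (pderiv 1 c) (Num.min r (r' / 2)).
  by apply: pconv_pderiv hc; [exact: ltW|rewrite gt_min; apply/orP; right; lra].
have hc' : pconv c (Num.min r (r' / 2)).
  by apply: pconv_le hc; [exact: ltW|rewrite ge_min; apply/orP; right; lra].
have hs := pconv_pshift 1 (ltW m0) hd; rewrite pshift_pderiv1 in hs.
exists (Num.min r (r' / 2)) => //; split.
  have := pconvB (ltW m0) hs (pconvZ N%:R hc').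
  by congr pconv; apply/funext => n; rewrite mulrBl.
move=> h h0 hm.
have [|d [/taylorE -> E0 E1]] := hr h h0; first by move: hm; rewrite le_min => /andP[].
have -> : (fun n => (n%:R - N%:R) * c n) = fun n => n%:R * c n - N%:R * c n.
  by apply/funext => n; rewrite mulrBl.
rewrite (pseB hs (pconvZ N%:R hc') hm) (pseZ _ hc' hm) -pshift_pderiv1 (pse_pshift _ hd hm).
rewrite -E1 -E0 expr1 mulrDr exprS -!mulrA; case: N N0 {hp hr E0 E1 hs} => // N _ /=.
by rewrite exprS; ring.
Qed.

Lemma taylor_succ f z c k : has_ps f z c ->
  taylor (fun w => taylor f w k) z 1 = k.+1%:R * taylor f z k.+1.
Proof.
move=> hps; rewrite (taylorE (has_ps_taylor k hps)) (taylorE hps).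
by rewrite /pderiv add1n binSn.
Qed.

Lemma has_pole_taylor f z N c k : (0 < N)%N -> c 0%N != 0 -> has_pole f z N c ->
  exists N' c', [/\ (0 < N')%N, c' 0%N != 0 & has_pole (fun w => taylor f w k) z N' c'].
Proof.
move=> N0 c0 hp; have [r r0 hr] := has_pole_punctured hp.
elim: k => [|k [M [d [M0 d0 hd]]]].
  exists N, c; split => //; apply: (has_pole_ext r0) hp => h h0 /(hr h h0)[d [hd _ _]].
  by rewrite (taylorE hd) -(has_ps_val hd).
exists M.+1, (fun n => k.+1%:R^-1 * ((n%:R - M%:R) * d n)); split => //.
  rewrite !mulf_neq0 ?invr_eq0 ?pnatr_eq0 // sub0r oppr_eq0 pnatr_eq0 -lt0n //.
apply: (has_pole_ext r0) (has_poleZ _ (has_pole_taylor1 M0 hd)) => h h0 /(hr h h0)[e [he _ _]].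
by rewrite (taylor_succ _ he) mulKf // pnatr_eq0.
Qed.

Lemma meromorphic_taylor f k : meromorphic f -> meromorphic (fun w => taylor f w k).
Proof.
move=> /meromorphicP hf; apply/meromorphicP => z; case: (hf z) => [[c hc]|].
  by left; exists (pderiv k c); exact: has_ps_taylor.
move=> [N [c [N0 c0 hp _]]]; right.
have [M [d [M0 d0 hd]]] := has_pole_taylor k N0 c0 hp; exists M, d; split => //.
rewrite /taylor; case: xgetP => [e _ he|//].
by case: (has_ps_not_pole he N0 c0).
Qed.

Lemma meromorphicZ (a : C) f : meromorphic f -> meromorphic (fun w => a * f w).
Proof.
have [->|a0] := eqVneq a 0.
  move=> _; apply: entire_meromorphic => z.
  by apply: has_ps_analytic (has_ps_ext ltr01 _ (has_ps_cst 0 z)) => h _; rewrite mul0r.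
move=> /meromorphicP hf; apply/meromorphicP => z; case: (hf z) => [[c hc]|].
  by left; eexists; exact: has_psM (has_ps_cst a z) hc.
move=> [N [c [N0 c0 hp fz]]]; right; exists N, (fun n => a * c n).
by rewrite fz mulr0 mulf_neq0 //; split => //; exact: has_poleZ.
Qed.

Lemma meromorphic_laurent f z : meromorphic f -> exists N c, has_pole f z N c.
Proof.
move=> /meromorphicP /(_ z)[[c hc]|[N [c [_ _ h _]]]]; last by exists N, c.
by exists 0%N, c; exact: has_ps_has_pole0.
Qed.

(** After multiplication by a common power of [h] both functions are power series, and two power
    series that agree at points arbitrarily close to the centre coincide. *)
Lemma meromorphic_dichotomy f g z : meromorphic f -> meromorphic g ->
  (exists2 r, 0 < r & forall h, h != 0 -> nm h < r -> f (z + h) = g (z + h)) \/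
  (exists2 r, 0 < r & forall h, h != 0 -> nm h < r -> f (z + h) <> g (z + h)).
Proof.
move=> /(meromorphic_laurent z)[N [c hc]] /(meromorphic_laurent z)[M [d hd]].
have := has_pole_raise N hd; have := has_pole_raise M hc; rewrite addnC.
move: (pshift M c) (pshift N d) (M + N)%N => {}c {}d {hc hd} K [r r0 [hc hf]] [r' r0' [hd hg]].
case: (pselect (exists2 r, 0 < r & forall h, h != 0 -> nm h < r -> f (z + h) <> g (z + h))).
  by right.
move=> nex; left.
have m0 : 0 < Num.min r r' by rewrite lt_min r0.
have E : c = d.
  apply: (pse_unique m0).
  - by apply: pconv_le hc; rewrite ?ge_min ?lexx // ltW.
  - by apply: pconv_le hd; rewrite ?ge_min ?lexx ?orbT // ltW.
  move=> e e0; apply: contrapT => nh; apply: nex.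
  exists (Num.min e (Num.min r r')); first by rewrite lt_min e0.
  move=> h h0; rewrite !lt_min => /and3P[he /ltW hr /ltW hr'] fg; apply: nh.
  by exists h; split => //; rewrite -hf // fg hg.
exists (Num.min r r') => // h h0; rewrite lt_min => /andP[/ltW h1 /ltW h2].
by apply: (mulfI (expf_neq0 K h0)); rewrite hf // hg // E.
Qed.

Definition agree_near f g z :=
  exists2 r, 0 < r & forall h, h != 0 -> nm h < r -> f (z + h) = g (z + h).

Lemma agree_near_eq f g z : meromorphic f -> meromorphic g -> agree_near f g z -> f z = g z.
Proof.
move=> /meromorphicP /(_ z) hf /meromorphicP /(_ z) hg [r r0 fg].
have fg' h : h != 0 -> nm h <= r / 2 -> f (z + h) = g (z + h) by move=> ? ?; apply: fg => //; lra.
have gf' h : h != 0 -> nm h <= r / 2 -> g (z + h) = f (z + h) by move=> ? ?; rewrite fg'.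
have r20 : 0 < r / 2 by lra.
case: hf => [[c hc]|[N [c [N0 c0 hc ->]]]]; case: hg => [[d hd]|[M [d [M0 d0 hd ->]]]] //.
- rewrite (has_ps_val hc) (has_ps_val hd); suff -> : c = d by [].
  case: hc hd => [r1 r10 [hc hf]] [r2 r20' [hd hg]].
  have m0 : 0 < Num.min r1 r2 by rewrite lt_min r10.
  apply: (pse_unique m0).
  + by apply: pconv_le hc; rewrite ?ge_min ?lexx // ltW.
  + by apply: pconv_le hd; rewrite ?ge_min ?lexx ?orbT // ltW.
  move=> e e0; have [|h h0] := @small_real (Num.min e (Num.min r (Num.min r1 r2))).
    by rewrite !lt_min e0 r0 r10.
  rewrite !lt_min => /and4P[he hr /ltW h1 /ltW h2]; exists h; split => //.
  by rewrite -hf // -hg // fg.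
- by case: (has_ps_not_pole hc M0 d0); apply: (has_pole_ext r20 gf').
- by case: (has_ps_not_pole hd N0 c0); apply: (has_pole_ext r20 fg').
Qed.

Lemma agree_near_open f g z : agree_near f g z -> exists2 r, 0 < r &
  forall h, nm h < r -> agree_near f g (z + h).
Proof.
move=> [r r0 fg]; exists r => // h hr.
have [->|h0] := eqVneq h 0; first by rewrite addr0; exists r.
have nh : 0 < nm h by rewrite nm_gt0.
exists (Num.min (nm h) (r - nm h)); first by rewrite lt_min; lra.
move=> s s0; rewrite lt_min => /andP[s1 s2]; rewrite -addrA; apply: fg.
  by rewrite -nm_gt0; have := nmBr h (- s); rewrite opprK nmN; lra.
by have := nmD h s; lra.
Qed.

(* Connectedness of the segment from z0 to z replaces analytic continuation along paths. *)
Theorem identity_theorem f g z0 : meromorphic f -> meromorphic g ->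
  agree_near f g z0 -> f = g.
Proof.
move=> mf mg a0; apply/funext => z; apply: agree_near_eq => //.
have [->//|zz0] := eqVneq z z0.
pose p (t : R) : C := z0 + t%:C * (z - z0).
have L0 : 0 < nm (z - z0) by rewrite nm_gt0 subr_eq0.
set L := nm (z - z0) in L0.
have pB t t' : p t' = p t + (t' - t)%:C * (z - z0) by rewrite /p rmorphB /=; ring.
have pn t t' : nm ((t' - t)%:C * (z - z0)) = `|t' - t| * L by rewrite nmM nm_real.
pose S := [set t : R | 0 <= t <= 1 /\ forall s : R, 0 <= s <= t -> agree_near f g (p s)].
have S0 : S 0.
  split; first by rewrite lexx ler01.
  move=> s /andP[s0 s1]; have -> : s = 0 by lra.
  by rewrite /p mul0r addr0.
have supS : has_sup S by split; [exists 0|exists 1 => t [/andP[]]].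
pose t := sup S.
have t0 : 0 <= t by apply: ub_le_sup => //; case: supS.
have t1 : t <= 1 by apply: ge_sup; [exists 0|move=> x [/andP[]]].
have below (s : R) : 0 <= s -> s < t -> agree_near f g (p s).
  move=> s0 st; have ts : 0 < t - s by lra.
  have [x [/andP[x0 x1] hx] sx] := sup_adherent ts supS.
  by apply: hx; rewrite -/t in sx; lra.
(* At the supremum the other branch of the dichotomy is impossible: [p (t - e)] lies in the disc
   where the functions would differ, yet they agree near it. *)
have at_t : agree_near f g (p t).
  have [//|[r r0 hr]] := meromorphic_dichotomy (p t) mf mg.
  have [t00|tn0] := eqVneq t 0; first by rewrite t00 /p mul0r addr0.
  have tp : 0 < t by rewrite lt_neqAle eq_sym tn0.
  pose e := Num.min t (r / L) / 2.
  have e0 : 0 < Num.min t (r / L) by rewrite lt_min tp divr_gt0.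
  have : Num.min t (r / L) <= t by rewrite ge_min lexx.
  have : Num.min t (r / L) <= r / L by rewrite ge_min lexx orbT.
  move=> e1 e2; have [|| r' r0' fg] := below (t - e); rewrite /e; [lra|lra|].
  have eL : e * L < r.
    by rewrite -ltr_pdivlMr // /e; lra.
  pose d := Num.min r' (r - e * L).
  have d0 : 0 < d by rewrite lt_min; lra.
  have ns : nm ((t - e - t)%:C * (z - z0)) = e * L.
    by rewrite pn (_ : t - e - t = - e) ?normrN ?ger0_norm /e; lra.
  pose u := (t - e - t)%:C * (z - z0).
  have u0 : u != 0 by rewrite -nm_gt0 ns mulr_gt0 // /e; lra.
  have [|s s0 sd] := @small_real (Num.min d (nm u)); first by rewrite lt_min d0 nm_gt0.
  move: sd; rewrite !lt_min => /andP[/andP[s1 s2] s3].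
  have := fg s s0 s1; rewrite -/e (pB t) -/u -addrA => h; case: (hr (u + s)) => //.
    by rewrite -nm_gt0; have := nmBr u (- s); rewrite opprK nmN; lra.
  by have := nmD u s; rewrite [nm u]ns; lra.
have [r r0 hr] := agree_near_open at_t.
have [t1'|tn1] := eqVneq t 1.
  by move: at_t; rewrite t1' /p mul1r subrKC.
have tl1 : t < 1 by rewrite lt_neqAle tn1.
pose e := Num.min (1 - t) (r / L) / 2.
have e0 : 0 < Num.min (1 - t) (r / L) by rewrite lt_min divr_gt0 // andbT; lra.
have e1 : Num.min (1 - t) (r / L) <= 1 - t by rewrite ge_min lexx.
have e2 : Num.min (1 - t) (r / L) <= r / L by rewrite ge_min lexx orbT.
(* Agreement is open, so it extends beyond [t] and contradicts the supremum. *)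
have St : S (t + e).
  split; first by rewrite /e; lra.
  move=> s /andP[s0 s1]; case: (ltP s t) => [|ts]; first exact: below.
  rewrite (pB t); apply: hr; rewrite pn ger0_norm ?subr_ge0 //.
  by rewrite -ltr_pdivlMr // /e in s1 *; lra.
by have [_ hb] := supS; have := ub_le_sup hb St; rewrite -/t /e; lra.
Qed.

(** The last hypothesis gives a zero of [g] a finite order, and the one before it prevents
    cancellation, so the zero is a genuine pole of the quotient. There [f z / g z] is [0] because
    the inverse of [0] is [0], as the convention at poles requires. *)
Lemma meromorphic_quot f g : entire f -> entire g ->
  (forall z, g z = 0 -> f z != 0) ->
  (forall z e, 0 < e -> exists h, [/\ h != 0, nm h < e & g (z + h) != 0]) ->
  meromorphic (fun z => f z / g z).
Proof.
move=> ef eg fg gn; apply/meromorphicP => z.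
have [d hd] := analytic_has_ps (ef z); have [c hc] := analytic_has_ps (eg z).
have [gz|gz] := eqVneq (g z) 0; last by left; exact: has_ps_quot hd hc gz.
right; have [r r0 [pc hg]] := hc.
have exn : exists n, c n != 0.
  apply: contrapT => nc; have [h [h0 hr]] := gn z r r0; rewrite hg ?ltW // => /eqP; apply.
  rewrite /pse -[RHS](csum0 (R := R) nat); apply: eq_csum => n.
  suff -> : c n = 0 by rewrite mul0r.
  by apply/eqP; apply: contrapT => /negP cn; apply: nc; exists n.
case: (ex_minnP exn) => -[|N] cN minN; first by move: cN; rewrite -(has_ps_val hc) gz eqxx.
have pcN := pconv_shift N.+1 r0 pc; have hN := has_ps_pse z r0 pcN.
have gE h : nm h <= r -> g (z + h) = h ^+ N.+1 * pse (fun n => c (n + N.+1)%N) h.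
  move=> hr; rewrite hg // (pse_take N.+1 r0 pc hr) big1 ?add0r // => i _.
  suff -> : c i = 0 by rewrite mul0r.
  apply/eqP; apply: contraT => /minN; by rewrite leqNgt ltn_ord.
have [|e he] := has_ps_quot hd hN; first by rewrite subrr pse0.
exists N.+1, e; split => //.
- by rewrite -(has_ps_val he) mulf_neq0 ?invr_eq0 ?subrr ?pse0 // fg.
- apply: has_pole_ext r0 _ (_ : has_pole (fun w => f w / pse (fun n => c (n + N.+1)%N) (w - z) / (w - z) ^+ N.+1) z N.+1 e).
    move=> h h0 hr; rewrite gE // addr_subl invfM -mulrA.
    by congr (_ * _); rewrite mulrC.
  case: he => [r1 r10 [hpe hf]]; exists r1 => //; split => // h h0 hr.
  by rewrite -hf // addr_subl mulrC divfK // expf_neq0.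
- by rewrite gz invr0 mulr0.
Qed.

End Meromorphic.

(** * Theta series and Kronecker's expansion *)

Section IntegerSums.
Context {R : realType}.
Local Notation C := R[i].

Lemma asum_rbdd (I : eqType) (f : I -> R) : (forall i, 0 <= f i) ->
  rbdd f <-> asum (fun i => (f i)%:C : C).
Proof.
by move=> f0; split; apply: rbdd_le => i; rewrite nm_real ger0_norm.
Qed.

Lemma rbdd_int (f : int -> R) : (forall k, 0 <= f k) ->
  rbdd (f \o Posz) -> rbdd (f \o Negz) -> rbdd f.
Proof.
move=> f0 hp hn; apply/asum_rbdd => //.
have [] // := @asum_int R (fun k => (f k)%:C).
- by apply/(asum_rbdd (f := f \o Posz)) => // k; exact: f0.
- by apply/(asum_rbdd (f := f \o Negz)) => // k; exact: f0.
Qed.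

Lemma rbdd_geo_int (r : R) : 0 <= r -> r < 1 -> rbdd (fun k : int => r ^+ `|k|).
Proof.
move=> r0 r1; apply: rbdd_int => [k||]; first exact: exprn_ge0.
  exact: rbdd_geo.
apply: rbdd_le (rbdd_geo r0 r1) => n /=.
by rewrite ler_wiXn2l // ltW.
Qed.

Lemma rbdd_exp_lin (a : R) : 0 < a -> rbdd (fun k : int => expR (- (a * `|k%:~R|))).
Proof.
move=> a0; have e1 : expR (- a) < 1 by rewrite -expR0 ltr_expR; lra.
apply: rbdd_le (rbdd_geo_int (expR_ge0 _) e1) => k.
by rewrite -expRM_natl -intr_norm -abszE pmulrn mulrN mulrC lexx.
Qed.

Lemma rbdd_gauss (a r : R) : 0 < a ->
  rbdd (fun k : int => expR (- a * k%:~R ^+ 2 + r * `|k%:~R|)).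
Proof.
move=> a0; pose B := expR ((r + 1) ^+ 2 / (4 * a)).
apply: rbdd_le (rbddZ (expR_ge0 _ : 0 <= B) (rbdd_exp_lin ltr01)) => k.
rewrite -expRD ler_expR mul1r -real_normK ?num_real //; set x := `|_|.
have h : 0 <= (2 * a * x - (r + 1)) ^+ 2 / (4 * a) by rewrite divr_ge0 ?sqr_ge0 //; lra.
have E : (2 * a * x - (r + 1)) ^+ 2 / (4 * a) = a * x ^+ 2 - (r + 1) * x + (r + 1) ^+ 2 / (4 * a).
  by field; rewrite gt_eqF.
by rewrite E in h; lra.
Qed.

(** One statement for all the exponential series below (theta, Lambert, a single exponential):
    expanding each exponential and exchanging the sums shows analyticity in [h] and gives the Taylor
    coefficients. The weight [exp (|e i| r)] is what makes the exchange absolute on the disc. *)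
Lemma exp_family (I : eqType) (e : I -> R) (u : I -> C) (r : R) : 0 <= r ->
  rbdd (fun i => nm (u i) * expR (`|e i| * r)) ->
  let c n := csum (fun i => u i * ((e i)%:C ^+ n / n`!%:R)) in
  pconv c r /\ forall h, nm h <= r ->
    asum (fun i => u i * cexp ((e i)%:C * h)) /\
    csum (fun i => u i * cexp ((e i)%:C * h)) = pse c h.
Proof.
move=> r0 hb c.
pose F h (p : I * nat) : C := u p.1 * exp_term ((e p.1)%:C * h) p.2.
have aF h : nm h <= r -> asum (F h).
  move=> hr; apply: asum_pair hb => i t ut; rewrite /F /=.
  under eq_bigr do rewrite nmM nm_exp_term.
  rewrite -mulr_sumr ler_wpM2l ?nm_ge0 //.
  apply: le_trans (sum_exp_coeff_le (nm_ge0 _) ut) _.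
  by rewrite ler_expR nmM nm_real ler_wpM2l.
have cE h n : nm h <= r -> csum (fun i => F h (i, n)) = c n * h ^+ n /\ (h != 0 -> asum (fun i => u i * ((e i)%:C ^+ n / n`!%:R))).
  move=> hr; have [->|h0] := eqVneq h 0.
    case: n => [|n]; last first.
      split=> //; rewrite exprS mul0r mulr0 -[RHS](csum0 (R := R) I); apply: eq_csum => i.
      by rewrite /F /exp_term /= mulr0 exprS !mul0r mulr0.
    split=> //; rewrite expr0 mulr1 /c; apply: eq_csum => i.
    by rewrite /F /exp_term /= !expr0.
  have /asum_swap/(asum_fst n) /= a := aF h hr.
  have hn : h ^+ n != 0 by rewrite expf_neq0.
  have a' : asum (fun i => u i * ((e i)%:C ^+ n / n`!%:R)).
    have := asumZr (h ^+ n)^-1 a; apply: eq_asum => i.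
    by rewrite /F /exp_term /= exprMn !mulrA mulrAC mulfK.
  split => //; rewrite -csumZr //; apply: eq_csum => i.
  by rewrite /F /exp_term /= exprMn !mulrA mulrAC.
split.
  have nr : nm (r%:C) = r by rewrite nm_real ger0_norm.
  have := asum_csum (asum_swap (aF r%:C _)); rewrite nr lexx => /(_ isT).
  apply: rbdd_le => n /=; have [|-> _] := cE r%:C n; first by rewrite nr.
  by rewrite nmM nmX nr.
move=> h hr; have E i : csum (fun n => F h (i, n)) = u i * cexp ((e i)%:C * h).
  by rewrite cexpE -csumZ //; exact: asum_exp.
split; first by apply: eq_asum (asum_csum (aF h hr)) => i; exact: E.
rewrite -(eq_csum E) (csum_exchange (aF h hr)); apply: eq_csum => n.
by have [] := cE h n hr.
Qed.

Definition sg (k : int) : C := (-1) ^ k.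

Lemma sgD k l : sg (k + l) = sg k * sg l.
Proof. by rewrite /sg expfzDr // oppr_eq0 oner_eq0. Qed.

Lemma sg1 : sg 1 = -1.
Proof. by rewrite /sg expr1z. Qed.

Lemma sg0 : sg 0 = 1.
Proof. by rewrite /sg expr0z. Qed.

Lemma sg_sq k : sg k * sg k = 1.
Proof. by rewrite -exprzMl ?unitfE ?oppr_eq0 ?oner_eq0 // mulrNN mulr1 exp1rz. Qed.

Lemma sgN k : sg (- k) = sg k.
Proof.
have h : sg (- k) * sg k = 1 by rewrite -sgD addNr sg0.
by rewrite -[LHS]mulr1 -(sg_sq k) mulrA h mul1r.
Qed.

Lemma nm_sg k : nm (sg k) = 1.
Proof.
have := sg_sq k => /(congr1 nm); rewrite nmM nm1 => h.
have := nm_ge0 (sg k); nra.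
Qed.

Lemma sg_neq0 k : sg k != 0.
Proof. by rewrite -nm_gt0 nm_sg. Qed.

End IntegerSums.

Section ThetaBasics.
Context {R : realType}.
Local Notation C := R[i].

Lemma intC (k : int) : (k%:~R : C) = (k%:~R : R)%:C.
Proof. by rewrite rmorph_int. Qed.

Lemma Re_mul_real (r : R) (z : C) : complex.Re (r%:C * z) = r * complex.Re z.
Proof. by case: z => x y /=; rewrite mul0r subr0. Qed.

Lemma Re_add (z w : C) : complex.Re (z + w) = complex.Re z + complex.Re w.
Proof. exact: raddfD. Qed.

Lemma nm_cexp_int (k : int) (z : C) : nm (cexp (k%:~R * z)) = expR (k%:~R * complex.Re z).
Proof. by rewrite nm_cexp intC Re_mul_real. Qed.

Lemma fin_lower_bound (f : int -> R) (s : seq int) : exists2 d, 0 < d &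
  forall k, k \in s -> 0 < f k -> d <= f k.
Proof.
elim: s => [|a s [d d0 hd]]; first by exists 1.
have [fa|fa] := ltP 0 (f a).
  exists (Num.min d (f a)); first by rewrite lt_min d0.
  by move=> k; rewrite inE ge_min => /orP[/eqP -> _|/hd h /h ->//]; rewrite lexx orbT.
exists d => // k; rewrite inE => /orP[/eqP -> |]; last exact: hd.
by rewrite ltNge fa.
Qed.

Context (om : C) (hom : complex.Re om < 0).

Lemma nm_nome (b : C) (k : int) :
  nm (cexp (b + 2 * om * k%:~R)) = expR (complex.Re b + 2 * complex.Re om * k%:~R).
Proof.
rewrite nm_cexp Re_add; congr (expR (_ + _)).
have -> : 2 * om * k%:~R = (2 * k%:~R : R)%:C * om.
  by rewrite rmorphM /= -intC rmorph_nat; ring.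
by rewrite Re_mul_real; ring.
Qed.

Lemma one_minus_lb (b : C) : exists2 d : R, 0 < d & forall k : int,
  cexp (b + 2 * om * k%:~R) != 1 ->
  d * (1 + nm (cexp (b + 2 * om * k%:~R))) <= nm (1 - cexp (b + 2 * om * k%:~R)).
Proof.
pose y k := cexp (b + 2 * om * k%:~R).
pose f k := nm (1 - y k) / (1 + nm (y k)).
(* Beyond [N] the exponent [Re b + 2 Re om k] has absolute value at least [1], so the modulus of
   [y k] is at most [exp (- 1)] or at least [exp 1]. Only finitely many [k] remain. *)
pose N := Num.truncn ((`|complex.Re b| + 1) / (- (2 * complex.Re om))).
have hN k : (N < `|k|)%N -> `|complex.Re b| + 1 <= - (2 * complex.Re om) * `|k%:~R|.
  move=> Nk; rewrite [X in _ <= X]mulrC -ler_pdivrMr; last by rewrite oppr_gt0 pmulr_rlt0.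
  apply: le_trans (ltW (truncnS_gt _)) _.
  by rewrite -intr_norm -abszE pmulrn ler_nat.
have [d d0 hd] := fin_lower_bound f ([seq Posz n | n <- iota 0 N.+1] ++ [seq Negz n | n <- iota 0 N.+1]).
have e1 : 0 < 1 - expR (- 1 : R) by rewrite subr_gt0 -[X in _ < X]expR0 ltr_expR; lra.
exists (Num.min d ((1 - expR (- 1)) / 2)); first by rewrite lt_min d0 /=; lra.
move=> k; rewrite -/(y k) => yk.
have y0 := nm_ge0 (y k).
case: (ltnP N `|k|) => [/hN hk|kN].
  have h1 : Num.min d ((1 - expR (- 1)) / 2) <= (1 - expR (- 1)) / 2 by rewrite ge_min lexx orbT.
  apply: le_trans (ler_wpM2r _ h1) _; first lra.
  have yE := nm_nome b k; rewrite -/(y k) in yE.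
  have hb := ler_norm (complex.Re b); have hb' := ler_norm (- complex.Re b).
  rewrite normrN in hb'.
  have E1 : expR 1 * expR (- 1) = 1 :> R by rewrite -expRD subrr expR0.
  have p1 := expR_gt0 (1 : R); have p2 := expR_gt0 (- 1 : R).
  have [k0|k0] := ler0P (k%:~R : R) ; last first.
    have : nm (y k) <= expR (- 1) by rewrite yE ler_expR; rewrite (ger0_norm (ltW k0)) in hk; lra.
    have := nmBr 1 (y k); rewrite nm1; nra.
  have : expR 1 <= nm (y k) by rewrite yE ler_expR; rewrite (ler0_norm k0) in hk; lra.
  have := nmBr (y k) 1; rewrite nm1 nm_distC; nra.
have h1 : Num.min d ((1 - expR (- 1)) / 2) <= d by rewrite ge_min lexx.
apply: le_trans (ler_wpM2r _ h1) _; first lra.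
rewrite -ler_pdivlMr; last lra.
apply: hd.
  rewrite mem_cat; apply/orP; move: kN.
  clear; case: k => n kN; [left|right]; apply/mapP; exists n; rewrite // mem_iota; lia.
by rewrite divr_gt0 // ?nm_gt0 ?subr_eq0 1?eq_sym //; lra.
Qed.

(** The second bound supplies the decay as [k] tends to minus infinity. Vanishing denominators are
    allowed, their inverse being [0]; at [b = 0] this drops the singular term [k = 0] from all the
    series. *)
Lemma inv_one_minus_bound (b : C) : exists2 B : R, 0 <= B & forall k : int,
  nm (1 - cexp (b + 2 * om * k%:~R))^-1 <= B /\
  nm (1 - cexp (b + 2 * om * k%:~R))^-1 <= B * expR (- (2 * complex.Re om * k%:~R)).
Proof.
have [d d0 hd] := one_minus_lb b.
have p0 := expR_gt0 (- complex.Re b); have di : 0 < d^-1 by rewrite invr_gt0.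
have B0 : 0 <= d^-1 * (1 + expR (- complex.Re b)) by rewrite mulr_ge0 ?ltW //; lra.
exists (d^-1 * (1 + expR (- complex.Re b))) => // k.
have q0 := expR_gt0 (- (2 * complex.Re om * k%:~R)).
have [->|yk] := eqVneq (cexp (b + 2 * om * k%:~R)) 1.
  by rewrite subrr invr0 nm0; split => //; rewrite mulr_ge0 // ltW.
have := hd k yk; have := nm_nome b k; set y := cexp _ => yE.
have y0 : 0 < nm y by rewrite yE expR_gt0.
have n0 : 0 < nm (1 - y) by rewrite nm_gt0 subr_eq0 eq_sym.
rewrite nmV => h; have y1 : 0 < 1 + nm y by lra.
have {}h : (nm (1 - y))^-1 <= d^-1 * (1 + nm y)^-1.
  by rewrite -invfM lef_pV2 ?posrE // mulr_gt0.
split; apply: le_trans h _.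
  rewrite ler_pM2l //; by apply: (@le_trans _ _ 1); [rewrite invf_le1 //; lra|lra].
rewrite -(mulrA d^-1) ler_pM2l //.
have -> : (1 + expR (- complex.Re b)) * expR (- (2 * complex.Re om * k%:~R))
    = expR (- (2 * complex.Re om * k%:~R)) + (nm y)^-1.
  by rewrite mulrDl mul1r -expRD -opprD yE -expRN.
by apply: (@le_trans _ _ (nm y)^-1); [rewrite lef_pV2 ?posrE //; lra|lra].
Qed.

(* With q = exp (2 om), the coefficients (-1)^k q^(k(k-1)/2): Theta z is the Jacobi theta
   series in the variable e^z. *)
Definition tht (k : int) : C := sg k * cexp (om * (k%:~R ^+ 2 - k%:~R)).

Lemma nm_tht (k : int) : nm (tht k) = expR (complex.Re om * (k%:~R ^+ 2 - k%:~R)).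
Proof.
rewrite /tht nmM nm_sg mul1r nm_cexp; congr expR.
have -> : om * (k%:~R ^+ 2 - k%:~R) = (k%:~R ^+ 2 - k%:~R : R)%:C * om.
  by rewrite rmorphB rmorphXn /= -intC mulrC.
by rewrite Re_mul_real mulrC.
Qed.

Lemma rbdd_tht (r : R) : rbdd (fun k : int => nm (tht k) * expR (`|k%:~R| * r)).
Proof.
have hom' := hom; have a0 : 0 < - complex.Re om by lra.
apply: rbdd_le (rbdd_gauss (r - complex.Re om) a0) => k.
rewrite nm_tht -expRD ler_expR; have := ler_norm (k%:~R : R).
by move: (k%:~R : R) => x hx; have := ler_norm x; nra.
Qed.

Definition Theta (z : C) : C := csum (fun k : int => tht k * cexp (k%:~R * z)).

Lemma asum_Theta z : asum (fun k : int => tht k * cexp (k%:~R * z)).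
Proof.
apply: rbdd_le (rbdd_tht (nm z)) => k; rewrite nmM ler_wpM2l ?nm_ge0 //.
rewrite nm_cexp_int ler_expR; have h1 := nm_Re z.
by apply: le_trans (ler_norm _) _; rewrite normrM ler_wpM2l.
Qed.

Lemma asum_tht : asum tht.
Proof. by apply: eq_asum (asum_Theta 0) => k; rewrite mulr0 cexp0 mulr1. Qed.

Lemma addz_bij (m : int) : bijective (fun k : int => k + m).
Proof. by exists (fun k => k - m) => k; rewrite ?addrK ?subrK. Qed.

Lemma subz_bij (m : int) : bijective (fun k : int => m - k).
Proof. by exists (fun k => m - k) => k; rewrite subKr. Qed.

Lemma oppz_bij : bijective (fun k : int => - k).
Proof. by exists (fun k => - k) => k; rewrite opprK. Qed.

Lemma Theta_quasi (m : int) z :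
  Theta z = sg m * cexp (om * (m%:~R ^+ 2 - m%:~R) + m%:~R * z) * Theta (z + 2 * om * m%:~R).
Proof.
rewrite /Theta -csumZ; last exact: asum_Theta.
rewrite (csum_bij (addz_bij m)); last exact: asum_Theta.
apply: eq_csum => k; rewrite /= /tht sgD intrD.
have E s t a b d : s * cexp a * (t * cexp b * cexp d) = t * s * cexp (a + b + d) :> C.
  by rewrite !cexpD; ring.
by rewrite E -!mulrA -cexpD; congr (_ * (_ * cexp _)); ring.
Qed.

(** The reflection [k -> 1 - k] fixes [k^2 - k] and reverses the sign, so the sum is its own
    opposite. *)
Lemma Theta0 : Theta 0 = 0.
Proof.
have h : Theta 0 = - Theta 0.
  rewrite {1}/Theta (csum_bij (subz_bij 1)); last exact: asum_Theta.
  rewrite -mulN1r -csumZ; last exact: asum_Theta.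
  apply: eq_csum => k; rewrite /= /tht sgD sgN sg1 intrB !mulr0 -!mulrA.
  by congr (_ * (_ * (cexp _ * _))); ring.
have : Theta 0 *+ 2 = 0 by rewrite mulr2n {2}h subrr.
by move=> /eqP; rewrite mulrn_eq0 /= => /eqP.
Qed.

Lemma Theta_lattice (m : int) : Theta (2 * om * m%:~R) = 0.
Proof.
have := Theta_quasi m 0; rewrite Theta0 add0r => /esym/eqP.
by rewrite !mulf_eq0 (negbTE (sg_neq0 _)) (negbTE (cexp_neq0 _)) /= => /eqP.
Qed.

End ThetaBasics.

(** * Partial fractions for the reciprocal of the theta series *)

Section PartialFractions.
Context {R : realType}.
Local Notation C := R[i].
Context (om : C) (hom : complex.Re om < 0).
Local Notation tht := (tht om).
Local Notation Theta := (Theta om).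

(* Partial sums of the theta coefficients: coefficients of the quotient Theta z / (1 - e^z). *)
Definition acoef (j : int) : C := csum (fun n : nat => tht (j - n%:Z)).

Lemma asum_acoef j : asum (fun n : nat => tht (j - n%:Z)).
Proof.
apply: (asum_comp (h := fun n : nat => j - n%:Z)) (asum_tht hom) => m n.
by move=> /addrI /oppr_inj [].
Qed.

Lemma acoef_rec j : acoef j = tht j + acoef (j - 1).
Proof.
rewrite {1}/acoef csum_nat_recl; last exact: asum_acoef.
rewrite subr0; congr (_ + _); apply: eq_csum => n /=.
by congr tht; rewrite -addn1 PoszD opprD addrA addrAC.
Qed.

Lemma csum_tht : csum tht = 0.
Proof.
by rewrite -(Theta0 hom); apply: eq_csum => k; rewrite mulr0 cexp0 mulr1.
Qed.

(** All coefficients [tht] sum to [Theta 0 = 0], so a partial sum is minus the complementary tail,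
    and [k -> 1 - k] turns that tail into a partial sum. This carries the Gaussian decay from
    negative to positive [j]. *)
Lemma acoefN j : acoef (- j) = acoef j.
Proof.
pose up (n : nat) : int := j + 1 + n%:Z; pose dn (n : nat) : int := j - n%:Z.
have aup : asum (tht \o up).
  by apply: asum_comp (asum_tht hom) => m n /addrI[].
have [||||||_] := csum_split (h := dn) (k := up) (f := tht).
- by move=> m n /addrI /oppr_inj [].
- by move=> m n /addrI [].
- by move=> m n; rewrite /up /dn; lia.
- move=> i; case: (lerP i j) => ij; [left; exists (absz (j - i)%R)|right; exists (absz (i - j - 1)%R)];
    rewrite /up /dn; lia.
- exact: asum_acoef.
- exact: aup.
rewrite csum_tht => /esym/eqP; rewrite addr_eq0 => /eqP.
rewrite -[csum (tht \o dn)]/(acoef j) => ->.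
rewrite /acoef -[RHS]mulN1r -csumZ //; apply: eq_csum => n; rewrite /= /up /tht.
rewrite -sg1 -[sg 1]sgN mulrA -sgD -[X in _ = X * _]sgN.
congr (sg _ * cexp (_ * _)); first lia.
by rewrite !intrD !intrN; ring.
Qed.

Lemma acoef_bound : exists2 B : R, 0 <= B &
  forall j, nm (acoef j) <= B * expR (complex.Re om * j%:~R ^+ 2).
Proof.
have a0 : 0 < - complex.Re om by have hom' := hom; lra.
have Pi : injective Posz by move=> ? ? [].
have [B hB] := rbdd_comp Pi (rbdd_gauss 0 a0).
have B0 : 0 <= B by have := hB [::] erefl; rewrite big_nil.
exists B => //.
(* For [j <= 0] and [n >= 0], [(j - n)^2 - (j - n)] is at least [j^2 + n^2]. *)
have neg (j : int) : j <= 0 -> nm (acoef j) <= B * expR (complex.Re om * j%:~R ^+ 2).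
  move=> j0; apply: nm_csum_le => s us.
  apply: le_trans (_ : \sum_(n <- s) (expR (- - complex.Re om * (Posz n)%:~R ^+ 2 + 0 * `|(Posz n)%:~R|) * expR (complex.Re om * j%:~R ^+ 2)) <= _); last first.
    by rewrite -mulr_suml ler_wpM2r ?expR_ge0 //; exact: hB.
  apply: ler_sum => n _; rewrite nm_tht -expRD ler_expR mul0r addr0 opprK -mulrDr.
  rewrite ler_nM2l // intrB.
  have : (j%:~R : R) <= 0 by rewrite lerz0.
  have : 0 <= (Posz n)%:~R :> R by rewrite ler0z.
  by move: (j%:~R) (_%:~R) => x y; nra.
move=> j; case: (lerP j 0) => j0; first exact: neg.
rewrite -acoefN; have := neg (- j); rewrite intrN sqrrN; apply; lia.
Qed.

Definition partialTheta (z : C) : C := csum (fun j : int => acoef j * cexp (j%:~R * z)).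

Lemma asum_partialTheta z : asum (fun j : int => acoef j * cexp (j%:~R * z)).
Proof.
have a0 : 0 < - complex.Re om by have hom' := hom; lra.
have [B B0 hB] := acoef_bound.
apply: rbdd_le (rbddZ B0 (rbdd_gauss (nm z) a0)) => j.
rewrite nmM nm_cexp_int opprK expRD mulrA.
apply: ler_pM; rewrite ?nm_ge0 ?expR_ge0 // ler_expR mulrC.
by apply: le_trans (ler_norm _) _; rewrite normrM ler_wpM2r // nm_Re.
Qed.

Lemma partialTheta_Theta z : (1 - cexp z) * partialTheta z = Theta z.
Proof.
rewrite mulrBl mul1r {2}/partialTheta -csumZ; last exact: asum_partialTheta.
have -> : csum (fun j : int => cexp z * (acoef j * cexp (j%:~R * z))) =
          csum (fun j : int => acoef (j - 1) * cexp (j%:~R * z)).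
  have a := asumZ (cexp z) (asum_partialTheta z).
  rewrite (csum_bij (addz_bij (- 1)) a); apply: eq_csum => j /=.
  by rewrite mulrCA -cexpD; congr (_ * cexp _); rewrite intrD; ring.
rewrite -csumB; last 2 first.
- exact: asum_partialTheta.
- have := asumZ (cexp z) (asum_partialTheta z).
  move=> /(asum_comp (bij_inj (addz_bij (- 1)))); apply: eq_asum => j /=.
  by rewrite mulrCA -cexpD; congr (_ * cexp _); rewrite intrD; ring.
apply: eq_csum => j; by rewrite -mulrBl acoef_rec addrK.
Qed.

(* Up to sign the derivative of Theta at 0 (cTheta_Tcoef1). *)
Definition cTheta : C := partialTheta 0.

(* In multiplicative form: e^b is not a power of q = exp (2 om). *)
Definition nonlattice (b : C) := forall k : int, cexp (b + 2 * om * k%:~R) != 1.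

Definition Appell_term (b : C) (k : int) : C :=
  sg k * cexp (om * (k%:~R ^+ 2 + k%:~R)) / (1 - cexp (b + 2 * om * k%:~R)).

Lemma asum_Appell_term b : asum (Appell_term b).
Proof.
have [B B0 hB] := inv_one_minus_bound hom b.
have := asumZr B%:C (asum_comp (bij_inj oppz_bij) (asum_tht hom)).
apply: rbdd_le => k; rewrite /Appell_term /= /tht !nmM !nm_sg !mul1r nm_real ger0_norm //.
rewrite intrN sqrrN opprK ler_wpM2l ?nm_ge0 //.
by have [] := hB k.
Qed.

(** [F] is summed in both orders. For fixed [k], quasi-periodicity and the division by [1 - e^z]
    produce [Theta b] times one Appell term. For fixed [m], the sum is an exponential times
    [partialTheta] at the zero [- 2 om m] of [Theta]; it vanishes there unless [m = 0], where the
    factor [1 - e^z] has absorbed the zero. *)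
Lemma partial_fraction (b : C) : nonlattice b -> Theta b * csum (Appell_term b) = cTheta.
Proof.
move=> nb.
have a0 : 0 < - complex.Re om by have hom' := hom; lra.
pose F (p : int * int) : C :=
  acoef (p.1 - p.2) * cexp (2 * om * p.2%:~R * p.1%:~R + p.1%:~R * b).
(* The cross terms cancel, [(m - k)^2 + 2 k m = m^2 + k^2], so [F] is dominated by a product of two
   Gaussians. *)
have aF : asum F.
  have [B B0 hB] := acoef_bound.
  have := rbddZ B0 (rbdd_prod _ _ (rbdd_gauss (nm b) a0) (rbdd_gauss 0 a0)).
  move=> /(_ (fun k => expR_ge0 _) (fun k => expR_ge0 _)).
  apply: rbdd_le => -[m k]; rewrite /F /= nmM.
  apply: le_trans (ler_wpM2r (nm_ge0 _) (hB _)) _.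
  rewrite -[X in X <= _]mulrA ler_wpM2l // nm_cexp -!expRD ler_expR.
  have -> : 2 * om * k%:~R * m%:~R + m%:~R * b = (2 * k%:~R * m%:~R : R)%:C * om + (m%:~R : R)%:C * b.
    by rewrite !rmorphM /= -!intC rmorph_nat; ring.
  rewrite Re_add !Re_mul_real intrB mul0r addr0.
  have h1 := nm_Re b; have h2 := ler_norm (m%:~R * complex.Re b).
  have : `|m%:~R * complex.Re b| <= `|m%:~R| * nm b by rewrite normrM ler_wpM2l.
  move: (m%:~R * complex.Re b) (`|m%:~R| * nm b) (nm b * `|m%:~R|) (mulrC (nm b) `|m%:~R|) h2 => x y v -> h2 h3.
  by nra.
have E1 k : csum (fun m => F (m, k)) = Theta b * Appell_term b k.
  have nk : 1 - cexp (b + 2 * om * k%:~R) != 0 by rewrite subr_eq0 eq_sym nb.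
  rewrite (Theta_quasi hom k b) -partialTheta_Theta /Appell_term.
  have G s e u A v : 1 - v != 0 ->
      s * e * ((1 - v) * A) * (s * u / (1 - v)) = (s * s) * (e * u) * A :> C.
    by move=> v0; field.
  rewrite G // sg_sq mul1r -cexpD /partialTheta -csumZ; last exact: asum_partialTheta.
  rewrite (csum_bij (addz_bij k)); last first.
    exact: (asum_fst (f := fun p => F (p.2, p.1)) k (asum_swap aF)).
  apply: eq_csum => j; rewrite /F /= addrK mulrCA -cexpD intrD; congr (_ * cexp _); ring.
have E2 m : csum (fun k => F (m, k)) = if m == 0 then cTheta else 0.
  rewrite (csum_bij (subz_bij m)); last exact: asum_fst.
  transitivity (cexp (2 * om * m%:~R ^+ 2 + m%:~R * b) * partialTheta (- (2 * om * m%:~R))).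
    rewrite /partialTheta -csumZ; last exact: asum_partialTheta.
    apply: eq_csum => j; rewrite /F /= subKr mulrCA -cexpD intrB; congr (_ * cexp _); ring.
  case: eqVneq => [->|m0]; first by rewrite !(mulr0, mul0r) expr0n mulr0 addr0 cexp0 mul1r oppr0.
  suff -> : partialTheta (- (2 * om * m%:~R)) = 0 by rewrite mulr0.
  have := partialTheta_Theta (- (2 * om * m%:~R)); rewrite -mulrN -intrN (Theta_lattice hom).
  move=> /eqP; rewrite mulf_eq0 => /orP[|/eqP//].
  rewrite subr_eq0 => /eqP /(congr1 nm); rewrite nm1 -[2 * om * _]add0r nm_nome raddf0 add0r => /esym/eqP.
  rewrite add0r -[X in _ == X]expR0 (inj_eq (@expR_inj _)) !mulf_eq0 pnatr_eq0 /= intr_eq0 oppr_eq0 (negbTE m0) orbF.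
  by rewrite (lt_eqF hom).
rewrite -csumZ; last exact: asum_Appell_term.
rewrite -(eq_csum E1) -(csum_exchange aF) (eq_csum E2).
have [|/hsum_csum -> _] := @csum_fin _ _ (fun m : int => if m == 0 then cTheta else 0) [:: 0] erefl.
  by move=> m; rewrite inE => /negbTE ->.
by rewrite big_seq1 eqxx.
Qed.

Lemma Theta_neq0 (b : C) : cTheta != 0 -> nonlattice b -> Theta b != 0.
Proof.
move=> c0 nb; apply/eqP => t0; have := partial_fraction nb.
by rewrite t0 mul0r => /esym/eqP; rewrite (negbTE c0).
Qed.

End PartialFractions.

(** * Kronecker's expansion, its logarithmic degeneration, and the bilinear theta identity *)

Section Kronecker.
Context {R : realType}.
Local Notation C := R[i].
Context (om : C) (hom : complex.Re om < 0).
Local Notation tht := (tht om).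
Local Notation Theta := (Theta om).
Local Notation cTheta := (cTheta om).
Local Notation nonlattice := (nonlattice om).

Definition kcoef (b : C) (l : int) : C := (1 - cexp (b + 2 * om * l%:~R))^-1.

(** [Re z < 0] gives decay for [l >= 0], and [Re z > 2 Re om] for [l < 0]; the rate is the distance
    from [Re z] to the edges of this strip. *)
Lemma kcoef_bound (b z : C) : exists2 B : R, 0 <= B & forall l,
  nm (kcoef b l * cexp (l%:~R * z)) <=
  B * expR (- (Num.min (- complex.Re z) (complex.Re z - 2 * complex.Re om) * `|l%:~R|)).
Proof.
have [B B0 hB] := inv_one_minus_bound hom b; exists B => // l.
have [h1 h2] := hB l; rewrite nmM nm_cexp_int.
case: (lerP 0 (l%:~R : R)) => l0.
  apply: ler_pM; rewrite ?nm_ge0 ?expR_ge0 // ler_expR.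
  have : Num.min (- complex.Re z) (complex.Re z - 2 * complex.Re om) <= - complex.Re z.
    by rewrite ge_min lexx.
  by rewrite (ger0_norm l0) => /(ler_wpM2r l0); move: (Num.min _ _) => e; lra.
apply: le_trans (ler_wpM2r (expR_ge0 _) h2) _.
rewrite -[X in X <= _]mulrA ler_wpM2l // -expRD ler_expR.
have : Num.min (- complex.Re z) (complex.Re z - 2 * complex.Re om) <= complex.Re z - 2 * complex.Re om.
  by rewrite ge_min lexx orbT.
by rewrite (ltr0_norm l0) => /(ler_wnM2r (ltW l0)); move: (Num.min _ _) => e; lra.
Qed.

Lemma asum_kcoef (b z : C) : 2 * complex.Re om < complex.Re z < 0 ->
  asum (fun l => kcoef b l * cexp (l%:~R * z)).
Proof.
move=> /andP[z1 z2]; have [B B0 hB] := kcoef_bound b z.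
apply: rbdd_le (rbddZ B0 (rbdd_exp_lin _)) => //.
by rewrite lt_min; apply/andP; split; lra.
Qed.

Lemma mul_Theta (u : int -> C) z : asum (fun l => u l * cexp (l%:~R * z)) ->
  csum (fun l => u l * cexp (l%:~R * z)) * Theta z =
  csum (fun m => cexp (m%:~R * z) * csum (fun l => u l * tht (m - l))).
Proof.
move=> au; have aT := asum_Theta hom z.
have aP := asum_prod au aT.
rewrite csum_prod //.
pose h (p : int * int) : int * int := (p.2, p.1 - p.2).
have hb : bijective h.
  exists (fun p => (p.2 + p.1, p.1)) => -[a c]; rewrite /h /=; congr pair; lia.
rewrite (csum_bij hb aP) csum_pair; last exact: asum_comp (bij_inj hb) aP.
apply: eq_csum => m.
have E l : (fun p : int * int => u p.1 * cexp (p.1%:~R * z) * (tht p.2 * cexp (p.2%:~R * z))) (h (m, l))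
    = cexp (m%:~R * z) * (u l * tht (m - l)).
  rewrite /h /= mulrACA -cexpD mulrC; congr (cexp _ * _); rewrite intrB; ring.
have a := asum_fst m (asum_comp (bij_inj hb) aP).
rewrite -csumZ; first exact: eq_csum.
have := asumZ (cexp (m%:~R * z))^-1 a; apply: eq_asum => l.
by rewrite /= (E l) mulKf // cexp_neq0.
Qed.

Lemma nonlattice_shift b (m : int) : nonlattice b -> nonlattice (b + 2 * om * m%:~R).
Proof. by move=> nb k; rewrite -addrA -mulrDr -intrD; exact: nb. Qed.

Lemma tht_shift (k l : int) :
  tht (k + l) = tht k * tht l * cexp (2 * om * k%:~R * l%:~R).
Proof.
have E s t a b d : s * cexp a * (t * cexp b) * cexp d = s * t * cexp (a + b + d) :> C.
  by rewrite !cexpD; ring.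
by rewrite /tht E sgD intrD; congr (_ * cexp _); ring.
Qed.

(* The coefficient of e^(m z) in the product of the Lambert series and of Theta z is a partial
   fraction at b + 2 om m, whose value is known from partial_fraction. *)
Lemma kronecker (b z : C) : nonlattice b -> 2 * complex.Re om < complex.Re z < 0 ->
  csum (fun l => kcoef b l * cexp (l%:~R * z)) * Theta z * Theta b = cTheta * Theta (b + z).
Proof.
move=> nb hz; rewrite mul_Theta; last exact: asum_kcoef.
rewrite /Theta -/(Theta b) -csumZ; last exact: asum_Theta.
have inner m : csum (fun l => kcoef b l * tht (m - l)) = csum (Appell_term om (b + 2 * om * m%:~R)).
  have a : asum (fun l => kcoef b l * tht (m - l)).
    have [B B0 hB] := inv_one_minus_bound hom b.
    have := asumZ B%:C (asum_comp (bij_inj (subz_bij m)) (asum_tht hom)).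
    apply: rbdd_le => l; rewrite /= 2!nmM nm_real ger0_norm // ler_wpM2r ?nm_ge0 //.
    exact: (hB l).1.
  rewrite (csum_bij (addz_bij m) a); apply: eq_csum => k /=.
  rewrite opprD addrCA subrr addr0 /Appell_term /kcoef /tht mulrC sgN intrN sqrrN opprK.
  by congr (_ / (1 - cexp _)); rewrite intrD; ring.
rewrite -csumZr; last first.
  have /asum_kcoef a := hz; have aP := asum_prod (a b) (asum_Theta hom z).
  pose h (p : int * int) : int * int := (p.2, p.1 - p.2).
  have hb : bijective h.
    exists (fun p => (p.2 + p.1, p.1)) => -[c d]; rewrite /h /=; congr pair; lia.
  have := asum_csum (asum_comp (bij_inj hb) aP); apply: eq_asum => m.
  rewrite -csumZ; last first.
    have [B B0 hB] := inv_one_minus_bound hom b.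
    have := asumZ B%:C (asum_comp (bij_inj (subz_bij m)) (asum_tht hom)).
    apply: rbdd_le => l; rewrite /= 2!nmM nm_real ger0_norm // ler_wpM2r ?nm_ge0 //.
    exact: (hB l).1.
  apply: eq_csum => l; rewrite /h /= mulrACA -cexpD mulrC; congr (cexp _ * _).
  by rewrite intrB; ring.
apply: eq_csum => m; rewrite inner -[LHS]mulrA [csum _ * _]mulrC.
rewrite (Theta_quasi hom m b) -[X in cexp _ * X]mulrA.
rewrite (partial_fraction hom (nonlattice_shift m nb)) /tht.
have E (s c u v : C) : u * (s * v * c) = c * (s * (u * v)) by ring.
have E2 (s c u v : C) : c * (s * u * v) = c * (s * (u * v)) by ring.
by rewrite [LHS]E [RHS]E2 -!cexpD; congr (_ * (_ * cexp _)); ring.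
Qed.

Definition DTheta (z : C) : C := csum (fun k : int => k%:~R * (tht k * cexp (k%:~R * z))).

(** Summands of the coefficient of [e^(m z)] in the Lambert series at [b = 0] times [Theta z],
    divided by [tht m]. The term [l = 0] is [0], since [kcoef 0 0] is the inverse of [0]. *)
Definition lcoef (m l : int) : C := kcoef 0 l * (tht (- l) * cexp (- (2 * om * m%:~R * l%:~R))).

Lemma asum_lcoef m : asum (lcoef m).
Proof.
have [B B0 hB] := inv_one_minus_bound hom 0.
have := asumZ B%:C (asum_comp (bij_inj oppz_bij) (asum_Theta hom (2 * om * m%:~R))).
apply: rbdd_le => l; rewrite /= /lcoef (nmM (kcoef 0 l)) (nmM B%:C) nm_real ger0_norm //.
have -> : (- l)%:~R * (2 * om * m%:~R) = - (2 * om * m%:~R * l%:~R) :> C by rewrite intrN; ring.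
by rewrite ler_wpM2r ?nm_ge0 //; exact: (hB l).1.
Qed.

Lemma nome_neq1 (l : int) : l != 0 -> 1 - cexp (2 * om * l%:~R) != 0.
Proof.
move=> l0; rewrite subr_eq0; apply/eqP => /(congr1 nm).
rewrite nm1 -[2 * om * _]add0r nm_nome raddf0 add0r => /esym/eqP.
rewrite -[X in _ == X]expR0 (inj_eq (@expR_inj _)) !mulf_eq0 pnatr_eq0 /= intr_eq0 (negbTE l0) orbF.
by rewrite (lt_eqF hom).
Qed.

(** The summand is odd in [l]. *)
Lemma csum_lcoef0 : csum (lcoef 0) = 0.
Proof.
have h : csum (lcoef 0) = - csum (lcoef 0).
  rewrite {1}(csum_bij oppz_bij (asum_lcoef 0)) -[RHS]mulN1r -csumZ; last exact: asum_lcoef.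
  apply: eq_csum => l; rewrite /= /lcoef opprK !(mulr0, mul0r, oppr0) cexp0 !mulr1.
  rewrite /kcoef !add0r intrN mulrN cexpN.
  have [->|l0] := eqVneq l 0.
    by rewrite mulr0 cexp0 invr1 subrr invr0 !(mul0r, mulr0).
  have q1 := nome_neq1 l0; have q0 := cexp_neq0 (2 * om * l%:~R).
  have -> : tht l = tht (- l) / cexp (2 * om * l%:~R).
    by rewrite -cexpN /tht sgN -mulrA -cexpD intrN; congr (_ * cexp _); ring.
  move: (cexp _) q1 q0 => q q1 q0; field.
  by rewrite q1 q0 /= -[q - 1]opprB oppr_eq0 q1.
have : csum (lcoef 0) *+ 2 = 0 by rewrite mulr2n {2}h subrr.
by move=> /eqP; rewrite mulrn_eq0 /= => /eqP.
Qed.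

(** Passing to [m + 1] multiplies the term by [q^(- l)], with [q = exp (2 om)], and the difference
    cancels the denominator. What remains is a theta series at a lattice point, whose sum is [0],
    with its term [1] at [l = 0] missing. *)
Lemma csum_lcoef_step m : csum (lcoef (m + 1)) = csum (lcoef m) - 1.
Proof.
pose g l := tht (- l) * cexp (- (2 * om * (m + 1)%:~R * l%:~R)).
pose d (l : int) : C := if l == 0 then 1 else 0.
have gE : g = (fun k => tht k * cexp (k%:~R * (2 * om * (m + 1)%:~R))) \o (fun k => - k).
  by apply/funext => l; rewrite /g /= intrN; congr (_ * cexp _); ring.
have ag : asum g by rewrite gE; apply: asum_comp (bij_inj oppz_bij) (asum_Theta hom _).
have g0 : csum g = 0.
  by rewrite gE -(csum_bij oppz_bij (asum_Theta hom _)); exact: Theta_lattice.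
have [|hd ad] := @csum_fin _ _ d [:: 0] erefl.
  by move=> l; rewrite inE /d => /negbTE ->.
move/hsum_csum : hd; rewrite big_seq1 {2}/d eqxx => d1.
have E l : lcoef (m + 1) l = lcoef m l + (g l - d l).
  rewrite /lcoef /g /d /kcoef add0r; case: eqVneq => [->|l0].
    by rewrite !mulr0 !oppr0 !cexp0 subrr invr0 !mul0r add0r /tht sg0 expr0n subrr mulr0 cexp0 !mulr1 subrr.
  have q1 := nome_neq1 l0; have q0 := cexp_neq0 (2 * om * l%:~R).
  have -> : cexp (- (2 * om * (m + 1)%:~R * l%:~R)) =
      cexp (- (2 * om * m%:~R * l%:~R)) / cexp (2 * om * l%:~R).
    by rewrite -cexpB; congr cexp; rewrite intrD; ring.
  by move: (tht _) (cexp (- _)) (cexp _) q1 q0 => t e q q1 q0; field; rewrite q1 q0.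
rewrite (eq_csum E) csumD; [|exact: asum_lcoef|]; last first.
  by apply: asumD => //; have := asumZ (-1) ad; apply: eq_asum => l; rewrite mulN1r.
by rewrite csumB // g0 d1 sub0r.
Qed.

Lemma csum_lcoef m : csum (lcoef m) = - m%:~R.
Proof.
have pos (n : nat) : csum (lcoef n%:Z) = - (n%:Z)%:~R.
  elim: n => [|n IH]; first by rewrite csum_lcoef0 oppr0.
  by rewrite -addn1 PoszD csum_lcoef_step IH intrD opprD.
have neg (n : nat) : csum (lcoef (- n%:Z)) = (n%:Z)%:~R.
  elim: n => [|n IH]; first by rewrite oppr0 csum_lcoef0.
  have := csum_lcoef_step (- (n.+1)%:Z).
  rewrite (_ : - (n.+1)%:Z + 1 = - n%:Z); last lia.
  by rewrite IH => /esym/eqP; rewrite subr_eq => /eqP ->; rewrite -addn1 PoszD intrD.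
by case: m => n; [exact: pos|rewrite NegzE neg intrN opprK].
Qed.

Lemma log_derivative (z : C) : 2 * complex.Re om < complex.Re z < 0 ->
  DTheta z = - (csum (fun l => kcoef 0 l * cexp (l%:~R * z)) * Theta z).
Proof.
move=> hz; rewrite mul_Theta; last exact: asum_kcoef.
have E m : csum (fun l => kcoef 0 l * tht (m - l)) = - (m%:~R * tht m).
  transitivity (tht m * csum (lcoef m)); last by rewrite csum_lcoef; ring.
  rewrite -csumZ; last exact: asum_lcoef.
  apply: eq_csum => l; rewrite /lcoef tht_shift intrN mulrN.
  by move: (cexp _) (tht m) (tht _) => e t t'; ring.
have aD : asum (fun k : int => k%:~R * (tht k * cexp (k%:~R * z))).
  apply: rbdd_le (rbdd_tht hom (nm z + 1)) => k.
  rewrite (nmM k%:~R) (nmM (tht k)) [X in X <= _]mulrCA ler_wpM2l ?nm_ge0 //.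
  rewrite nm_cexp_int mulrDr mulr1 addrC expRD intC nm_real; apply: ler_pM; rewrite ?expR_ge0 //.
    by apply: le_trans (expR_ge1Dx _); lra.
  rewrite ler_expR; apply: le_trans (ler_norm _) _.
  by rewrite normrM ler_wpM2l // nm_Re.
rewrite -[RHS]mulN1r -csumZ.
  by apply: eq_csum => m; rewrite E mulrN mulN1r opprK; ring.
have := asumZ (-1) aD; apply: eq_asum => m; rewrite E; ring.
Qed.

(** The exponents become the half-integers [k - 1/2], symmetric about [0], and the function becomes
    odd. It is a multiple of the prime form. *)
Definition halfTheta (z : C) : C := cexp (- (z / 2)) * Theta z.

(* Indices (k, l) of the double series for a product of two theta values are split according
   to the parity of k - l. *)
Definition evenSum (z : C) : C :=
  csum (fun j : int => cexp (2 * om * j%:~R ^+ 2) * cexp (2 * j%:~R * z)).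

Definition oddSum (z : C) : C :=
  csum (fun i : int => cexp (2 * om * (i%:~R ^+ 2 + i%:~R)) * cexp ((2 * i%:~R + 1) * z)).

Lemma asum_evenSum z :
  asum (fun j : int => cexp (2 * om * j%:~R ^+ 2) * cexp (2 * j%:~R * z)).
Proof.
have a0 : 0 < - (2 * complex.Re om) by have hom' := hom; lra.
apply: rbdd_le (rbdd_gauss (2 * nm z) a0) => j; rewrite nmM !nm_cexp -expRD ler_expR.
have -> : 2 * om * j%:~R ^+ 2 = (2 * j%:~R ^+ 2 : R)%:C * om.
  by rewrite rmorphM rmorphXn /= -intC rmorph_nat; ring.
have -> : 2 * j%:~R * z = (2 * j%:~R : R)%:C * z by rewrite rmorphM /= -intC rmorph_nat.
rewrite !Re_mul_real opprK; have h := nm_Re z; have := ler_norm (j%:~R * complex.Re z).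
have : `|j%:~R * complex.Re z| <= `|j%:~R| * nm z by rewrite normrM ler_wpM2l.
by move: (`|_ * _|) => x; lra.
Qed.

Lemma asum_oddSum z :
  asum (fun i : int => cexp (2 * om * (i%:~R ^+ 2 + i%:~R)) * cexp ((2 * i%:~R + 1) * z)).
Proof.
have := asumZ (cexp z) (asum_evenSum (z + om)); apply: eq_asum => i.
rewrite -!cexpD; congr cexp; ring.
Qed.

Lemma asum_even z :
  asum (fun k : int => tht k * cexp ((k%:~R - 2^-1) * z)).
Proof.
have := asumZ (cexp (- (z / 2))) (asum_Theta hom z); apply: eq_asum => k.
by rewrite mulrCA -cexpD; congr (_ * cexp _); ring.
Qed.

Lemma halfThetaE z : halfTheta z = csum (fun k : int => tht k * cexp ((k%:~R - 2^-1) * z)).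
Proof.
rewrite /halfTheta -csumZ; last exact: asum_Theta.
by apply: eq_csum => k; rewrite mulrCA -cexpD; congr (_ * cexp _); ring.
Qed.

(** In the sum and difference of the two indices both the quadratic and the linear exponents
    separate; since sum and difference have the same parity, two products arise. The right-hand side
    is a 2 by 2 minor, so the three-term identity will be a Pluecker relation. *)
Lemma halfTheta_bilinear x y :
  halfTheta (x + y) * halfTheta (x - y) = oddSum x * evenSum y - evenSum x * oddSum y.
Proof.
have a1 := asum_even (x + y); have a2 := asum_even (x - y).
have aP := asum_prod a1 a2; rewrite !halfThetaE csum_prod //.
set G := (fun p : int * int => _) in aP *.
pose h (p : int * int) : int * int := (p.2, p.2 - p.1).
have hb : bijective h.
  exists (fun p => (p.1 - p.2, p.1)) => -[c d]; rewrite /h /=; congr pair; lia.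
have ah := asum_comp (bij_inj hb) aP.
rewrite (csum_bij hb aP) csum_pair //.
have ag := asum_csum ah.
have i1 : injective (fun j : int => 2 * j) by move=> c d /=; lia.
have i2 : injective (fun j : int => 2 * j + 1) by move=> c d /=; lia.
have [||||||_ ->] := csum_split (h := fun j : int => 2 * j) (k := fun j : int => 2 * j + 1)
    (f := fun i => csum (fun j => (G \o h) (i, j))).
- exact: i1.
- exact: i2.
- by move=> c d; lia.
- move=> i; have [e|e] : (exists j : int, i = 2 * j) \/ (exists j : int, i = 2 * j + 1).
  + case: (boolP (2 %| i)%Z) => [/dvdzP[c ->]|]; first by left; exists c; rewrite mulrC.
    by move=> ?; right; exists ((i - 1) %/ 2)%Z; lia.
  + by left; case: e => j ->; exists j.
  + by right; case: e => j ->; exists j.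
- exact: asum_comp i1 ag.
- exact: asum_comp i2 ag.
have E s t a b c d : s * cexp a * cexp b * (t * cexp c * cexp d) = s * t * cexp (a + b + c + d) :> C.
  by rewrite !cexpD; ring.
congr (_ + _).
  rewrite mulrC -csumZr; last exact: asum_evenSum.
  apply: eq_csum => j /=.
  (* The original indices are now [i + j + 1] and [i - j + 1]; the corresponding half-integral
     exponents have sum [2 i + 1] and difference [2 j]. *)
  rewrite (csum_bij (addz_bij (j + 1))); last exact: asum_fst ah.
  rewrite -csumZ; last exact: asum_oddSum.
  apply: eq_csum => i; rewrite /G /h /= /tht E -sgD.
  rewrite (_ : i + (j + 1) + (i + (j + 1) - 2 * j) = (i + 1) + (i + 1)); last lia.
  by rewrite sgD sg_sq mul1r -!cexpD !(intrB, intrD, intrM); congr cexp; field; rewrite ?pnatr_eq0.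
rewrite -mulNr -csumZ; last exact: asum_oddSum.
apply: eq_csum => i /=.
rewrite (csum_bij (addz_bij (i + 1))); last exact: asum_fst ah.
rewrite [RHS]mulrC mulrN -mulNr -csumZ; last exact: asum_evenSum.
apply: eq_csum => j; rewrite /G /h /= /tht E -sgD.
rewrite (_ : j + (i + 1) + (j + (i + 1) - (2 * i + 1)) = 1 + (j + j)); last lia.
rewrite !sgD sg_sq mulr1 sg1 -[X in _ = X * _]mulN1r -[RHS]mulrA; congr (_ * _).
by rewrite -!cexpD !(intrB, intrD, intrM); congr cexp; field.
Qed.

End Kronecker.

(** * Exponentials of power series and Bernoulli numbers *)

Section ExpSeries.
Context {R : realType}.
Local Notation C := R[i].
Implicit Types (c d e g : nat -> C) (r : R).

Lemma asum_sum (I : eqType) (f : nat -> I -> C) N : (forall k, (k < N)%N -> asum (f k)) ->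
  asum (fun i => \sum_(k < N) f k i) /\
  csum (fun i => \sum_(k < N) f k i) = \sum_(k < N) csum (f k).
Proof.
elim: N => [|N IH] hf.
  split; first by exists 0 => s _; rewrite big1 // => i _; rewrite big_ord0 nm0.
  rewrite big_ord0 -[RHS](csum0 (R := R) I); apply: eq_csum => i; by rewrite big_ord0.
have [a1 E1] := IH (fun k kN => hf k (leqW kN)); have a2 := hf N (ltnSn N).
split; first by have := asumD a1 a2; apply: eq_asum => i; rewrite big_ord_recr.
rewrite big_ord_recr /= -E1 -csumD //; apply: eq_csum => i; by rewrite big_ord_recr.
Qed.

Lemma pmul_bound c d r A B : 0 <= r ->
  (forall s, uniq s -> \sum_(n <- s) nm (c n) * r ^+ n <= A) ->
  (forall s, uniq s -> \sum_(n <- s) nm (d n) * r ^+ n <= B) ->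
  forall s, uniq s -> \sum_(n <- s) nm (pmul c d n) * r ^+ n <= A * B.
Proof.
move=> r0 hA hB s us.
pose x n := nm (c n) * r ^+ n; pose y n := nm (d n) * r ^+ n.
have x0 n : 0 <= x n by rewrite mulr_ge0 ?nm_ge0 ?exprn_ge0.
have y0 n : 0 <= y n by rewrite mulr_ge0 ?nm_ge0 ?exprn_ge0.
have [N sub] : exists N, {subset s <= iota 0 N}.
  exists (\max_(i <- s) i).+1.
  by move=> i hi; rewrite mem_iota add0n ltnS leq_bigmax_seq.
apply: le_trans (sum_sub _ us sub) _.
  by move=> n; rewrite mulr_ge0 ?nm_ge0 ?exprn_ge0.
apply: (@le_trans _ _ (\sum_(n <- iota 0 N) \sum_(i <- iota 0 N | (i <= n)%N) x i * y (n - i)%N)).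
  rewrite big_seq [X in _ <= X]big_seq; apply: ler_sum => n; rewrite mem_iota /= => nN.
  apply: (@le_trans _ _ (\sum_(i < n.+1) nm (c i * d (n - i)%N) * r ^+ n)).
    by rewrite -mulr_suml ler_wpM2r ?exprn_ge0 // nm_sum.
  rewrite -(big_mkord xpredT (fun i => nm (c i * d (n - i)%N) * r ^+ n)).
  rewrite -[X in _ <= X]big_filter.
  apply: (@le_trans _ _ (\sum_(i <- index_iota 0 n.+1) x i * y (n - i)%N)).
    rewrite big_seq [X in _ <= X]big_seq; apply: ler_sum => i; rewrite mem_index_iota /= => hi.
    have -> : r ^+ n = r ^+ i * r ^+ (n - i) by rewrite -exprD subnKC // -ltnS.
    by rewrite nmM mulrACA.
  apply: sum_sub; [by move=> i; rewrite mulr_ge0|exact: iota_uniq|].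
  by move=> i; rewrite mem_filter !mem_iota => hi; lia.
rewrite (exchange_big_dep xpredT) //.
apply: (@le_trans _ _ (\sum_(i <- iota 0 N) x i * B)).
  apply: ler_sum => i _; rewrite -mulr_sumr ler_wpM2l //.
  rewrite -big_filter.
  have := hB [seq (n - i)%N | n <- [seq n <- iota 0 N | (i <= n)%N]]; rewrite big_map; apply.
  rewrite map_inj_in_uniq ?filter_uniq ?iota_uniq // => n m.
  by rewrite !mem_filter => /andP[h1 _] /andP[h2 _]; lia.
rewrite -mulr_suml ler_wpM2r //; last by apply: hA; exact: iota_uniq.
by have := hB [::] erefl; rewrite big_nil.
Qed.

(** Read off from the values of the series by uniqueness of coefficients. *)
Lemma pmulCA c d e r : 0 < r -> pconv c r -> pconv d r -> pconv e r ->
  pmul c (pmul d e) = pmul d (pmul c e).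
Proof.
move=> r0 hc hd he; have r0' := ltW r0.
have hde := pconv_pmul r0' hd he; have hce := pconv_pmul r0' hc he.
apply: (pse_unique r0); [exact: pconv_pmul..|].
move=> x x0; have [|h h0 hh] := @small_real R (Num.min x r); first by rewrite lt_min x0.
move: hh; rewrite lt_min => /andP[h1 /ltW h2]; exists h; split => //.
rewrite (pse_pmul hc hde h2) (pse_pmul hd he h2) (pse_pmul hd hce h2) (pse_pmul hc he h2).
by rewrite mulrCA.
Qed.

(** The operator [z d/dz] on coefficients. *)
Definition euler c n : C := n%:R * c n.

Lemma euler_pmul c d n : euler (pmul c d) n = pmul (euler c) d n + pmul c (euler d) n.
Proof.
rewrite /euler /pmul -big_split mulr_sumr; apply: eq_bigr => i _ /=.
have le : (i <= n)%N by rewrite -ltnS.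
by rewrite -{1}(subnKC le) natrD; ring.
Qed.

Definition pone n : C := (n == 0%N)%:R.

Fixpoint cpow c j : nat -> C := if j is j'.+1 then pmul c (cpow c j') else pone.

Lemma pone_hsum h : hsum (fun n => pone n * h ^+ n) 1 /\ asum (fun n => pone n * h ^+ n).
Proof.
have [|E a] := @csum_fin R _ (fun n => pone n * h ^+ n) [:: 0%N] erefl.
  by move=> [|n] // _; rewrite /pone mul0r.
by split => //; rewrite big_seq1 /pone eqxx mul1r expr0 in E.
Qed.

Lemma pconv_cpow c r j : 0 <= r -> pconv c r -> pconv (cpow c j) r.
Proof.
move=> r0 hc; elim: j => [|j IH] /=; last exact: pconv_pmul.
by have [_] := pone_hsum r%:C; apply: rbdd_le => n; rewrite nmM nmX nm_real ger0_norm.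
Qed.

Lemma pse_cpow c r j h : 0 <= r -> pconv c r -> nm h <= r -> pse (cpow c j) h = pse c h ^+ j.
Proof.
move=> r0 hc hr; elim: j => [|j IH] /=.
  by have [E _] := pone_hsum h; rewrite /pse (hsum_csum E) expr0.
by rewrite (pse_pmul hc (pconv_cpow j r0 hc) hr) IH exprS.
Qed.

Lemma cpow_bound c r A j : 0 <= r ->
  (forall s, uniq s -> \sum_(n <- s) nm (c n) * r ^+ n <= A) ->
  forall s, uniq s -> \sum_(n <- s) nm (cpow c j n) * r ^+ n <= A ^+ j.
Proof.
move=> r0 hA; elim: j => [|j IH] s us /=.
  apply: le_trans (sum_fin_le (s := [:: 0%N]) us _ _) _.
  - by move=> n; rewrite mulr_ge0 ?nm_ge0 ?exprn_ge0.
  - by move=> [|n] // _; rewrite /pone nm0 mul0r.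
  - by rewrite big_seq1 /pone nm1 mul1r expr0.
by rewrite exprS; exact: pmul_bound.
Qed.

Lemma euler_cpow c r j n : 0 < r -> pconv c r ->
  euler (cpow c j.+1) n = j.+1%:R * pmul (euler c) (cpow c j) n.
Proof.
move=> r0 hc; have r20 : 0 < r / 2 by lra.
have hc' : pconv c (r / 2) by apply: pconv_le hc; lra.
have he : pconv (euler c) (r / 2).
  have h := pconv_pshift 1 (ltW r20) (pconv_pderiv 1 (ltW r20) (_ : r / 2 < r) hc).
  by move: h; rewrite pshift_pderiv1; apply; lra.
elim: j n => [|j IH] n; rewrite euler_pmul.
  rewrite mul1r [X in _ + X](_ : _ = 0) ?addr0 // /pmul big1 // => i _.
  by rewrite /euler /pone; case: (n - i)%N => [|k]; rewrite ?mul0r ?mulr0.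
have -> : pmul c (euler (cpow c j.+1)) n = j.+1%:R * pmul c (pmul (euler c) (cpow c j)) n.
  by rewrite /pmul mulr_sumr; apply: eq_bigr => i _; rewrite IH mulrCA.
rewrite (pmulCA r20 hc' he) -?[j.+2%:R]natr1 /=; first by ring.
exact: pconv_cpow (ltW r20) hc'.
Qed.

(** The last clause is the equation [z h' = (z g') h]. It determines [h] up to its constant term, so
    a series can be recognised as an exponential from its recursion alone. *)
Theorem exp_series g r : 0 < r -> pconv g r ->
  exists h, [/\ pconv h r, forall z, nm z <= r -> pse h z = cexp (pse g z) &
    forall n, n%:R * h n = pmul (euler g) h n].
Proof.
move=> r0 hg; have [A hA] := hg; have r0' := ltW r0.
have A0 : 0 <= A by have := hA [::] erefl; rewrite big_nil.
pose F z (p : nat * nat) : C := cpow g p.1 p.2 / p.1`!%:R * z ^+ p.2.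
have aF z : nm z <= r -> asum (F z).
  move=> hz; apply: (asum_pair (g := exp_coeff A)) (rbdd_exp A0) => j s us.
  apply: le_trans (_ : \sum_(n <- s) (nm (cpow g j n) * r ^+ n) / j`!%:R <= _).
    apply: ler_sum => n _; rewrite /F /= !nmM nmX nmV nm_nat mulrAC.
    rewrite ler_wpM2r ?invr_ge0 // ler_wpM2l ?nm_ge0 // lerXn2r ?nnegrE ?nm_ge0 //.
  by rewrite -mulr_suml ler_wpM2r ?invr_ge0 // cpow_bound.
have nr : nm (r%:C : C) = r by rewrite nm_real ger0_norm.
have aFn n : asum (fun j => cpow g j n / j`!%:R).
  have := aF r%:C; rewrite nr lexx => /(_ isT)/asum_swap/(asum_fst n) /= a.
  have rn : (r%:C : C) ^+ n != 0 by rewrite expf_neq0 // -nm_gt0 nr.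
  by have := asumZr ((r%:C) ^+ n)^-1 a; apply: eq_asum => j; rewrite /F /= mulfK.
pose h n := csum (fun j => cpow g j n / j`!%:R).
exists h; split.
- have := asum_csum (asum_swap (aF r%:C _)); rewrite nr lexx => /(_ isT).
  by apply: rbdd_le => n /=; rewrite /F /= csumZr // nmM nmX nr.
- move=> z hz; rewrite cexpE.
  rewrite [RHS](_ : _ = csum (fun j => csum (fun n => F z (j, n)))).
    rewrite (csum_exchange (aF z hz)); apply: eq_csum => n.
    by rewrite /F /= csumZr.
  apply: eq_csum => j; rewrite /exp_term -(pse_cpow j r0' hg hz) /pse -csumZr.
    by apply: eq_csum => n; rewrite /F /= mulrAC.
  exact: pconv_asum (pconv_cpow j r0' hg) hz.
- move=> n; rewrite -csumZ // csum_nat_recl; last exact: asumZ.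
  rewrite [X in X + _](_ : _ = 0) ?add0r; last first.
    by rewrite /= /pone; case: n => [|n]; rewrite ?mul0r ?mulr0.
  have E j : ((fun j => n%:R * (cpow g j n / j`!%:R)) \o S) j =
      \sum_(k < n.+1) euler g k * (cpow g j (n - k)%N / j`!%:R).
    have := euler_cpow j n r0 hg; rewrite /euler /= mulrA => ->.
    rewrite factS natrM invfM mulrAC mulrA mulfV ?pnatr_eq0 // mul1r mulrC.
    by rewrite /pmul mulr_suml; apply: eq_bigr => k _; rewrite mulrA.
  rewrite (eq_csum E).
  have [|_ ->] := @asum_sum _ (fun k j => euler g k * (cpow g j (n - k)%N / j`!%:R)) n.+1.
    by move=> k _; exact: asumZ.
  by apply: eq_bigr => k _; rewrite csumZ.
Qed.

Lemma exp_series_unique g h h' : (forall n, n%:R * h n = pmul (euler g) h n) ->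
  (forall n, n%:R * h' n = pmul (euler g) h' n) -> h' 0%N = 1 ->
  forall n, h n = h 0%N * h' n.
Proof.
move=> H H' h1 n; have [k] := ubnP n; elim: k n => // k IH [|n] nk.
  by rewrite h1 mulr1.
have n0 : n.+1%:R != 0 :> C by rewrite pnatr_eq0.
apply: (mulfI n0); rewrite H mulrCA H' /pmul mulr_sumr; apply: eq_bigr => -[[|i] hi] _ /=.
  by rewrite /euler !mul0r mulr0.
have le : (n.+1 - i.+1 < k)%N by lia.
by rewrite (IH _ le) mulrCA.
Qed.

End ExpSeries.

(** * Bernoulli numbers as coefficients of z / (e^z - 1) *)

Section BernoulliSeries.
Context {R : realType}.
Local Notation C := R[i].

Definition bern (n : nat) : C := ratr (bernoulli n) / n`!%:R.

Definition expm1_coef (n : nat) : C := (n.+1)`!%:R^-1.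

Lemma size_bernoulli_seq n : size (bernoulli_seq n) = n.
Proof. by elim: n => //= n IH; rewrite size_rcons IH. Qed.

Lemma nth_bernoulli_seq n j : (j < n)%N -> (bernoulli_seq n)`_j = bernoulli j.
Proof.
elim: n => // n IH; rewrite ltnS leq_eqVlt => /orP[/eqP ->//|jn].
by rewrite /= nth_rcons size_bernoulli_seq jn IH.
Qed.

Lemma bernoulliE n : bernoulli n =
  ((n == 0%N)%:R - \sum_(j < n) 'C(n.+1, j)%:R * bernoulli j) / n.+1%:R.
Proof.
rewrite {1}/bernoulli /= nth_rcons size_bernoulli_seq ltnn eqxx.
by congr ((_ - _) / _); apply: eq_bigr => j _; rewrite nth_bernoulli_seq.
Qed.

Lemma fact_neq0 n : n`!%:R != 0 :> C.
Proof. by rewrite pnatr_eq0 -lt0n fact_gt0. Qed.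

(** The Bernoulli recursion divided by [n!] is the recursion for the reciprocal of
    [(e^z - 1) / z]. *)
Lemma bern_prec n : bern n = prec expm1_coef n.
Proof.
have [k] := ubnP n; elim: k n => // k IH n nk.
have -> : prec expm1_coef n = (n == 0%N)%:R - \sum_(j < n) expm1_coef (n - j) * prec expm1_coef j.
  by rewrite precE [expm1_coef 0]/expm1_coef factS fact0 muln1 invr1 divr1.
rewrite /expm1_coef /bern bernoulliE.
rewrite fmorph_div /= rmorphB rmorph_sum /= !rmorph_nat mulrBl mulrBl.
have -> : (n == 0%N)%:R / n.+1%:R / n`!%:R = (n == 0%N)%:R :> C.
  by case: n {nk} => [|n]; rewrite ?mul0r // fact0 !divr1.
congr (_ - _); rewrite !mulr_suml; apply: eq_bigr => j _.
rewrite -IH; last exact: leq_trans (ltn_ord j) _.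
have le : (j <= n.+1)%N by apply: ltnW; apply: ltnW; rewrite ltnS; exact: ltn_ord.
have E : n.+1%:R * n`!%:R = 'C(n.+1, j)%:R * (j`!%:R * ((n - j).+1)`!%:R) :> C.
  by rewrite -!natrM -factS -(bin_fact le) subSn // ltnW.
have b0 : 'C(n.+1, j)%:R != 0 :> C by rewrite pnatr_eq0 -lt0n bin_gt0.
rewrite rmorphM rmorph_nat /= /bern -mulrA -invfM E.
by field; rewrite !fact_neq0 b0.
Qed.

Lemma expm1_series : exists2 r : R, 0 < r & pconv expm1_coef r /\
  forall z, nm z <= r -> cexp z = 1 + z * pse expm1_coef z.
Proof.
have hc : pconv (fun n => n`!%:R^-1 : C) 1.
  by apply: rbdd_le (asum_exp (1 : C)) => n; rewrite /exp_term !nmM nmX nm1 expr1n mulr1 mul1r.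
exists 1 => //; split.
  by have := pconv_shift 1 ltr01 hc; congr pconv; apply/funext => n; rewrite addn1.
move=> z hz; have := pse_recl ltr01 hc hz; rewrite fact0 invr1 => <-.
by rewrite cexpE; apply: eq_csum => n; rewrite /exp_term mulrC.
Qed.

Lemma bernoulli_series : exists2 r : R, 0 < r & pconv bern r /\
  forall z, nm z <= r -> pse bern z * (cexp z - 1) = z /\ (z != 0 -> cexp z != 1).
Proof.
have [r r0 [hc hz]] := expm1_series.
have c0 : expm1_coef 0 != 0 by rewrite /expm1_coef invr_eq0 fact_neq0.
have [r' /andP[r'0 rr'] hp] := pconv_prec r0 hc c0.
have bE : bern = prec expm1_coef by apply/funext => n; exact: bern_prec.
rewrite -bE in hp.
exists r' => //; split => // z zr.
have hc' : pconv expm1_coef r' by apply: pconv_le hc => //; exact: ltW.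
have E : pse bern z * pse expm1_coef z = 1.
  rewrite -(pse_pmul hp hc' zr); have [h _] := pone_hsum z.
  rewrite /pse -(hsum_csum h); apply: eq_csum => n.
  by rewrite bE pmul_prec.
have ez := hz z (le_trans zr rr').
split; first by rewrite ez addrC addKr mulrCA E mulr1.
move=> z0; rewrite ez -subr_eq0 addrC addKr mulf_neq0 //.
by apply/eqP => p0; move: E; rewrite p0 mulr0 => /esym/eqP; rewrite oner_eq0.
Qed.

(** The function [z / (e^z - 1)] at [- z] equals its value at [z] plus [z]. Comparing coefficients
    gives [bern n = - bern n] for odd [n] other than [1]. *)
Lemma bern_odd n : odd n -> (2 < n)%N -> bern n = 0.
Proof.
move=> on n2; have [r r0 [hb hz]] := bernoulli_series.
pose c m : C := (-1) ^+ m * bern m.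
pose d m : C := bern m + affine_coef 0 1 m.
have pc : pconv c r by apply: rbdd_le hb => m; rewrite /c nmM nmX nmN nm1 expr1n mul1r.
have pa : pconv (affine_coef (0 : C) 1) r.
  have c0 m : m \notin [:: 0; 1]%N -> affine_coef (0 : C) 1 m * r%:C ^+ m = 0.
    by case: m => [|[|m]] //= _; rewrite mul0r.
  have [|_ a] := @csum_fin R _ (fun m => affine_coef 0 1 m * r%:C ^+ m) [:: 0; 1]%N erefl.
    exact: c0.
  by apply: rbdd_le a => m; rewrite nmM nmX nm_real gtr0_norm.
have pd := pconvD (ltW r0) hb pa.
suff /(congr1 (fun f => f n)) : c = d.
  rewrite /c /d -signr_odd on expr1 mulN1r; case: n on n2 => [|[|n]] //= _ _.
  rewrite addr0 => /eqP; rewrite eq_sym -addr_eq0 -mulr2n mulrn_eq0 /= => /eqP //.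
apply: (pse_unique r0) => // e e0.
have [|h h0 hh] := @small_real R (Num.min e r); first by rewrite lt_min e0.
move: hh; rewrite lt_min => /andP[h1 /ltW h2]; exists h; split => //.
have -> : pse c h = pse bern (- h).
  by apply: eq_csum => m; rewrite /c [(- h) ^+ m]exprNn [RHS]mulrCA [RHS]mulrA.
have -> : pse d h = pse bern h + h.
  rewrite (pseD hb pa h2); congr (_ + _).
  have c0 m : m \notin [:: 1]%N -> affine_coef (0 : C) 1 m * h ^+ m = 0.
    by case: m => [|[|m]] //= _; rewrite mul0r.
  have [|/hsum_csum E _] := @csum_fin R _ (fun m => affine_coef 0 1 m * h ^+ m) [:: 1]%N erefl.
    exact: c0.
  by rewrite /pse E big_seq1 mul1r expr1.
have [E1 /(_ h0) ne] := hz h h2; have [|E2 _] := hz (- h); first by rewrite nmN.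
have e0' := cexp_neq0 h; rewrite cexpN in E2.
have ne' : cexp h - 1 != 0 by rewrite subr_eq0.
apply: (mulIf ne'); rewrite (mulrDl (pse bern h)) E1.
have -> : cexp h - 1 = - cexp h * ((cexp h)^-1 - 1) by field.
by rewrite mulrCA E2; field.
Qed.

End BernoulliSeries.

(** * The prime form as a theta function *)

Section ThetaNonzero.
Context {R : realType}.
Local Notation C := R[i].

Lemma asum_tail (I : eqType) (c : I -> C) (e : R) : asum c -> 0 < e ->
  exists2 s : seq I, uniq s & forall t, uniq t -> (forall i, i \in t -> i \notin s) ->
    \sum_(i <- t) nm (c i) <= e.
Proof.
move=> ac e0; have [l hl] := hsum_nonneg (fun i => nm_ge0 (c i)) ac.
have e20 : 0 < e / 2 by lra.
have [s us hs] := hl _ e20; exists s => // t ut dis.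
have h1 := hs s us (fun _ => id).
have h2 : nm (\sum_(i <- s ++ t) (nm (c i))%:C - l) < e / 2.
  apply: hs; last by move=> i; rewrite mem_cat => ->.
  rewrite cat_uniq us ut andbT /=; apply/hasPn => i /dis //.
have h3 := nm_triangle (\sum_(i <- s ++ t) (nm (c i))%:C) l (\sum_(i <- s) (nm (c i))%:C).
have h4 : nm (\sum_(i <- s ++ t) (nm (c i))%:C - \sum_(i <- s) (nm (c i))%:C) =
    `|\sum_(i <- t) nm (c i)|.
  by rewrite big_cat addr_subl -raddf_sum nm_real.
have h5 := ler_norm (\sum_(i <- t) nm (c i)).
by rewrite h4 [nm (l - _)]nm_distC in h3; lra.
Qed.

Lemma cexp_ipi : cexp ('i%C * pi%:C) = -1 :> C.
Proof.
rewrite /cexp /= !(mul0r, mul1r, mulr0, subr0, add0r, addr0, oppr0) expR0 cospi sinpi !mul1r.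
by apply/eqP; rewrite eq_complex /= ?oppr0 !eqxx.
Qed.

Lemma cexp_int_ipi (k : int) : cexp (k%:~R * ('i%C * pi%:C)) = sg k :> C.
Proof. by rewrite cexpM_int cexp_ipi. Qed.

(** The values at [z / 2] and [z / 2 + i pi] are added: odd indices cancel and even ones double.
    Both points stay on the imaginary axis, where all the exponentials have modulus [1]. *)
Lemma even_part_zero (d : int -> C) : asum d ->
  (forall z, complex.Re z = 0 -> csum (fun k => d k * cexp (k%:~R * z)) = 0) ->
  forall z, complex.Re z = 0 -> csum (fun k => d (2 * k) * cexp (k%:~R * z)) = 0.
Proof.
move=> ad hd z rz.
have az w : complex.Re w = 0 -> asum (fun k => d k * cexp (k%:~R * w)).
  by move=> rw; apply: asum_le ad => k; rewrite nmM nm_cexp_int rw mulr0 expR0 mulr1.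
pose z1 := (2^-1 : R)%:C * z; pose z2 := z1 + 'i%C * pi%:C.
have r1 : complex.Re z1 = 0 by rewrite Re_mul_real rz mulr0.
have r2 : complex.Re z2 = 0 by rewrite Re_add r1 add0r /= !(mul0r, mulr0, subr0, oppr0).
have s0 : csum (fun k => d k * cexp (k%:~R * z1) + d k * cexp (k%:~R * z2)) = 0.
  by rewrite csumD ?hd ?addr0 //; apply: az.
have E k : d k * cexp (k%:~R * z1) + d k * cexp (k%:~R * z2) = (1 + sg k) * (d k * cexp (k%:~R * z1)).
  by rewrite /z2 mulrDr cexpD cexp_int_ipi; ring.
rewrite (eq_csum E) in s0.
have i2 : injective (fun j : int => 2 * j) by move=> a b /=; lia.
have sg2 (j : int) : sg (2 * j) = 1 :> C by rewrite mulrC -[2]/(1 + 1 : int) mulrDr mulr1 sgD sg_sq.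
have out (i : int) : (forall j, 2 * j <> i) -> (1 + sg i) * (d i * cexp (i%:~R * z1)) = 0.
  move=> hi; have [j ->] : exists j : int, i = 2 * j + 1.
    case: (boolP (2 %| i)%Z) => [/dvdzP[a ai]|]; first by case: (hi a); rewrite ai mulrC.
    by move=> ?; exists ((i - 1) %/ 2)%Z; lia.
  by rewrite sgD sg2 sg1 mul1r subrr mul0r.
have E2 j : ((fun i : int => (1 + sg i) * (d i * cexp (i%:~R * z1))) \o (fun j : int => 2 * j)) j =
    2 * (d (2 * j) * cexp (j%:~R * z)).
  rewrite /= sg2 (_ : 1 + 1 = 2) //; congr (_ * (_ * cexp _)).
  rewrite /z1 fmorphV rmorph_nat intrM mulrCA !mulrA mulVf ?mul1r ?pnatr_eq0 //.
have a2 : asum (fun j : int => d (2 * j) * cexp (j%:~R * z)).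
  by apply: asum_le (asum_comp i2 ad) => k /=; rewrite nmM nm_cexp_int rz mulr0 expR0 mulr1.
rewrite (csum_inj i2 out) in s0; last first.
  by have := asumZ 2 a2; apply: eq_asum => j; rewrite E2.
rewrite (eq_csum E2) csumZ // in s0.
by move/eqP: s0; rewrite mulf_eq0 pnatr_eq0 /= => /eqP.
Qed.

(* Averaging over the 2^n-th roots of unity (even_part_zero, iterated) keeps only the indices
   divisible by 2^n; apart from c 0 they leave every finite set of indices. *)
Lemma fourier_coef0 (c : int -> C) : asum c ->
  (forall z, complex.Re z = 0 -> csum (fun k => c k * cexp (k%:~R * z)) = 0) -> c 0 = 0.
Proof.
move=> ac hc.
have P n : forall z, complex.Re z = 0 -> csum (fun k : int => c (2 ^+ n * k) * cexp (k%:~R * z)) = 0.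
  elim: n => [|n IH] z rz.
    by rewrite -[RHS](hc z rz); apply: eq_csum => k; rewrite expr0 mul1r.
  have i2 : injective (fun k : int => 2 ^+ n * k).
    by move=> a b /mulfI; apply; rewrite expf_neq0.
  rewrite -[RHS](even_part_zero (asum_comp i2 ac) IH rz); apply: eq_csum => k /=.
  by rewrite exprSr mulrA.
apply: nm_small_eq0 => e e0.
have [s us hs] := asum_tail ac e0.
pose n := (\max_(i <- s) absz i)%N.
have i2 : injective (fun k : int => 2 ^+ n.+1 * k).
  by move=> a b /mulfI; apply; rewrite expf_neq0.
pose d (k : int) : C := if k == 0 then 0 else c (2 ^+ n.+1 * k).
pose d0 (k : int) : C := if k == 0 then c 0 else 0.
have [|h0 a0] := @csum_fin _ _ d0 [:: 0] erefl.
  by move=> k; rewrite inE /d0 => /negbTE ->.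
move/hsum_csum : h0; rewrite big_seq1 {2}/d0 eqxx => h0.
have a1 : asum d.
  apply: asum_le (asum_comp i2 ac) => k; rewrite /d /=; case: eqP => // _.
  by rewrite nm0 nm_ge0.
have : c 0 = - csum d.
  have := P n.+1 0 erefl; rewrite (eq_csum (g := fun k => d0 k + d k)); last first.
    move=> k; rewrite mulr0 cexp0 mulr1 /d0 /d; case: eqVneq => [->|_]; last by rewrite add0r.
    by rewrite mulr0 addr0.
  by rewrite csumD // h0 => /eqP; rewrite addr_eq0 => /eqP.
move=> ->; rewrite nmN; apply: nm_csum_le => t ut.
have -> : \sum_(i <- t) nm (d i) = \sum_(i <- [seq 2 ^+ n.+1 * k | k <- t & k != 0]) nm (c i).
  rewrite big_map big_filter [LHS](bigID (fun k : int => k != 0)) /= [X in _ + X]big1 ?addr0; last first.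
    by move=> k; rewrite negbK /d => ->; rewrite nm0.
  by apply: eq_bigr => k /negbTE k0; rewrite /d k0.
apply: hs; first by rewrite map_inj_uniq ?filter_uniq.
move=> i /mapP[k]; rewrite mem_filter => /andP[k0 _] ->; apply/negP => hk.
have h1 := @leq_bigmax_seq _ s xpredT absz _ hk isT; rewrite -/n abszM abszX in h1.
have k1 : (0 < `|k|)%N by rewrite absz_gt0.
have h2 := leq_trans (leq_pmulr (2 ^ n.+1) k1) h1.
have h3 := leq_trans (ltn_expl n.+1 (isT : (1 < 2)%N)) h2.
by rewrite ltnNge leqnSn in h3.
Qed.

Context (om : C) (hom : complex.Re om < 0).

Lemma Theta_not_zero : ~ (forall z, Theta om z = 0).
Proof.
move=> h; have := fourier_coef0 (asum_tht hom) (fun z _ => h z).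
rewrite /tht sg0 mul1r => /eqP; exact/negP/cexp_neq0.
Qed.

End ThetaNonzero.

(** * Taylor series, derivative and Lambert expansion of the odd theta series *)

Section HalfTheta.
Context {R : realType}.
Local Notation C := R[i].

Lemma exp_family_coef (I : eqType) (e : I -> R) (u : I -> C) (r : R) n : 0 < r ->
  rbdd (fun i => nm (u i) * expR (`|e i| * r)) ->
  asum (fun i => u i * ((e i)%:C ^+ n / n`!%:R)).
Proof.
move=> r0 hb; have rn : 0 <= (r ^+ n)^-1 by rewrite invr_ge0 exprn_ge0 ?ltW.
apply: rbdd_le (rbddZ rn hb) => i.
rewrite nmM mulrCA ler_wpM2l ?nm_ge0 //.
have h := sum_exp_coeff_le (mulr_ge0 (normr_ge0 (e i)) (ltW r0)) (isT : uniq [:: n]).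
rewrite big_seq1 /exp_coeff /= exprMn mulrAC in h.
by rewrite nmM nmX nm_real nmV nm_nat [X in _ <= X]mulrC ler_pdivlMr ?exprn_gt0.
Qed.

Context (om : C) (hom : complex.Re om < 0).
Local Notation tht := (tht om).
Local Notation Theta := (Theta om).
Local Notation T := (halfTheta om).

Definition hexp (k : int) : R := k%:~R - 2^-1.

Lemma hexpC k : (hexp k)%:C = k%:~R - 2^-1 :> C.
Proof. by rewrite /hexp rmorphB /= -intC fmorphV rmorph_nat. Qed.

Lemma halfTheta_family z (r : R) : 0 <= r ->
  rbdd (fun k => nm (tht k * cexp ((hexp k)%:C * z)) * expR (`|hexp k| * r)).
Proof.
move=> r0; have h := rbdd_tht hom (nm z + r).
apply: rbdd_le (rbddZ (expR_ge0 ((nm z + r) / 2)) h) => k.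
rewrite (nmM (tht k)) [X in _ <= X]mulrCA -[X in X <= _]mulrA ler_wpM2l ?nm_ge0 //.
rewrite nm_cexp Re_mul_real -!expRD ler_expR.
have hk : `|hexp k| <= `|k%:~R| + 2^-1.
  by apply: le_trans (ler_normB _ _) _; rewrite [`|2^-1|]ger0_norm.
have h1 := ler_norm (hexp k * complex.Re z); rewrite normrM in h1.
have h2 : `|hexp k| * `|complex.Re z| <= `|hexp k| * nm z by rewrite ler_wpM2l // nm_Re.
have h3 : `|hexp k| * (nm z + r) <= (`|k%:~R| + 2^-1) * (nm z + r).
  by rewrite ler_wpM2r // addr_ge0 // nm_ge0.
by lra.
Qed.

Lemma halfTheta_exp z : T z = csum (fun k => tht k * cexp ((hexp k)%:C * z)).
Proof. by rewrite halfThetaE //; apply: eq_csum => k; rewrite hexpC. Qed.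

Lemma halfTheta_entire : entire T.
Proof.
move=> z; have [h1 h2] := exp_family ler01 (halfTheta_family z ler01).
eexists; apply: has_ps_near; exists 1 => //; split; first exact: h1.
move=> h hr; have [_ <-] := h2 h hr; rewrite halfTheta_exp; apply: eq_csum => k.
by rewrite mulrDr cexpD mulrA.
Qed.

Lemma halfTheta0_family (r : R) : 0 <= r -> rbdd (fun k => nm (tht k) * expR (`|hexp k| * r)).
Proof.
move=> r0; apply: rbdd_le (halfTheta_family 0 r0) => k.
by rewrite mulr0 cexp0 mulr1.
Qed.

Definition Tcoef n : C := csum (fun k => tht k * ((hexp k)%:C ^+ n / n`!%:R)).

Lemma Tcoef_series r : 0 <= r ->
  pconv Tcoef r /\ forall z, nm z <= r -> T z = pse Tcoef z.
Proof.
move=> r0; have [h1 h2] := exp_family r0 (halfTheta0_family r0); split => // z hz.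
by have [_ <-] := h2 z hz; rewrite halfTheta_exp.
Qed.

(** The derivative of [halfTheta], taken term by term. *)
Definition DT (z : C) : C := csum (fun k => tht k * (hexp k)%:C * cexp ((hexp k)%:C * z)).

Lemma DT_family (r : R) : 0 <= r ->
  rbdd (fun k => nm (tht k * (hexp k)%:C) * expR (`|hexp k| * r)).
Proof.
move=> r0; have r1 : 0 <= r + 1 by lra.
apply: rbdd_le (halfTheta0_family r1) => k.
rewrite (nmM (tht k)) nm_real -mulrA ler_wpM2l ?nm_ge0 // mulrDr mulr1 addrC expRD.
by rewrite ler_wpM2r ?expR_ge0 //; apply: le_trans (expR_ge1Dx _); lra.
Qed.

Lemma DT_series z : z * DT z = pse (fun n => n%:R * Tcoef n) z.
Proof.
have r0 : 0 < nm z + 1 by have := nm_ge0 z; lra.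
have zr : nm z <= nm z + 1 by lra.
have [hT _] := Tcoef_series (ltW r0).
have [h1 h2] := exp_family (ltW r0) (DT_family (ltW r0)).
have E : (fun n => csum (fun k => tht k * (hexp k)%:C * ((hexp k)%:C ^+ n / n`!%:R))) = pderiv 1 Tcoef.
  apply/funext => n; rewrite /pderiv /Tcoef -csumZ; last first.
    exact: exp_family_coef r0 (halfTheta0_family (ltW r0)).
  apply: eq_csum => k; rewrite addn1 bin1 exprS factS natrM.
  by field; rewrite fact_neq0 nat1r pnatr_eq0.
rewrite E in h1; rewrite -pshift_pderiv1 (pse_pshift _ h1 zr) expr1 -E.
by have [_ <-] := h2 z zr.
Qed.

Lemma DT_DTheta z : 2 * complex.Re om < complex.Re z < 0 ->
  DT z = - (csum (fun l => kcoef om 0 l * cexp (l%:~R * z)) + 2^-1) * T z.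
Proof.
move=> hz; have aT := asum_Theta hom z.
have aD : asum (fun k => tht k * (hexp k)%:C * cexp ((hexp k)%:C * z)).
  have [_ h] := exp_family (nm_ge0 z) (DT_family (nm_ge0 z)).
  by have [] := h z (lexx _).
have E k : tht k * (hexp k)%:C * cexp ((hexp k)%:C * z) =
   cexp (- (z / 2)) * (k%:~R * (tht k * cexp (k%:~R * z)) + (- 2^-1) * (tht k * cexp (k%:~R * z))).
  have -> : cexp ((hexp k)%:C * z) = cexp (- (z / 2)) * cexp (k%:~R * z).
    by rewrite -cexpD hexpC; congr cexp; ring.
  by rewrite hexpC; ring.
have aD' : asum (fun k : int => k%:~R * (tht k * cexp (k%:~R * z))).
  have := asumD (asumZ (cexp (- (z / 2)))^-1 aD) (asumZ 2^-1 aT); apply: eq_asum => k.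
  by rewrite E mulKf ?cexp_neq0 //; ring.
rewrite /DT (eq_csum E) csumZ; last by apply: asumD => //; exact: asumZ.
rewrite csumD //; last exact: asumZ.
rewrite csumZ // -/(DTheta om z) -/(Theta z) (log_derivative hom hz) /halfTheta; ring.
Qed.

(** Summation by parts: [tht j = acoef j - acoef (j - 1)] turns the sum of [j tht j] into minus the
    sum of [acoef j], and the shift by [1/2] contributes a multiple of the sum of [tht], which is
    [0]. *)
Lemma cTheta_Tcoef1 : Tcoef 1 = - cTheta om.
Proof.
have a0 : 0 < - complex.Re om by have hom' := hom; lra.
have [B B0 hB] := acoef_bound hom.
have aA : asum (acoef om) by have := asum_partialTheta hom 0; apply: eq_asum => j; rewrite mulr0 cexp0 mulr1.
have akA : asum (fun j : int => j%:~R * acoef om j).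
  apply: rbdd_le (rbddZ B0 (rbdd_gauss 1 a0)) => j.
  rewrite nmM intC nm_real mul1r opprK expRD mulrA [X in X <= _]mulrC.
  apply: ler_pM; [exact: nm_ge0|exact: normr_ge0|exact: hB|].
  by apply: le_trans (expR_ge1Dx _); lra.
have E j : tht j * ((hexp j)%:C ^+ 1 / 1`!%:R) = j%:~R * (acoef om j - acoef om (j - 1)) - 2^-1 * tht j.
  by rewrite [acoef om j](acoef_rec hom) addrK expr1 factS fact0 muln1 divr1 hexpC; ring.
have i1 := bij_inj (addz_bij (- 1)).
have aA1 : asum (fun j : int => acoef om (j - 1)) := asum_comp i1 aA.
have akA1 : asum (fun j : int => j%:~R * acoef om (j - 1)).
  have := asumD (asum_comp i1 akA) aA1; apply: eq_asum => j /=.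
  by rewrite intrB; ring.
have E2 j : j%:~R * (acoef om j - acoef om (j - 1)) - 2^-1 * tht j
   = (j%:~R * acoef om j - j%:~R * acoef om (j - 1)) + (- 2^-1) * tht j by ring.
rewrite /Tcoef (eq_csum E) (eq_csum E2) csumD; last 2 first.
- by have := asumD akA (asumZ (-1) akA1); apply: eq_asum => j; rewrite mulN1r.
- by apply: asumZ; exact: asum_tht.
rewrite csumZ; last exact: asum_tht.
rewrite csum_tht // mulr0 addr0 csumB //.
rewrite (csum_bij (addz_bij 1) akA1) /cTheta /partialTheta.
have E3 j : ((fun j : int => j%:~R * acoef om (j - 1)) \o (fun k => k + 1)) j = j%:~R * acoef om j + acoef om j.
  by rewrite /= addrK intrD; ring.
rewrite (eq_csum E3) csumD // opprD addrA subrr add0r; congr (- _).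
by apply: eq_csum => j; rewrite mulr0 cexp0 mulr1.
Qed.

Definition lambert_term (r : nat) : C :=
  cexp (2 * om * r.+1%:R) / (1 - cexp (2 * om * r.+1%:R)).

Lemma lambert_family (e : nat -> R) (rho : R) : 0 <= rho -> rho < - (2 * complex.Re om) ->
  (forall r, `|e r| = r.+1%:R) -> rbdd (fun r => nm (lambert_term r) * expR (`|e r| * rho)).
Proof.
move=> rho0 rho1 he; have [B B0 hB] := inv_one_minus_bound hom 0.
have d0 : 0 < - (2 * complex.Re om) - rho by lra.
have Pi : injective Posz by move=> ? ? [].
apply: rbdd_le (rbddZ B0 (rbdd_comp (inj_comp Pi succn_inj) (rbdd_exp_lin d0))) => r /=.
have [h _] := hB (Posz r.+1); rewrite !add0r -pmulrn in h.
rewrite he /lambert_term nmM; apply: (@le_trans _ _ (nm (cexp (2 * om * r.+1%:R)) * B * expR (r.+1%:R * rho))).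
  by rewrite ler_wpM2r ?expR_ge0 // ler_wpM2l ?nm_ge0.
rewrite [nm _ * B]mulrC -[X in X <= _]mulrA ler_wpM2l //.
have := @nm_nome R om 0 (Posz r.+1); rewrite add0r -pmulrn raddf0 add0r => ->.
rewrite -expRD ler_expR -pmulrn ger0_norm //; lra.
Qed.

Definition lambert_sum (z : C) : C :=
  csum (fun r : nat => lambert_term r * cexp (r.+1%:R * z)) - csum (fun r : nat => lambert_term r * cexp (- r.+1%:R * z)).

Definition lambert_coef (n : nat) : C :=
  csum (fun r : nat => lambert_term r * (r.+1%:R ^+ n / n`!%:R))
  - csum (fun r : nat => lambert_term r * ((- r.+1%:R) ^+ n / n`!%:R)).

Lemma lambert_series : pconv lambert_coef (- complex.Re om) /\ forall z, nm z <= - complex.Re om ->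
  [/\ asum (fun r : nat => lambert_term r * cexp (r.+1%:R * z)),
      asum (fun r : nat => lambert_term r * cexp (- r.+1%:R * z)) & lambert_sum z = pse lambert_coef z].
Proof.
have hom' := hom; have r0 : 0 <= - complex.Re om by lra.
have r1 : - complex.Re om < - (2 * complex.Re om) by lra.
pose e1 (r : nat) : R := r.+1%:R; pose e2 (r : nat) : R := - r.+1%:R.
have e1C r : (e1 r)%:C = r.+1%:R :> C by rewrite rmorph_nat.
have e2C r : (e2 r)%:C = - r.+1%:R :> C by rewrite rmorphN rmorph_nat.
have he1 r : `|e1 r| = r.+1%:R by rewrite ger0_norm.
have he2 r : `|e2 r| = r.+1%:R by rewrite normrN ger0_norm.
have [p1 s1] := exp_family r0 (lambert_family r0 r1 he1).
have [p2 s2] := exp_family r0 (lambert_family r0 r1 he2).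
have E1 : (fun n => csum (fun r => lambert_term r * ((e1 r)%:C ^+ n / n`!%:R))) =
   (fun n => csum (fun r => lambert_term r * (r.+1%:R ^+ n / n`!%:R))).
  by apply/funext => n; apply: eq_csum => r; rewrite e1C.
have E2 : (fun n => csum (fun r => lambert_term r * ((e2 r)%:C ^+ n / n`!%:R))) =
   (fun n => csum (fun r => lambert_term r * ((- r.+1%:R) ^+ n / n`!%:R))).
  by apply/funext => n; apply: eq_csum => r; rewrite e2C.
rewrite E1 in p1 s1; rewrite E2 in p2 s2.
split; first exact: pconvB r0 p1 p2.
move=> z hz; have [a1 c1] := s1 z hz; have [a2 c2] := s2 z hz; split.
- by apply: eq_asum a1 => r; rewrite e1C.
- by apply: eq_asum a2 => r; rewrite e2C.
have F1 r : lambert_term r * cexp (r.+1%:R * z) = lambert_term r * cexp ((e1 r)%:C * z) by rewrite e1C.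
have F2 r : lambert_term r * cexp (- r.+1%:R * z) = lambert_term r * cexp ((e2 r)%:C * z) by rewrite e2C.
rewrite /lambert_sum (eq_csum F1) (eq_csum F2) c1 c2; exact: esym (pseB p1 p2 hz).
Qed.

Lemma asum_pow (x : C) : nm x < 1 -> asum (fun r : nat => x ^+ r.+1) /\
  (1 - x) * csum (fun r : nat => x ^+ r.+1) = x.
Proof.
move=> x1; have a0 : asum (fun r : nat => x ^+ r).
  by apply: rbdd_le (rbdd_geo (nm_ge0 x) x1) => n; rewrite nmX.
have a1 : asum (fun r : nat => x ^+ r.+1).
  by have := asumZ x a0; apply: eq_asum => r; rewrite exprS.
split => //; have E : csum (fun r : nat => x ^+ r.+1) = x * csum (fun r : nat => x ^+ r).
  by rewrite -csumZ //; apply: eq_csum => r; rewrite exprS.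
have E1 : csum (fun r : nat => x ^+ r) = 1 + csum (fun r : nat => x ^+ r.+1).
  by rewrite csum_nat_recl // expr0.
move: E; rewrite E1; move: (csum _) => X EX.
by rewrite mulrBl mul1r {1}EX; ring.
Qed.

(** With [q = exp (2 om)], [1 / (1 - q^l)] is [1 + q^l / (1 - q^l)] for [l > 0] and
    [- q^(-l) / (1 - q^(-l))] for [l < 0]. The ones add up to a geometric series, the only part that
    is singular at [z = 0]; the rest is analytic there. *)
Lemma kcoef0_expansion z : nm z <= - complex.Re om -> complex.Re z < 0 ->
  csum (fun l => kcoef om 0 l * cexp (l%:~R * z)) = cexp z / (1 - cexp z) + lambert_sum z.
Proof.
move=> hz z0; have hom' := hom; have [_ /(_ z hz)[a1 a2 _]] := lambert_series.
have hz' : 2 * complex.Re om < complex.Re z < 0.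
  by have := nm_Re z; rewrite ler_norml; lra.
have ak := asum_kcoef hom 0 hz'.
have nx : nm (cexp z) < 1 by rewrite nm_cexp -[X in _ < X]expR0 ltr_expR.
have [ax sx] := asum_pow nx.
(* The inline terms are the injectivity of [Posz] and [Negz], the argument being recovered by
   [absz]. *)
have ap := asum_comp (f := fun l : int => kcoef om 0 l * cexp (l%:~R * z)) (h := Posz) (fun m n e => let: erefl in _ = b := e return m = absz b in erefl) ak.
have an := asum_comp (f := fun l : int => kcoef om 0 l * cexp (l%:~R * z)) (h := Negz) (fun m n e => let: erefl in _ = b := e return m = (absz b).-1 in erefl) ak.
have [_ ->] := asum_int ap an.
rewrite csum_nat_recl //= {1}/kcoef mulr0 addr0 cexp0 subrr invr0 mul0r add0r.
have q1 r : 1 - cexp (2 * om * r.+1%:R) != 0.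
  by have := nome_neq1 hom (l := Posz r.+1) isT; rewrite -pmulrn.
have E1 r : ((fun l : nat => kcoef om 0 (Posz l) * cexp ((Posz l)%:~R * z)) \o S) r =
   cexp z ^+ r.+1 + lambert_term r * cexp (r.+1%:R * z).
  rewrite /= -pmulrn -cexpM_nat /kcoef add0r /lambert_term -pmulrn.
  by have := q1 r; move: (cexp _) (cexp _) => q x q0; field.
have E2 r : ((fun l : int => kcoef om 0 l * cexp (l%:~R * z)) \o Negz) r =
   (-1) * (lambert_term r * cexp (- r.+1%:R * z)).
  rewrite /= NegzE intrN -pmulrn /kcoef add0r /lambert_term mulrN cexpN.
  have := q1 r; have := cexp_neq0 (2 * om * r.+1%:R).
  move: (cexp _) (cexp _) => q x q0 q1'; field.
  by rewrite q0 q1' -[x - 1]opprB oppr_eq0 q1'.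
rewrite (eq_csum E1) (eq_csum E2) csumD // csumZ // mulN1r -addrA; congr (_ + _).
have x1 : 1 - cexp z != 0.
  by rewrite subr_eq0; apply/eqP => /(congr1 nm); rewrite nm1 => e1; rewrite -e1 ltxx in nx.
by apply: (mulfI x1); rewrite sx mulrC divfK.
Qed.

End HalfTheta.

Section PrimeForm.
Context {R : realType}.
Local Notation C := R[i].
Context (tau : C) (htau : 0 < complex.Im tau).

(* The period 2 pi i tau is 2 (half_period tau). *)
Definition half_period (t : C) : C := 'i%C * pi%:C * t.
Local Notation om := (half_period tau).

Lemma half_period_lt0 : complex.Re om < 0.
Proof.
have p0 := @pi_gt0 R.
have -> : complex.Re om = - (pi * complex.Im tau) by rewrite /half_period; case: tau => a b /=; ring.
by rewrite oppr_lt0 mulr_gt0.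
Qed.
Local Notation hom := half_period_lt0.

Lemma two_pi_iE : two_pi_i R = 2 * ('i%C * pi%:C).
Proof.
rewrite /two_pi_i mulr_natl !mulr2n; apply/eqP; rewrite eq_complex /=.
by rewrite !(mul0r, mul1r, mulr0, subr0, add0r, addr0, oppr0) !eqxx.
Qed.

Lemma qexpE (r : R) : qexp tau r = cexp (2 * om * r%:C).
Proof. by rewrite /qexp two_pi_iE /half_period; congr cexp; ring. Qed.

(* Coefficients of z T'(z) / T(z) at 0, where T is halfTheta. *)
Definition pcoef (n : nat) : C :=
  bern n + affine_coef 0 2^-1 n - pshift 1 (lambert_coef om) n.

(** The logarithmic derivative times [z] is [z / (e^z - 1) + z / 2 - z lambert_sum z]. It is
    obtained for [Re z < 0] only, where the Lambert series converges, which is enough for comparing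
    coefficients. *)
Lemma pcoef_series : exists2 r, 0 < r & pconv pcoef r /\
  forall z, nm z <= r -> complex.Re z < 0 -> z * DT om z = halfTheta om z * pse pcoef z.
Proof.
have hom := hom; have [r1 r10 [hb hz]] := @bernoulli_series R.
have [hh hH] := lambert_series hom.
pose r := Num.min r1 (- complex.Re om).
have r0 : 0 < r by rewrite lt_min r10; lra.
have rr1 : r <= r1 by rewrite ge_min lexx.
have rr2 : r <= - complex.Re om by rewrite ge_min lexx orbT.
have pb : pconv (@bern R) r by exact: pconv_le (ltW r0) rr1 hb.
have ph : pconv (lambert_coef om) r by exact: pconv_le (ltW r0) rr2 hh.
have ps := pconv_pshift 1 (ltW r0) ph.
have c0 m : m \notin [:: 1]%N -> forall h : C, affine_coef (0 : C) 2^-1 m * h ^+ m = 0.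
  by case: m => [|[|m]] //= _ h; rewrite mul0r.
have pa : pconv (affine_coef (0 : C) 2^-1) r.
  have [|_ a] := @csum_fin R _ (fun m => affine_coef 0 2^-1 m * r%:C ^+ m) [:: 1]%N erefl.
    by move=> m /c0.
  by apply: rbdd_le a => m; rewrite nmM nmX nm_real gtr0_norm.
have pba := pconvD (ltW r0) pb pa.
exists r => //; split; first exact: pconvB (ltW r0) pba ps.
move=> z zr z0; have [E1 ne] := hz z (le_trans zr rr1).
have zn0 : z != 0 by apply: contraTneq z0 => ->; rewrite raddf0 ltxx.
have {}ne := ne zn0.
have [_ _ EH] := hH z (le_trans zr rr2).
have hz' : 2 * complex.Re om < complex.Re z < 0.
  by have := nm_Re z; rewrite ler_norml; have := le_trans zr rr2; lra.
rewrite (DT_DTheta hom hz') (kcoef0_expansion hom (le_trans zr rr2) z0) EH.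
have -> : pse pcoef z = pse (@bern R) z + 2^-1 * z - z * pse (lambert_coef om) z.
  rewrite (pseB pba ps zr) (pseD pb pa zr) (pse_pshift 1 ph zr) expr1; congr (_ + _ - _).
  have [|/hsum_csum E _] := @csum_fin R _ (fun m => affine_coef 0 2^-1 m * z ^+ m) [:: 1]%N erefl.
    by move=> m /c0.
  by rewrite /pse E big_seq1 expr1.
have e1 : cexp z - 1 != 0 by rewrite subr_eq0.
have e2 : 1 - cexp z != 0 by rewrite -opprB oppr_eq0.
have -> : pse (@bern R) z = z / (cexp z - 1) by apply: (mulIf e1); rewrite E1 divfK.
by field; rewrite e1 e2.
Qed.

Lemma Tcoef0 : Tcoef om 0 = 0.
Proof.
have [_ h] := Tcoef_series hom (lexx (0 : R)).
by rewrite -[LHS]pse0 -h ?nm0 // /halfTheta (Theta0 hom) mulr0.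
Qed.

Lemma Tcoef_rec n : n%:R * Tcoef om n = pmul (Tcoef om) pcoef n.
Proof.
have [r r0 [hp hz]] := pcoef_series; have r20 : 0 < r / 2 by lra.
have [hT hT2] := Tcoef_series hom (ltW r0).
have hp' : pconv pcoef (r / 2) by apply: pconv_le hp; lra.
have hT' : pconv (Tcoef om) (r / 2) by apply: pconv_le hT; lra.
have r2r : r / 2 < r by lra.
have hE := pconv_pshift 1 (ltW r20) (pconv_pderiv 1 (ltW r20) r2r hT).
rewrite pshift_pderiv1 in hE.
suff /(congr1 (fun f => f n)) : (fun n => n%:R * Tcoef om n) = pmul (Tcoef om) pcoef by [].
apply: (pse_unique r20 hE (pconv_pmul (ltW r20) hT' hp')) => e e0.
(* The test point is a negative real, since the relation of [pcoef_series] is known in the left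
   half-disc. *)
pose z : C := (- (Num.min e (r / 2) / 2))%:C.
have m0 : 0 < Num.min e (r / 2) by rewrite lt_min e0.
have nz : nm z = Num.min e (r / 2) / 2 by rewrite nm_real normrN ger0_norm //; lra.
have zz : nm z < Num.min e (r / 2) by rewrite nz; lra.
move: (zz); rewrite lt_min => /andP[z1 /ltW z2]; exists z; split => //.
  by rewrite -nm_gt0 nz; lra.
rewrite (pse_pmul hT' hp' z2) -(DT_series hom) hz ?hT2 //=; lra.
Qed.

(** For odd [n] the two halves of [lambert_coef (n - 1)] cancel and the Bernoulli number vanishes;
    for even [n] they agree up to sign, which is the factor [2] in the Eisenstein series. *)
Lemma eisenstein_pcoef n : (1 < n)%N -> pcoef n = - eisenstein n tau.
Proof.
move=> n1; have hom := hom.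
have r0 : 0 < - complex.Re om by lra.
have r1 : - complex.Re om < - (2 * complex.Re om) by lra.
have ag k : asum (fun r : nat => lambert_term om r * (r.+1%:R ^+ k / k`!%:R)).
  pose e (r : nat) : R := r.+1%:R.
  have he r : `|e r| = r.+1%:R by rewrite ger0_norm.
  have := exp_family_coef k r0 (lambert_family hom (ltW r0) r1 he).
  by apply: eq_asum => r; rewrite rmorph_nat.
rewrite /pcoef /eisenstein; case: n n1 => [|[|n]] // _.
rewrite /= addr0 /pshift /= subn1 /= negbK /lambert_coef.
have E r : lambert_term om r * ((- r.+1%:R) ^+ n.+1 / n.+1`!%:R) =
    (-1) ^+ n.+1 * (lambert_term om r * (r.+1%:R ^+ n.+1 / n.+1`!%:R)).
  by rewrite exprNn; ring.
rewrite (eq_csum E) csumZ //.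
case: (boolP (odd n)) => on.
  have -> : (-1) ^+ n.+1 = 1 :> C by rewrite -signr_odd /= on.
  by rewrite mul1r subrr subr0 bern_odd ?oppr0 //=; [rewrite negbK|case: n on {E}].
have -> : (-1) ^+ n.+1 = -1 :> C by rewrite -signr_odd /= on.
have -> : limn (series (fun r : nat => r.+1%:R ^+ n.+1 * qexp tau r.+1%:R / (1 - qexp tau r.+1%:R)))
   = n.+1`!%:R * csum (fun r => lambert_term om r * (r.+1%:R ^+ n.+1 / n.+1`!%:R)).
  have E2 r : n.+1`!%:R * (lambert_term om r * (r.+1%:R ^+ n.+1 / n.+1`!%:R)) =
     r.+1%:R ^+ n.+1 * qexp tau r.+1%:R / (1 - qexp tau r.+1%:R).
    rewrite qexpE rmorph_nat /lambert_term; have := @fact_neq0 R n.+1.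
    move: (1 - _)^-1 => v f0; field; exact: f0.
  rewrite -csumZ // limn_csum; first exact/esym/eq_csum.
  by have := asumZ (n.+1`!%:R) (ag n.+1); apply: eq_asum.
have f0 := @fact_neq0 R n.+1; rewrite -/(bern n.+2).
rewrite mulrA divfK // mulN1r opprK /bern; ring.
Qed.

Lemma pcoef0 : pcoef 0 = 1.
Proof.
by rewrite /pcoef bern_prec precE big_ord0 /expm1_coef /= subr0 factS fact0 muln1 !(invr1, divr1, addr0, subr0) mulr1.
Qed.

Lemma pcoef1 : pcoef 1 = 0.
Proof.
rewrite /pcoef /pshift /= subnn /lambert_coef.
rewrite (eq_csum (g := fun r : nat => lambert_term om r * (r.+1%:R ^+ 0 / 0`!%:R))); last first.
  by move=> r; rewrite !expr0.
rewrite subrr subr0 bern_prec precE big_ord_recr big_ord0 /= precE big_ord0 /expm1_coef.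
rewrite !factS fact0 !muln1 !(invr1, divr1, subr0, add0r, sub0r, mulr1); ring.
Qed.

(** Coefficients of the logarithm of [T z / (c z)], where [T] is [halfTheta] and [c] its first
    Taylor coefficient: the integral of [(pcoef - 1) / z]. *)
Definition gcoef n : C := if n is 0%N then 0 else pcoef n / n%:R.

(** Dividing [T] by [z] takes [pcoef 0 = 1] off the logarithmic derivative, so [T z / z] satisfies
    the differential equation of the exponential of [gcoef]. *)
Lemma Tcoef_exp n : n%:R * Tcoef om n.+1 = pmul (euler gcoef) (fun k => Tcoef om k.+1) n.
Proof.
have eg k : euler gcoef k.+1 = pcoef k.+1 by rewrite /euler /gcoef mulrCA mulfV ?mulr1 // pnatr_eq0.
have := Tcoef_rec n.+1; rewrite /pmul big_ord_recl Tcoef0 mul0r add0r => E.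
rewrite [RHS](reindex_inj rev_ord_inj) /=.
move: E; rewrite big_ord_recr /= subnn pcoef0 mulr1 -natr1 mulrDl mul1r => /addIr ->.
rewrite big_ord_recr /= subnn /euler mul0r mul0r addr0; apply: eq_bigr => i _.
rewrite /bump leq0n add1n !subSS subKn; last exact: ltnW.
have : (0 < n - i)%N by rewrite subn_gt0.
case: (n - i)%N => // k _; rewrite -eg mulrC.
by [].
Qed.

Lemma pconv_gcoef r : 0 < r -> pconv pcoef r -> pconv gcoef r.
Proof.
move=> /ltW r0; apply: rbdd_le => -[|n].
  by rewrite nm0 mul0r mulr_ge0 ?nm_ge0 ?exprn_ge0.
rewrite ler_wpM2r ?exprn_ge0 // (nmM (pcoef _)) nmV nm_nat ler_pdivrMr //.
by rewrite ler_peMr ?nm_ge0 // ler1n.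
Qed.

Lemma halfTheta_near0 : exists2 r, 0 < r & forall z, nm z <= r ->
  halfTheta om z = Tcoef om 1 * (z * cexp (- P0_plus_log z tau)).
Proof.
have hom := hom; have [r r0 [hp _]] := pcoef_series.
have hg := pconv_gcoef r0 hp.
have [h [ph hh hrec]] := exp_series r0 hg.
have h0 : h 0%N = 1 by rewrite -[LHS]pse0 hh ?nm0 ?(ltW r0) // pse0 cexp0.
have uE := exp_series_unique Tcoef_exp hrec h0.
exists r => // z zr; have [hT ->] := Tcoef_series hom (ltW r0) => //.
rewrite (pse_recl r0 hT zr) Tcoef0 add0r mulrCA; congr (_ * _).
have -> : (fun n => Tcoef om n.+1) = (fun n => Tcoef om 1 * h n).
  by apply/funext => n; exact: uE.
rewrite (pseZ _ ph zr) hh //; congr (_ * cexp _).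
rewrite (pse_take 2 r0 hg zr) big_ord_recr big_ord1 /= pcoef1 !mul0r !add0r.
have hg2 := pconv_shift 2 r0 hg.
rewrite -csumZ; last exact: pconv_asum hg2 zr.
have E n : z ^+ 2 * (gcoef (n + 2)%N * z ^+ n) = (-1) * (n.+2%:R^-1 * eisenstein n.+2 tau * z ^+ n.+2).
  by rewrite addn2 /gcoef eisenstein_pcoef // !exprS; ring.
have a := asumZ (z ^+ 2) (pconv_asum hg2 zr).
have a2 : asum (fun n => n.+2%:R^-1 * eisenstein n.+2 tau * z ^+ n.+2).
  by have := asumZ (-1) a; apply: eq_asum => n; rewrite E; ring.
by rewrite (eq_csum E) csumZ // mulN1r /P0_plus_log limn_csum.
Qed.

(** By uniqueness for that equation every coefficient of [T z / z] is a multiple of this one, so if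
    it were [0] the theta series would vanish identically. *)
Lemma Tcoef1_neq0 : Tcoef om 1 != 0.
Proof.
apply/eqP => t0; apply: (Theta_not_zero hom) => z.
have hom := hom; have [r r0 [hp _]] := pcoef_series.
have hg := pconv_gcoef r0 hp.
have [h [ph hh hrec]] := exp_series r0 hg.
have h0 : h 0%N = 1 by rewrite -[LHS]pse0 hh ?nm0 ?(ltW r0) // pse0 cexp0.
have uE := exp_series_unique Tcoef_exp hrec h0.
have T0 n : Tcoef om n = 0 by case: n => [|n]; [exact: Tcoef0|rewrite uE t0 mul0r].
have [_ hT] := Tcoef_series hom (nm_ge0 z).
have : halfTheta om z = 0.
  rewrite hT // /pse -[RHS](csum0 (R := R) nat); apply: eq_csum => n; by rewrite T0 mul0r.
by rewrite /halfTheta => /eqP; rewrite mulf_eq0 (negbTE (cexp_neq0 _)) /= => /eqP.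
Qed.

Lemma entireZ (a : C) f : entire f -> entire (fun z => a * f z).
Proof.
move=> ef z; have [c hc] := analytic_has_ps (ef z).
exact: has_ps_analytic (has_psM (has_ps_cst a z) hc).
Qed.

Theorem prime_formE z : prime_form z tau = halfTheta om z / Tcoef om 1.
Proof.
have hom := hom; have t0 := Tcoef1_neq0.
pose K z := (Tcoef om 1)^-1 * halfTheta om z.
have eK : entire K by apply: entireZ; exact: halfTheta_entire.
have nK : \forall w \near (0 : C), K w = w * cexp (- P0_plus_log w tau).
  have [r r0 hr] := halfTheta_near0; apply/nbhsC_P; exists r => // w.
  by rewrite subr0 => /ltW /hr; rewrite /K => ->; rewrite mulKf.
rewrite [RHS]mulrC -/(K z) /prime_form; case: xgetP => [f _ [ef nf]|nf]; last first.
  by case: (nf K).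
suff -> : f = K by [].
apply: (identity_theorem (entire_meromorphic ef) (entire_meromorphic eK) (z0 := 0)).
move/nbhsC_P : nf => [r1 r10 h1]; move/nbhsC_P : nK => [r2 r20 h2].
exists (Num.min r1 r2); first by rewrite lt_min r10.
move=> h _; rewrite lt_min => /andP[hr1 hr2]; rewrite add0r h1 ?h2 ?subr0 //.
Qed.

End PrimeForm.

(** * Twisted Weierstrass functions as theta quotients *)

Section Lattice.
Context {R : realType}.
Local Notation C := R[i].

Lemma cexp_eq1 (w : C) : cexp w = 1 -> exists u : int, w = two_pi_i R * u%:~R.
Proof.
move=> w1; have p0 := @pi_gt0 R; have p20 : 0 < pi *+ 2 :> R by rewrite mulr2n; lra.
have rw : complex.Re w = 0.
  have := congr1 nm w1; rewrite nm_cexp nm1 => /eqP.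
  by rewrite -[X in _ == X]expR0 (inj_eq (@expR_inj _)) => /eqP.
pose u := Num.floor (complex.Im w / (pi *+ 2)); exists u.
pose v : C := w - two_pi_i R * u%:~R.
have tpi1 : cexp (two_pi_i R) = 1.
  apply/eqP; rewrite eq_complex /two_pi_i /cexp /= expR0 !mul1r.
  by rewrite cos2pi sin2pi !eqxx.
have v1 : cexp v = 1 by rewrite /v cexpB w1 [two_pi_i R * _]mulrC cexpM_int tpi1 exp1rz divr1.
have ev : v = 'i%C * (complex.Im w - pi *+ 2 * u%:~R)%:C.
  rewrite /v {1}[w]complexRI rw add0r rmorphB rmorphM /= -intC mulrBr; congr (_ - _).
  by rewrite two_pi_iE rmorphMn /=; ring.
set y := complex.Im w - _ in ev.
have y0 : 0 <= y.
  by rewrite subr_ge0 -ler_pdivlMl // mulrC floor_le.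
have y1 : y < pi *+ 2.
  rewrite ltrBlDl -{2}[pi *+ 2]mulr1 -mulrDr mulrC -ltr_pdivrMr //.
  by have := floorD1_gt (complex.Im w / (pi *+ 2)); rewrite intrD.
have cy : cos y = 1.
  have := congr1 (@complex.Re R) v1; rewrite ev /cexp /=.
  by rewrite !(mul0r, mul1r, mulr0, subr0, add0r, addr0, oppr0) expR0 mul1r.
(* Cosine is injective on [[0, pi]] only. Beyond [pi], the reflected angle [2 pi - y] would have to
   be [0], contrary to [y < 2 pi]. *)
have y00 : y = 0.
  case: (lerP y pi) => yp.
    by apply: cos_inj; rewrite ?in_itv /= ?y0 ?yp ?lexx ?ltW // cos0.
  have c2 : cos (pi *+ 2 - y) = 1 by rewrite cosB cos2pi sin2pi mul0r addr0 mul1r.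
  have : pi *+ 2 - y = 0.
    by apply: cos_inj; rewrite ?in_itv /= ?lexx ?(ltW p0) ?c2 ?cos0 //; rewrite mulr2n in y1 *; lra.
  by move=> h; lra.
by apply/eqP; rewrite -subr_eq0 -/v ev y00 mulr0.
Qed.

Context (tau : C) (htau : 0 < complex.Im tau).
Local Notation om := (half_period tau).
Local Notation hom := (half_period_lt0 htau).
Local Notation T := (halfTheta om).
Local Notation c1 := (Tcoef om 1).

Lemma nonlatticeP (z : C) : ~ period_lattice tau z -> nonlattice om z.
Proof.
move=> nz k; apply/eqP => /cexp_eq1[u hu]; apply: nz; exists u, (- k).
rewrite intrN mulrDr -hu two_pi_iE /half_period; ring.
Qed.

Lemma cTheta_neq0 : cTheta om != 0.
Proof. by have := Tcoef1_neq0 htau; rewrite (cTheta_Tcoef1 hom) oppr_eq0. Qed.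

Lemma halfTheta_neq0 z : nonlattice om z -> T z != 0.
Proof.
by move=> nz; rewrite mulf_neq0 ?cexp_neq0 // (Theta_neq0 hom) //; exact: cTheta_neq0.
Qed.

Lemma halfTheta_eq0 z : T z = 0 -> exists k : int, cexp (z + 2 * om * k%:~R) = 1.
Proof.
move=> z0; apply: contrapT => nk; have /halfTheta_neq0 : nonlattice om z.
  by move=> k; apply/eqP => h; apply: nk; exists k.
by rewrite z0 eqxx.
Qed.

Lemma nonlattice_add (z a : C) (k : int) : cexp (z + 2 * om * k%:~R) = 1 ->
  nonlattice om a -> nonlattice om (z + a).
Proof.
move=> zk na j; have -> : z + a + 2 * om * j%:~R =
    (z + 2 * om * k%:~R) + (a + 2 * om * (j - k)%:~R) by rewrite intrB; ring.
by rewrite cexpD zk mul1r; exact: na.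
Qed.

Lemma nonlattice_real (h : R) : 0 < h -> h < - (2 * complex.Re om) -> nonlattice om h%:C.
Proof.
move=> h0 h1 k; have h2 := hom; apply/eqP => /(congr1 nm); rewrite nm_nome nm1 => /eqP.
rewrite -[X in _ == X]expR0 (inj_eq (@expR_inj _)) /= => /eqP e.
have [k0|[k0|k0]] : (k%:~R : R) <= 0 \/ k = 1 \/ (1 : R) <= (k - 1)%:~R.
- case: (lerP k 0) => hk; first by left; rewrite lerz0.
  right; case: (eqVneq k 1) => [->|k1]; first by left.
  by right; rewrite ler1z; lia.
- by have : 0 <= complex.Re om * k%:~R; [rewrite mulr_le0 //; exact: ltW|lra].
- by rewrite k0 mulr1 in e; lra.
- have : complex.Re om * (k%:~R - 2) <= 0; last by lra.
  by rewrite mulr_le0_ge0 ?(ltW h2) //; move: k0; rewrite intrB (_ : 1%:~R = 1) //; lra.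
Qed.

(** Two test points, [z + d] and [z + 2 d]: if the first is a zero it lies in the lattice, and then
    the second does not. *)
Lemma halfTheta_isolated z (e : R) : 0 < e ->
  exists h, [/\ h != 0, nm h < e & T (z + h) != 0].
Proof.
move=> e0; have hom' := hom.
(* A third of the minimum makes [2 d < e] and keeps [d] strictly between [0] and the modulus
   [- 2 Re om] of the real parts of the lattice. *)
pose d := Num.min e (- (2 * complex.Re om)) / 3.
have m0 : 0 < Num.min e (- (2 * complex.Re om)) by rewrite lt_min e0; lra.
have m1 : Num.min e (- (2 * complex.Re om)) <= e by rewrite ge_min lexx.
have m2 : Num.min e (- (2 * complex.Re om)) <= - (2 * complex.Re om) by rewrite ge_min lexx orbT.
have nd x : 0 < x -> (nm (x%:C : C) = x) * (x%:C != 0 :> C).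
  by move=> x0; rewrite -nm_gt0 nm_real gtr0_norm.
have d0 : 0 < d by rewrite /d; lra.
have d20 : 0 < 2 * d by lra.
case: (eqVneq (T (z + d%:C)) 0) => [/halfTheta_eq0[k hk]|]; last first.
  by move=> h; exists d%:C; rewrite !nd //; split => //; rewrite /d; lra.
exists (2 * d)%:C; rewrite !nd //; split => //; first by rewrite /d; lra.
have -> : z + (2 * d)%:C = (z + d%:C) + d%:C by rewrite rmorphM rmorph_nat; ring.
by apply: halfTheta_neq0 (nonlattice_add hk (nonlattice_real _ _)) => //; rewrite /d; lra.
Qed.

Lemma entire_shift (f : C -> C) (a : C) : entire f -> entire (fun z => f (z + a)).
Proof.
move=> ef z; have [c [r r0 [hc hf]]] := analytic_has_ps (ef (z + a)).
apply: (@has_ps_analytic _ _ _ c); exists r => //; split=> // h hr.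
by rewrite addrAC hf.
Qed.

Lemma entireM (f g : C -> C) : entire f -> entire g -> entire (fun z => f z * g z).
Proof.
move=> ef eg z; have [c hc] := analytic_has_ps (ef z); have [d hd] := analytic_has_ps (eg z).
exact: has_ps_analytic (has_psM hc hd).
Qed.

(** The instance of [exp_family] with a one-element index. *)
Lemma entire_cexp (l : R) : entire (fun z : C => cexp (l%:C * z)).
Proof.
move=> z; pose u (_ : unit) := cexp (l%:C * z); pose e (_ : unit) := l.
have hb : rbdd (fun i => nm (u i) * expR (`|e i| * 1)).
  exists (\sum_(i <- [:: tt]) nm (u i) * expR (`|e i| * 1)) => s us.
  by apply: sum_sub us _ => [i|[] _]; rewrite ?mem_head // mulr_ge0 ?nm_ge0 ?expR_ge0.
have [h1 h2] := exp_family ler01 hb.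
eexists; apply: has_ps_near; exists 1 => //; split; first exact: h1.
move=> h hr; have [_ <-] := h2 h hr.
have [|/hsum_csum -> _] := @csum_fin _ _ (fun i => u i * cexp ((e i)%:C * h)) [:: tt] erefl.
  by case.
by rewrite big_seq1 mulrDr cexpD.
Qed.

(* Kronecker's function e^(l z) K(z + a) / (K(a) K(z)), K being the prime form; it is P_1 for
   suitable l and a. *)
Definition kron (l : R) (a z : C) : C := cexp (l%:C * z) * T (z + a) / T a / (T z / c1).

Lemma kron_meromorphic (l : R) (a : C) : nonlattice om a -> meromorphic (kron l a).
Proof.
move=> na; have eT := halfTheta_entire hom; have c0 := Tcoef1_neq0 htau.
have e1 : entire (fun z => cexp (l%:C * z) * T (z + a) / T a).
  have := entireZ (T a)^-1 (entireM (entire_cexp l) (entire_shift a eT)).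
  by congr entire; apply/funext => z; rewrite mulrC.
have e2 : entire (fun z => T z / c1).
  have := entireZ c1^-1 eT; by congr entire; apply/funext => z; rewrite mulrC.
apply: (meromorphic_quot e1 e2).
  move=> z /eqP; rewrite mulf_eq0 invr_eq0 (negbTE c0) orbF => /eqP /halfTheta_eq0[k hk].
  have h1 : T (z + a) != 0 by apply: halfTheta_neq0; exact: nonlattice_add hk na.
  apply: mulf_neq0; last by rewrite invr_eq0; exact: halfTheta_neq0.
  by apply: mulf_neq0 h1; exact: cexp_neq0.
move=> z e /(halfTheta_isolated z)[h [h0 he hT]]; exists h; split => //.
by apply: mulf_neq0; rewrite ?invr_eq0.
Qed.

Lemma kron_has_ps (l : R) (a z : C) : nonlattice om z -> exists c, has_ps (kron l a) z c.
Proof.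
move=> nz; have eT := halfTheta_entire hom; have c0 := Tcoef1_neq0 htau.
have e1 : entire (fun z => cexp (l%:C * z) * T (z + a) / T a).
  have := entireZ (T a)^-1 (entireM (entire_cexp l) (entire_shift a eT)).
  by congr entire; apply/funext => w; rewrite mulrC.
have e2 : entire (fun z => T z / c1).
  have := entireZ c1^-1 eT; by congr entire; apply/funext => w; rewrite mulrC.
have [c hc] := analytic_has_ps (e1 z); have [d hd] := analytic_has_ps (e2 z).
apply: has_ps_quot hc hd _; apply: mulf_neq0; last by rewrite invr_eq0.
exact: halfTheta_neq0.
Qed.

Lemma kron_annulus (l : R) (a z : C) : nonlattice om a ->
  2 * complex.Re om < complex.Re z < 0 ->
  kron l a z = - (cexp (l%:C * z) * csum (fun k => kcoef om a k * cexp (k%:~R * z))).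
Proof.
move=> na hz; have K := kronecker hom na hz.
have c0 := cTheta_neq0.
have Ta := Theta_neq0 hom c0 na.
have Tz : Theta om z != 0.
  apply: (Theta_neq0 hom c0) => k; apply/eqP => /(congr1 nm); rewrite nm_nome nm1 => /eqP.
  rewrite -[X in _ == X]expR0 (inj_eq (@expR_inj _)) => /eqP e; have h2 := hom.
  case/andP: hz => z1 z2.
  have [k0|k0] : (k%:~R : R) <= - 1 \/ 0 <= (k%:~R : R).
    case: (lerP 0 k) => hk; first by right; rewrite ler0z.
    by left; rewrite -(intrN _ 1) ler_int; lia.
  + have : complex.Re om * (k%:~R + 1) >= 0 by rewrite mulr_le0 ?(ltW h2) //; lra.
    by lra.
  + by have : complex.Re om * k%:~R <= 0; [rewrite mulr_le0_ge0 ?(ltW h2)|lra].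
rewrite /kron (cTheta_Tcoef1 hom) /halfTheta.
have -> : csum (fun k => kcoef om a k * cexp (k%:~R * z)) =
    cTheta om * Theta om (a + z) / (Theta om a * Theta om z).
  by rewrite -K; field; rewrite Ta Tz.
have -> : cexp (- ((z + a) / 2)) = cexp (- (z / 2)) * cexp (- (a / 2)).
  by rewrite -cexpD; congr cexp; ring.
rewrite [z + a]addrC; have x1 := cexp_neq0 (- (z / 2)); have x2 := cexp_neq0 (- (a / 2)).
by field; rewrite x1 x2 Ta Tz c0.
Qed.

End Lattice.

(** * The twist as a shift of the argument *)

Section Twist.
Context {R : realType}.
Local Notation C := R[i].

Lemma realC_Dint (l : R) (k : int) : (l + k%:~R)%:C = l%:C + k%:~R :> C.
Proof. by rewrite rmorphD /= intC. Qed.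

Lemma realC_intD (l : R) (k : int) : (k%:~R + l)%:C = k%:~R + l%:C :> C.
Proof. by rewrite rmorphD /= intC. Qed.

Lemma cexp_two_pi_int (u : int) : cexp (two_pi_i R * u%:~R) = 1.
Proof.
by rewrite two_pi_iE [X in cexp X](_ : _ = (2 * u)%:~R * ('i%C * pi%:C)) ?cexp_int_ipi;
  [rewrite mulrC -[2]/(1 + 1 : int) mulrDr mulr1 sgD sg_sq|rewrite intrM; ring].
Qed.

Lemma twist_exponentP (beta : R) (phi : C) : phi = cexp (- (two_pi_i R * beta%:C)) ->
  0 <= twist_exponent phi < 1 /\ exists p : int, twist_exponent phi = - beta + p%:~R.
Proof.
move=> hphi.
have ex : exists l : R, 0 <= l < 1 /\ phi = cexp (two_pi_i R * l%:C).
  exists (- beta - (Num.floor (- beta))%:~R); split.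
    have := floor_le (- beta); have := floorD1_gt (- beta); rewrite intrD; lra.
  rewrite hphi rmorphB rmorphN /= -intC mulrBr cexpB cexp_two_pi_int divr1; congr cexp; ring.
rewrite /twist_exponent; case: xgetP => [l _ [l01 lE]|nl]; last by case: ex => l /nl.
split => //; have : cexp (two_pi_i R * (l + beta)%:C) = 1.
  by rewrite rmorphD mulrDr cexpD -lE hphi -cexpD addNr cexp0.
move=> /cexp_eq1[p hp]; exists p.
have t0 : two_pi_i R != 0.
  rewrite two_pi_iE !mulf_neq0 ?pnatr_eq0 //; last by rewrite -nm_gt0 nm_real gtr0_norm ?pi_gt0.
  by rewrite -nm_gt0 nm_i.
have /complexI : (l + beta)%:C = (p%:~R : R)%:C by rewrite -intC; exact: mulfI hp.
by move=> h; rewrite addrC -h addrK.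
Qed.

Context (alpha beta : R) (theta phi tau : C).
Context (htheta : theta = cexp (- (two_pi_i R * alpha%:C))).
Context (hphi : phi = cexp (- (two_pi_i R * beta%:C))).
Context (htwist : (theta, phi) <> (1, 1)) (htau : 0 < complex.Im tau).
Local Notation om := (half_period tau).
Local Notation hom := (half_period_lt0 htau).
Local Notation T := (halfTheta om).
Local Notation lam := (twist_exponent phi).

(** Chosen so that [theta^-1 q^(l + lambda)] is [exp (a + 2 om l)], which makes the denominators of
    the twisted series those of [kcoef om a l]. *)
Definition twist_shift : C := two_pi_i R * alpha%:C + 2 * om * lam%:C.
Local Notation a := twist_shift.

(** If [a] were in the lattice, imaginary parts would give [lam + k = 0], hence [k = lam = 0]
    because [0 <= lam < 1]; then [theta = phi = 1], the excluded twist. *)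
Lemma twist_nonlattice : nonlattice om a.
Proof.
have [/andP[l0 l1] [p hp]] := twist_exponentP hphi.
move=> k; apply/eqP => h; apply: htwist.
have e1 : cexp (two_pi_i R * (alpha%:C + (lam + k%:~R)%:C * tau)) = 1.
  rewrite -[RHS]h; congr cexp; rewrite /twist_shift two_pi_iE /half_period realC_Dint; ring.
have [u hu] := cexp_eq1 e1.
have t0 : two_pi_i R != 0.
  rewrite two_pi_iE !mulf_neq0 ?pnatr_eq0 //; last by rewrite -nm_gt0 nm_real gtr0_norm ?pi_gt0.
  by rewrite -nm_gt0 nm_i.
have {}hu := mulfI t0 hu.
have im : (lam + k%:~R) * complex.Im tau = 0.
  have := congr1 (@complex.Im R) hu; rewrite intC /=.
  by case: tau => x y /=; rewrite mul0r addr0 add0r.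
have lk : lam + k%:~R = 0.
  by move/eqP: im; rewrite mulf_eq0 (gt_eqF htau) orbF => /eqP.
have k0 : k = 0.
  have : (k%:~R : R) <= 0 by lra.
  have : (- 1 : R) < k%:~R by lra.
  by rewrite lerz0 -(intrN _ 1) ltr_int; lia.
have lam0 : lam = 0 by move: lk; rewrite k0 addr0.
rewrite htheta hphi; congr pair.
  rewrite lk mul0r addr0 in hu.
  by rewrite hu cexpN cexp_two_pi_int invr1.
have -> : beta = p%:~R by lra.
by rewrite -intC cexpN cexp_two_pi_int invr1.
Qed.

Lemma kcoef_twist (l : int) (z : C) :
  kcoef om a l * cexp ((l%:~R + lam)%:C * z) =
  cexp ((l%:~R + lam)%:C * z) / (1 - theta^-1 * qexp tau (l%:~R + lam)).
Proof.
rewrite mulrC /kcoef; congr (_ / (1 - _)).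
rewrite htheta -cexpN opprK qexpE -cexpD realC_intD; congr cexp.
by rewrite /twist_shift; ring.
Qed.

(** With [lam = - beta + p], the characteristic [n - beta + 1/2] equals [(n + 1 - p) - 1/2 + lam].
    Translating the index by [1 - p] therefore matches the exponents of [halfTheta], and [D0]
    gathers what depends neither on [n] nor on [z]. *)
Lemma vartheta_halfTheta : exists2 D : C, D != 0 &
  forall z, vartheta (- beta + 2^-1) (alpha + 2^-1) z tau = D * (cexp (lam%:C * z) * T (z + a)).
Proof.
have [_ [p hp]] := twist_exponentP hphi.
pose D0 : C := om * (4^-1 + lam%:C ^+ 2) + lam%:C * (two_pi_i R * alpha%:C)
  + (lam%:C - 2^-1) * ('i%C * pi%:C).
exists (cexp D0); first exact: cexp_neq0.
move=> z; pose g (k : int) := tht om k * cexp ((k%:~R - 2^-1) * (z + a)).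
have ag : asum g by exact: asum_even hom (z + a).
pose f (n : int) : C := let na : C := (n%:~R + (- beta + 2^-1))%:C in
    cexp ((0 +i* pi) * na ^+ 2 * tau + na * (z + two_pi_i R * (alpha + 2^-1)%:C)).
have E n : f n = cexp D0 * cexp (lam%:C * z) * g (n + (1 - p)).
  rewrite /g /tht -cexp_int_ipi -!cexpD /f; congr cexp.
  have -> : - beta = lam - p%:~R by lra.
  have -> : (0 +i* pi : C) = 'i%C * pi%:C.
    by apply/eqP; rewrite eq_complex /= !(mul0r, mul1r, mulr0, subr0, add0r, addr0, oppr0) !eqxx.
  rewrite !(rmorphD, rmorphB, rmorphN) /= -!intC fmorphV rmorph_nat /D0 /twist_shift two_pi_iE.
  by rewrite /half_period; field; rewrite ?pnatr_eq0.
have af : asum f.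
  have := asumZ (cexp D0 * cexp (lam%:C * z)) (asum_comp (bij_inj (addz_bij (1 - p))) ag).
  by apply: eq_asum => n; rewrite E.
rewrite /vartheta -[zsum _]/(zsum f) (zsum_csum af) (eq_csum E) csumZ; last first.
  exact: (asum_comp (bij_inj (addz_bij (1 - p))) ag).
by rewrite -(csum_bij (addz_bij (1 - p)) ag) (halfThetaE hom) mulrA.
Qed.

Lemma vartheta_ratio z :
  vartheta (- beta + 2^-1) (alpha + 2^-1) z tau / vartheta (- beta + 2^-1) (alpha + 2^-1) 0 tau
  = cexp (lam%:C * z) * T (z + a) / T a.
Proof.
have [D D0 E] := vartheta_halfTheta; rewrite !E mulr0 cexp0 add0r mul1r.
have Ta := halfTheta_neq0 htau twist_nonlattice.
by field; rewrite D0 Ta.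
Qed.

Lemma kron_annulus_ps (w : C) : 2 * complex.Re om < complex.Re w < 0 ->
  has_ps (kron tau lam a) w (fun n =>
    csum (fun l : int => - (kcoef om a l * cexp ((l%:~R + lam)%:C * w)) * ((l%:~R + lam)%:C ^+ n / n`!%:R)))
  /\ forall n, asum (fun l : int => - (kcoef om a l * cexp ((l%:~R + lam)%:C * w)) * ((l%:~R + lam)%:C ^+ n / n`!%:R)).
Proof.
move=> /andP[w1 w2]; have [/andP[l0 l1] _] := twist_exponentP hphi.
(* The distance from [w] to the boundary of the strip; half of it is a safe radius for the Taylor
   series. *)
pose eta := Num.min (- complex.Re w) (complex.Re w - 2 * complex.Re om).
have eta0 : 0 < eta by rewrite lt_min; apply/andP; split; lra.
have m1 : eta <= - complex.Re w by rewrite ge_min lexx.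
have m2 : eta <= complex.Re w - 2 * complex.Re om by rewrite ge_min lexx orbT.
have r0 : 0 < eta / 2 by lra.
pose u (l : int) : C := - (kcoef om a l * cexp ((l%:~R + lam)%:C * w)).
pose e (l : int) : R := l%:~R + lam.
have hb : rbdd (fun l => nm (u l) * expR (`|e l| * (eta / 2))).
  have [B B0 hB] := kcoef_bound hom a w.
  have := rbddZ B0 (rbddZ (expR_ge0 (lam * complex.Re w + eta / 2)) (rbdd_exp_lin r0)).
  apply: rbdd_le => l; rewrite /u nmN realC_intD mulrDl cexpD mulrA (nmM (kcoef _ _ _ * _)).
  apply: le_trans (ler_wpM2r (expR_ge0 _) (ler_wpM2r (nm_ge0 _) (hB l))) _.
  rewrite -/eta nm_cexp Re_mul_real -!mulrA ler_wpM2l // -!expRD ler_expR.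
  have : `|e l| <= `|l%:~R| + 1.
    by apply: le_trans (ler_normD _ _) _; rewrite [`|lam|]ger0_norm //; lra.
  move=> /(ler_wpM2r (ltW r0)); lra.
have [h1 h2] := exp_family (ltW r0) hb.
split; last by move=> n; exact: exp_family_coef r0 hb.
exists (eta / 2) => //; split; first exact: h1.
move=> h hr; have hh : 2 * complex.Re om < complex.Re (w + h) < 0.
  by have := nm_Re h; rewrite Re_add ler_norml => /andP[h3 h4]; apply/andP; split; lra.
have [_ <-] := h2 h hr.
rewrite (kron_annulus htau _ twist_nonlattice hh) -mulNr -csumZ; last exact: (asum_kcoef hom _ hh).
apply: eq_csum => l; rewrite /u !mulNr; congr (- _).
rewrite mulrCA -mulrA -!cexpD; congr (_ * cexp _); rewrite /e realC_intD; ring.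
Qed.

Lemma annulusP (w : C) : `|qexp tau 1| < `|cexp w| < 1 <-> 2 * complex.Re om < complex.Re w < 0.
Proof.
rewrite !nmE !ltcR qexpE mulr1.
rewrite -[2 * om]add0r -[0 + _](_ : 0 + 2 * om * 1%:~R = _); last by rewrite mulr1.
by rewrite nm_nome raddf0 add0r mulr1 nm_cexp ltr_expR expR_lt1.
Qed.

Theorem twisted_weierstrassE k z : twisted_weierstrass theta phi k.+1 z tau =
  (-1) ^+ k * taylor (kron tau lam a) z k.
Proof.
pose f z := (-1) ^+ k * taylor (kron tau lam a) z k.
have mk := kron_meromorphic htau lam twist_nonlattice.
have mf : meromorphic f by apply: meromorphicZ; exact: meromorphic_taylor.
have fs (w : C) : `|qexp tau 1| < `|cexp w| < 1 ->
    f w = twisted_weierstrass_series theta phi k.+1 w tau.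
  move=> /annulusP hw; have [hps ha] := kron_annulus_ps hw.
  rewrite /f (taylorE hps) /twisted_weierstrass_series /=.
  set g := (fun l : int => _ * _ / _).
  have E l : g l = - (k`!%:R) * (- (kcoef om a l * cexp ((l%:~R + lam)%:C * w)) * ((l%:~R + lam)%:C ^+ k / k`!%:R)).
    rewrite kcoef_twist /g; have := @fact_neq0 R k; move: (1 - _)^-1 => v f0.
    by field.
  have ag : asum g by have := asumZ (- k`!%:R) (ha k); apply: eq_asum => l; rewrite E.
  rewrite (zsum_csum ag) (eq_csum E) csumZ //; have f0 := @fact_neq0 R k.
  by rewrite exprS; field.
rewrite -/(f z) /twisted_weierstrass; case: xgetP => [g _ [mg gs]|ng]; last by case: (ng f).
suff -> : g = f by [].
(* [Re om] is the middle of the strip [2 Re om < Re w < 0], so the disc of radius [- Re om] around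
   it stays inside. *)
have hom := hom; pose w0 : C := (complex.Re om)%:C.
apply: (identity_theorem (z0 := w0)) => //.
exists (- complex.Re om); first lra.
move=> h _ hr; have hw : 2 * complex.Re om < complex.Re (w0 + h) < 0.
  have := nm_Re h; rewrite Re_add ler_norml /= => /andP[h3 h4]; apply/andP; split; lra.
by rewrite gs ?fs //; apply/annulusP.
Qed.

Theorem twisted_DE p r z : twisted_D theta phi p.+1 r.+1 tau z =
  (-1) ^+ r * 'C(p + r, p)%:R * taylor (kron tau lam a) z (p + r).
Proof.
rewrite /twisted_D.
have -> : (p.+1 + r.+1 - 2)%N = (p + r)%N by lia.
have -> : (p.+1 + r.+1 - 1)%N = (p + r).+1 by lia.
rewrite subn1 /= twisted_weierstrassE !exprS exprD.
have s2 : (-1) ^+ p * (-1) ^+ p = 1 :> C by rewrite -expr2 sqrr_sign.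
rewrite mulN1r mulN1r opprK.
rewrite [LHS](_ : _ = ((-1) ^+ p * (-1) ^+ p) * ((-1) ^+ r * 'C(p + r, p)%:R * taylor (kron tau lam a) z (p + r))); last by ring.
by rewrite s2 mul1r.
Qed.

End Twist.

(** * Frobenius determinant *)

Section Limits.
Context {R : realType}.
Local Notation C := R[i].
Implicit Types (f g : C -> C) (l m : C).

(* Limit at 0 along h != 0. *)
Definition lim0 f l := forall e : R, 0 < e ->
  exists2 d, 0 < d & forall h, h != 0 -> nm h < d -> nm (f h - l) < e.

Lemma lim0_cst l : lim0 (fun=> l) l.
Proof. by move=> e e0; exists 1 => // h _ _; rewrite subrr nm0. Qed.

Lemma lim0D f g l m : lim0 f l -> lim0 g m -> lim0 (fun h => f h + g h) (l + m).
Proof.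
move=> hf hg e e0; have e2 : 0 < e / 2 by lra.
have [d d0 hd] := hf _ e2; have [d' d'0 hd'] := hg _ e2.
exists (Num.min d d'); first by rewrite lt_min d0.
move=> h h0; rewrite lt_min => /andP[h1 h2]; rewrite opprD addrACA.
have := hd h h0 h1; have := hd' h h0 h2; have := nmD (f h - l) (g h - m); lra.
Qed.

Lemma lim0M f g l m : lim0 f l -> lim0 g m -> lim0 (fun h => f h * g h) (l * m).
Proof.
move=> hf hg e e0; have [|d d0 hd] := hf (Num.min 1 (e / (2 * (nm m + 1)))).
  by rewrite lt_min ltr01 divr_gt0 //; have := nm_ge0 m; lra.
have [|d' d'0 hd'] := hg (e / (2 * (nm l + 1))).
  by rewrite divr_gt0 //; have := nm_ge0 l; lra.
exists (Num.min d d'); first by rewrite lt_min d0.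
move=> h h0; rewrite lt_min => /andP[h1 h2].
have := hd h h0 h1; rewrite lt_min => /andP[f1 f2]; have g1 := hd' h h0 h2.
have -> : f h * g h - l * m = f h * (g h - m) + (f h - l) * m by ring.
apply: le_lt_trans (nmD _ _) _; rewrite !nmM.
have fl : nm (f h) <= nm l + 1 by have := nmBr (f h) l; lra.
have l0 := nm_ge0 l; have m0 := nm_ge0 m.
have p1 : nm (f h) * nm (g h - m) <= (nm l + 1) * nm (g h - m) by rewrite ler_wpM2r ?nm_ge0.
have p2 : (nm l + 1) * nm (g h - m) < e / 2.
  rewrite mulrC -ltr_pdivlMr; last by lra.
  by move: g1; rewrite invfM mulrA.
have p3 : nm (f h - l) * nm m <= nm (f h - l) * (nm m + 1) by rewrite ler_wpM2l ?nm_ge0 //; lra.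
have p4 : nm (f h - l) * (nm m + 1) < e / 2.
  rewrite -ltr_pdivlMr; last by lra.
  by move: f2; rewrite invfM mulrA.
by lra.
Qed.

Lemma lim0_sum (I : Type) (s : seq I) (P : pred I) (f : I -> C -> C) (l : I -> C) :
  (forall i, P i -> lim0 (f i) (l i)) ->
  lim0 (fun h => \sum_(i <- s | P i) f i h) (\sum_(i <- s | P i) l i).
Proof.
move=> hf; elim: s => [|i s IH].
  by rewrite big_nil; under [X in lim0 X]funext do rewrite big_nil; exact: lim0_cst.
rewrite big_cons; under [X in lim0 X]funext do rewrite big_cons.
by case: ifP => Pi //; apply: lim0D => //; exact: hf.
Qed.

Lemma lim0_prod (I : Type) (s : seq I) (P : pred I) (f : I -> C -> C) (l : I -> C) :
  (forall i, P i -> lim0 (f i) (l i)) ->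
  lim0 (fun h => \prod_(i <- s | P i) f i h) (\prod_(i <- s | P i) l i).
Proof.
move=> hf; elim: s => [|i s IH].
  by rewrite big_nil; under [X in lim0 X]funext do rewrite big_nil; exact: lim0_cst.
rewrite big_cons; under [X in lim0 X]funext do rewrite big_cons.
by case: ifP => Pi //; apply: lim0M => //; exact: hf.
Qed.

Lemma lim0V f l : l != 0 -> lim0 f l -> lim0 (fun h => (f h)^-1) l^-1.
Proof.
move=> l0 hf e e0; have n0 : 0 < nm l by rewrite nm_gt0.
have [|d d0 hd] := hf (Num.min (nm l / 2) (e * (nm l * nm l) / 2)).
  by rewrite lt_min !divr_gt0 ?mulr_gt0.
exists d => // h h0 /(hd h h0); rewrite lt_min => /andP[h1 h2].
have f1 : nm l / 2 < nm (f h).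
  by have := nmBr l (f h); rewrite nm_distC; lra.
have f0 : f h != 0 by rewrite -nm_gt0; lra.
have -> : (f h)^-1 - l^-1 = (l - f h) / (f h * l) by field; rewrite f0 l0.
rewrite !nmM nmV nmM nm_distC ltr_pdivrMr ?mulr_gt0 //; last by lra.
apply: lt_le_trans h2 _; rewrite -mulrA ler_pM2l // mulrAC ler_wpM2r //; first exact: ltW.
by lra.
Qed.

Lemma lim0_det n (A : C -> 'M[C]_n) (B : 'M[C]_n) :
  (forall i j, lim0 (fun h => A h i j) (B i j)) -> lim0 (fun h => \det (A h)) (\det B).
Proof.
move=> hA; rewrite /determinant; apply: lim0_sum => s _.
by apply: lim0M; [exact: lim0_cst|apply: lim0_prod].
Qed.

Lemma lim0_frequently f g l m : lim0 f l -> lim0 g m ->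
  (forall e : R, 0 < e -> exists h, [/\ h != 0, nm h < e & f h = g h]) -> l = m.
Proof.
move=> hf hg hfg; apply/eqP; rewrite -subr_eq0; apply/eqP/nm_small_eq0 => e e0.
have e2 : 0 < e / 2 by lra.
have [d d0 hd] := hf _ e2; have [d' d'0 hd'] := hg _ e2.
have [|h [h0 hh fg]] := hfg (Num.min d d'); first by rewrite lt_min d0.
move: hh; rewrite lt_min => /andP[h1 h2].
have := hd h h0 h1; have := hd' h h0 h2; rewrite -fg [nm (f h - l)]nm_distC.
have := nm_triangle l (f h) m; lra.
Qed.

Lemma lim0_id (a : C) : lim0 (fun h => a * h) 0.
Proof.
move=> e e0; have a1 : 0 < nm a + 1 by have := nm_ge0 a; lra.
exists (e / (nm a + 1)); first exact: divr_gt0.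
move=> h h0; rewrite ltr_pdivlMr // subr0 nmM => hh.
by apply: le_lt_trans hh; rewrite mulrC ler_wpM2l ?nm_ge0 //; lra.
Qed.

Lemma lim0_comp f l (g : C -> C) : (forall e : R, 0 < e ->
    exists2 d, 0 < d & forall h, nm h < d -> nm (f h - l) < e) ->
  lim0 g 0 -> lim0 (fun h => f (g h)) l.
Proof.
move=> hf hg e /hf[d d0 hd]; have [d' d'0 hd'] := hg d d0.
by exists d' => // h h0 /(hd' h h0); rewrite subr0 => /hd.
Qed.

Lemma analytic_lim0 f z (g : C -> C) : analytic_at f z -> lim0 g 0 ->
  lim0 (fun h => f (z + g h)) (f z).
Proof.
move=> /analytic_has_ps[c hc]; apply: (lim0_comp (f := fun h => f (z + h))).
exact: has_ps_cont hc.
Qed.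

End Limits.

Section Determinants.
Context {F : fieldType}.

Lemma det_schur n (a : F) (r : 'rV[F]_n) (c : 'cV[F]_n) (D : 'M[F]_n) : a != 0 ->
  \det (block_mx (a%:M : 'M[F]_1) r c D) = a * \det (D - a^-1 *: (c *m r)).
Proof.
move=> a0; set B := block_mx _ _ _ _.
have E : B *m block_mx 1%:M (- a^-1 *: r) 0 1%:M = block_mx a%:M 0 c (D - a^-1 *: (c *m r)).
  rewrite mulmx_block !mulmx1 !mulmx0 !addr0; congr block_mx.
    by rewrite -scalemxAr mul_scalar_mx scalerA mulNr mulVf // scaleN1r addNr.
  by rewrite -scalemxAr scaleNr addrC.
have := congr1 determinant E; rewrite det_mulmx det_ublock det_lblock !det1 !mulr1 => ->.
by rewrite det_scalar1.
Qed.

Lemma det_scale_entries n (c : F) (u v : 'I_n -> F) (M : 'M[F]_n) :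
  \det (\matrix_(i, j) (c * u i * v j * M i j)) =
  c ^+ n * (\prod_i u i) * (\prod_j v j) * \det M.
Proof.
have -> : \matrix_(i, j) (c * u i * v j * M i j) =
    c *: (diag_mx (\row_i u i) *m M *m diag_mx (\row_j v j)).
  apply/matrixP => i j; rewrite mul_diag_mx mul_mx_diag !mxE; ring.
rewrite detZ !det_mulmx !det_diag; under eq_bigr do rewrite mxE.
under [X in _ * (_ * X)]eq_bigr do rewrite mxE.
by rewrite -!mulrA; congr (_ * (_ * _)); rewrite mulrC.
Qed.

Lemma prod_lt_recl n (G : 'I_n.+1 -> 'I_n.+1 -> F) :
  \prod_(i < n.+1) \prod_(k < n.+1 | (i < k)%N) G i k =
  (\prod_(k < n) G ord0 (lift ord0 k)) *
  \prod_(i < n) \prod_(k < n | (i < k)%N) G (lift ord0 i) (lift ord0 k).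
Proof.
rewrite big_ord_recl; congr (_ * _).
  rewrite big_mkcond big_ord_recl /= mul1r; apply: eq_bigr => k _.
  by rewrite /bump.
apply: eq_bigr => i _; rewrite big_mkcond big_ord_recl /= mul1r [RHS]big_mkcond.
by apply: eq_bigr => k _; rewrite /bump !leq0n !add1n ltnS.
Qed.

Lemma prod2_recl n (H : 'I_n.+1 -> 'I_n.+1 -> F) :
  \prod_(i < n.+1) \prod_(j < n.+1) H i j =
  H ord0 ord0 * (\prod_(j < n) H ord0 (lift ord0 j)) *
  ((\prod_(i < n) H (lift ord0 i) ord0) *
   \prod_(i < n) \prod_(j < n) H (lift ord0 i) (lift ord0 j)).
Proof.
rewrite big_ord_recl big_ord_recl; congr (_ * _).
by rewrite -big_split; apply: eq_bigr => i _; rewrite big_ord_recl.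
Qed.

End Determinants.

(** * The determinant of Frobenius for a function with a three-term identity *)

Section Frobenius.
Context {R : realType}.
Local Notation C := R[i].
Context (s : C -> C).
Context (s_entire : entire s).
Context (s_isolated : forall z (e : R), 0 < e -> exists h, [/\ h != 0, nm h < e & s (z + h) != 0]).
Context (s_three_term : forall a X X1 Y Y1,
  s (X - Y + a) * s (X1 - Y1 + a) * s (X - Y1) * s (X1 - Y)
  - s (X - Y1 + a) * s (X1 - Y + a) * s (X - Y) * s (X1 - Y1)
  = s a * s (a + X + X1 - Y - Y1) * s (X - X1) * s (Y1 - Y)).

(* Induction on n by a Schur complement, which is again a matrix of the same kind with a shifted
   parameter; when the pivot vanishes, a is perturbed. *)
Theorem frobenius_det n (x y : 'I_n -> C) a : (forall i j, s (x i - y j) != 0) ->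
  s a * \det (\matrix_(i, j) (s (x i - y j + a) / s (x i - y j))) =
  s a ^+ n * s (a + \sum_i x i - \sum_j y j) *
  ((\prod_(i < n) \prod_(k < n | (i < k)%N) (s (x k - x i) * s (y i - y k)))
   / \prod_i \prod_j s (x i - y j)).
Proof.
elim: n x y a => [|n IH] x y a sxy.
  by rewrite det_mx00 !big_ord0 addr0 subr0 expr0 mulr1 mul1r divr1 mulr1.
pose L a := s a * \det (\matrix_(i, j) (s (x i - y j + a) / s (x i - y j))).
pose K := (\prod_(i < n.+1) \prod_(k < n.+1 | (i < k)%N) (s (x k - x i) * s (y i - y k)))
   / \prod_i \prod_j s (x i - y j).
pose Q a := s a ^+ n.+1 * s (a + \sum_i x i - \sum_j y j) * K.
have main b : s (x ord0 - y ord0 + b) != 0 -> L b = Q b.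
  move=> sb.
  have s00 := sxy ord0 ord0.
  set M := \matrix_(i, j) (s (x i - y j + b) / s (x i - y j)) : 'M[C]_(1 + n).
  pose f i j := s (x i - y j + b) / s (x i - y j).
  have f00 : f ord0 ord0 != 0 by rewrite mulf_neq0 ?invr_eq0.
  (* The three-term identity with [X1 = x 0] and [Y1 = y 0] turns each entry of the Schur complement
     into an entry with this new parameter, times one factor for the row and one for the column. *)
  pose b' := b + x ord0 - y ord0.
  have sb' : s b' != 0 by move: sb; rewrite /b' [b + _]addrC addrAC.
  pose x' i := x (lift ord0 i); pose y' j := y (lift ord0 j).
  pose M' := \matrix_(i < n, j < n) (s (x' i - y' j + b') / s (x' i - y' j)).
  have E : \det M = f ord0 ord0 * ((s b / s b') ^+ n *
     (\prod_(i < n) (s (x' i - x ord0) / s (x' i - y ord0))) *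
     (\prod_(j < n) (s (y ord0 - y' j) / s (x ord0 - y' j))) * \det M').
    rewrite -det_scale_entries.
    have l0 : lshift n (ord0 : 'I_1) = ord0 by apply/val_inj.
    have r1 (j : 'I_n) : rshift 1 j = lift ord0 j by apply/val_inj.
    have -> : M = block_mx (f ord0 ord0)%:M (\row_j f ord0 (lift ord0 j))
        (\col_i f (lift ord0 i) ord0) (\matrix_(i, j) f (lift ord0 i) (lift ord0 j)).
      rewrite -[LHS]submxK; congr block_mx.
      - by apply/matrixP => i j; rewrite !ord1 !mxE eqxx mulr1n l0.
      - by apply/matrixP => i j; rewrite !ord1 !mxE l0 r1.
      - by apply/matrixP => i j; rewrite !ord1 !mxE l0 r1.
      - by apply/matrixP => i j; rewrite !mxE !r1.
    rewrite (det_schur _ _ _ f00); congr (_ * _); congr (\det _); apply/matrixP => i j.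
    rewrite !mxE big_ord1 !mxE -/(x' i) -/(y' j).
    have W := s_three_term b (x' i) (x ord0) (y' j) (y ord0).
    have W' : s (b + x' i + x ord0 - y' j - y ord0) = s (x' i - y' j + b').
      by congr s; rewrite /b'; ring.
    rewrite W' in W; rewrite /f -/(x' i) -/(y' j).
    have n1 := sxy (lift ord0 i) (lift ord0 j); have n2 := sxy (lift ord0 i) ord0.
    have n3 := sxy ord0 (lift ord0 j); rewrite -/(x' i) -/(y' j) in n1 n2 n3.
    have bE : s b' = s (x ord0 - y ord0 + b) by congr s; rewrite /b'; ring.
    rewrite bE.
    move: W sb n1 n2 n3 s00.
    move: (s (x' i - y' j + b)) (s (x ord0 - y ord0 + b)) (s (x' i - y ord0)) (s (x ord0 - y' j))
      (s (x' i - y ord0 + b)) (s (x ord0 - y' j + b)) (s (x' i - y' j)) (s (x ord0 - y ord0))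
      (s b) (s (x' i - y' j + b')) (s (x' i - x ord0)) (s (y ord0 - y' j)).
    move=> A1 A2 A3 A4 A5 A6 A7 A8 A9 B1 B2 B3 W nA2 nA7 nA3 nA4 nA8.
    have -> : A1 / A7 - (A2 / A8)^-1 * (A5 / A3 * (A6 / A4)) =
      (A1 * A2 * A3 * A4 - A5 * A6 * A7 * A8) / (A7 * A2 * A3 * A4).
      by field; rewrite nA2 nA3 nA4 nA7 nA8.
    by rewrite W; field; rewrite ?nA2 ?nA3 ?nA4 ?nA7 ?nA8.
  have IH' := IH x' y' b' (fun i j => sxy _ _).
  rewrite /L /Q /K -/M E prod_lt_recl prod2_recl.
  have SE : b + \sum_i x i - \sum_j y j = b' + \sum_i x' i - \sum_j y' j.
    by rewrite !big_ord_recl /b' /x' /y'; ring.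
  rewrite SE.
  have D' : \det M' = s b' ^+ n * s (b' + \sum_i x' i - \sum_j y' j) *
     ((\prod_(i < n) \prod_(k < n | (i < k)%N) (s (x' k - x' i) * s (y' i - y' k)))
   / \prod_i \prod_j s (x' i - y' j)) / s b' by rewrite -IH' mulrAC mulfV // mul1r.
  rewrite D' !prodf_div expr_div_n [\prod_(k < n) (s _ * s _)]big_split /=.
  have p1 : \prod_(i < n) s (x' i - y ord0) != 0 by apply/prodf_neq0 => i _; exact: sxy.
  have p2 : \prod_(j < n) s (x ord0 - y' j) != 0 by apply/prodf_neq0 => j _; exact: sxy.
  have p3 : \prod_(i < n) \prod_(j < n) s (x' i - y' j) != 0.
    by apply/prodf_neq0 => i _; apply/prodf_neq0 => j _; exact: sxy.
  have bE : s b' = s (x ord0 - y ord0 + b) by congr s; rewrite /b'; ring.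
  rewrite /f -bE exprS -/(x' _) -/(y' _).
  have sbn : s b' ^+ n != 0 by rewrite expf_neq0.
  move: (s b' ^+ n) (s b ^+ n) (\prod_(i < n) \prod_(k < n | _) _) sbn => S1 S2 S3 sbn.
  move: p1 p2 p3; rewrite /x' /y'.
  move: (\prod_(i < n) s (x (lift ord0 i) - y ord0)) (\prod_(j < n) s (x ord0 - y (lift ord0 j)))
    (\prod_i \prod_j _) (\prod_(i < n) s (x (lift ord0 i) - x ord0))
    (\prod_(j < n) s (y ord0 - y (lift ord0 j))) => P1 P2 P3 P4 P5 p1 p2 p3.
  by field; rewrite p1 p2 p3 sbn sb' s00.
have cont f z : entire f -> lim0 (fun h => f (z + h)) (f z).
  move=> ef; apply: analytic_lim0 (ef z) _ => e e0; exists e => // h _.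
  by rewrite subr0.
rewrite -[LHS]/(L a) -[RHS]/(Q a).
apply: (@lim0_frequently _ (fun h => L (a + h)) (fun h => Q (a + h))).
- apply: lim0M; first exact: cont.
  apply: (lim0_det (A := fun h => \matrix_(i, j) (s (x i - y j + (a + h)) / s (x i - y j)))) => i j.
  rewrite mxE; under [X in lim0 X]funext do rewrite mxE addrA.
  by apply: lim0M; [exact: cont|exact: lim0_cst].
- apply: lim0M; last exact: lim0_cst.
  apply: lim0M.
    have -> : s a ^+ n.+1 = \prod_(i < n.+1) s a by rewrite prodr_const card_ord.
    under [X in lim0 X]funext do rewrite -[n.+1]card_ord -prodr_const.
    by apply: lim0_prod => i _; exact: cont.
  have -> : (fun h => s (a + h + \sum_i x i - \sum_j y j)) =
      (fun h => s ((a + \sum_i x i - \sum_j y j) + h)).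
    by apply/funext => h; congr s; ring.
  exact: cont.
move=> e /(s_isolated (x ord0 - y ord0 + a))[h [h0 he hs]]; exists h; split => //.
by apply: main; rewrite addrA.
Qed.

End Frobenius.

Lemma cexp_sum (R : realType) (I : Type) (s : seq I) (P : pred I) (f : I -> R[i]) :
  cexp (\sum_(i <- s | P i) f i) = \prod_(i <- s | P i) cexp (f i).
Proof. by apply: (big_morph (@cexp R)); [exact: cexpD|exact: cexp0]. Qed.

Section PrimeFormIdentities.
Context {R : realType} (tau : R[i]) (htau : 0 < complex.Im tau).
Local Notation C := R[i].
Local Notation om := (half_period tau).
Local Notation T := (halfTheta om).
Local Notation K z := (@prime_form R z tau).

(** The bilinear formula changes sign when [x] and [y] are exchanged; a point [w] where the function
    is nonzero lets the common factor be cancelled. *)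
Lemma halfThetaN z : T (- z) = - T z.
Proof.
have hom := half_period_lt0 htau.
have [w [_ _ Tw]] := halfTheta_isolated htau 0 ltr01; rewrite add0r in Tw.
have h1 := halfTheta_bilinear hom ((w + z) / 2) ((w - z) / 2).
have h2 := halfTheta_bilinear hom ((w - z) / 2) ((w + z) / 2).
have e1 : (w + z) / 2 + (w - z) / 2 = w by field.
have e2 : (w + z) / 2 - (w - z) / 2 = z by field.
have e3 : (w - z) / 2 - (w + z) / 2 = - z by field.
rewrite e1 e2 in h1; rewrite addrC e1 e3 in h2.
apply: (mulfI Tw); rewrite h2 mulrN h1; ring.
Qed.

Lemma prime_formN z : K (- z) = - K z.
Proof. by rewrite !prime_formE // halfThetaN mulNr. Qed.

Lemma prime_form_entire : entire (@prime_form R ^~ tau).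
Proof.
have -> : @prime_form R ^~ tau = fun z => (Tcoef om 1)^-1 * T z.
  by apply/funext => z; rewrite prime_formE // mulrC.
by apply: entireZ; exact: halfTheta_entire (half_period_lt0 htau).
Qed.

Lemma prime_form_neq0 z : (K z != 0) = (T z != 0).
Proof. by rewrite prime_formE // mulf_eq0 invr_eq0 (negbTE (Tcoef1_neq0 htau)) orbF. Qed.

(** Writing [[x, y]] for the minor of [halfTheta_bilinear], this is the Pluecker relation [[u, v]
    [u', v'] - [u, v'] [u', v] = [u, u'] [v, v']]; the four points solve the linear system given by
    the arguments. *)
Lemma prime_form_three_term a X X1 Y Y1 :
  K (X - Y + a) * K (X1 - Y1 + a) * K (X - Y1) * K (X1 - Y)
  - K (X - Y1 + a) * K (X1 - Y + a) * K (X - Y) * K (X1 - Y1)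
  = K a * K (a + X + X1 - Y - Y1) * K (X - X1) * K (Y1 - Y).
Proof.
have hB := halfTheta_bilinear (half_period_lt0 htau).
pose u := (X + X1 - Y - Y1) / 2 + a; pose v := (X - Y - X1 + Y1) / 2.
pose u' := (X + X1 - Y - Y1) / 2; pose v' := (X - X1 + Y - Y1) / 2.
have := hB u v; have := hB u' v'; have := hB u v'; have := hB u' v.
have := hB u u'; have := hB v v'.
have -> : u + v = X - Y + a by rewrite /u /v; field.
have -> : u - v = X1 - Y1 + a by rewrite /u /v; field.
have -> : u' + v' = X - Y1 by rewrite /u' /v'; field.
have -> : u' - v' = X1 - Y by rewrite /u' /v'; field.
have -> : u + v' = X - Y1 + a by rewrite /u /v'; field.
have -> : u - v' = X1 - Y + a by rewrite /u /v'; field.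
have -> : u' + v = X - Y by rewrite /u' /v; field.
have -> : u' - v = X1 - Y1 by rewrite /u' /v; field.
have -> : u + u' = a + X + X1 - Y - Y1 by rewrite /u /u'; field.
have -> : u - u' = a by rewrite /u /u'; ring.
have -> : v + v' = X - X1 by rewrite /v /v'; field.
have -> : v - v' = Y1 - Y by rewrite /v /v'; field.
rewrite !prime_formE // => h1 h2 h3 h4 h5 h6.
set c := (Tcoef om 1)^-1.
transitivity (c ^+ 4 * ((T (X - Y + a) * T (X1 - Y1 + a)) * (T (X - Y1) * T (X1 - Y))
  - (T (X - Y1 + a) * T (X1 - Y + a)) * (T (X - Y) * T (X1 - Y1)))); first ring.
rewrite h3 h4 h5 h6.
transitivity (c ^+ 4 * ((T (a + X + X1 - Y - Y1) * T a) * (T (X - X1) * T (Y1 - Y)))); last ring.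
rewrite h1 h2; ring.
Qed.

Lemma prime_form_lim (c : C) : lim0 (fun h => K (c * h) / h) c.
Proof.
move=> e e0.
have [hc hT] := Tcoef_series (half_period_lt0 htau) (@ler01 R).
have [B B0 hB] := pse_remainder 2 ltr01 hc.
set t := Tcoef om 1; have t0 : t != 0 := Tcoef1_neq0 htau.
have nt : 0 < nm t by rewrite nm_gt0.
have c0 := nm_ge0 c.
(* The second-order remainder at [c h], divided by [t h], is at most [nm h] times the first summand;
   the [+ 1] makes [D] positive and the final inequality strict. *)
pose D := B * (nm c * nm c) / nm t + 1.
have D0 : 0 < D by rewrite ltr_wpDl // divr_ge0 ?mulr_ge0 // ltW.
exists (Num.min (e / D) (1 / (nm c + 1))).
  by rewrite lt_min !divr_gt0 //; lra.
move=> h h0; rewrite lt_min => /andP[h1 h2].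
have nh : 0 < nm h by rewrite nm_gt0.
have ch : nm (c * h) <= 1.
  move: h2; rewrite ltr_pdivlMr ?nmM; last by lra.
  by rewrite mulrDr mulr1 mulrC; lra.
have := hB _ ch; rewrite -hT // 2!big_ord_recr big_ord0 /= (Tcoef0 htau) -/t => hh.
have -> : prime_form (c * h) tau / h - c = (T (c * h) - (0 + 0 * (c * h) ^+ 0 + t * (c * h) ^+ 1)) / (t * h).
  by rewrite prime_formE // -/t; field; rewrite t0 h0.
rewrite nmM nmV nmM ltr_pdivrMr ?mulr_gt0 //.
apply: le_lt_trans hh _; rewrite nmM.
have : nm h * D < e by rewrite -ltr_pdivlMr.
rewrite /D => hD.
have E : B * (nm c * nm h) ^+ 2 + nm h * nm h * nm t = (nm h * nm t) * (nm h * (B * (nm c * nm c) / nm t + 1)).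
  by field; rewrite gt_eqF.
have q1 : (nm h * nm t) * (nm h * (B * (nm c * nm c) / nm t + 1)) < (nm h * nm t) * e.
  by rewrite ltr_pM2l ?mulr_gt0.
have q2 : 0 < nm h * nm h * nm t by rewrite !mulr_gt0.
rewrite -E in q1; have -> : e * (nm t * nm h) = (nm h * nm t) * e by ring.
by apply: lt_trans q1; rewrite ltrDl.
Qed.

Lemma kron_prime_form l a z :
  kron tau l a z = (K a)^-1 * cexp (l%:C * z) * (K (z + a) / K z).
Proof.
rewrite /kron !prime_formE //; have := Tcoef1_neq0 htau.
move: (Tcoef _ 1) (T (z + a)) (T z) (T a) => t A B D t0.
by rewrite !invfM !invrK; move: B^-1 D^-1 => {}B {}D; field.
Qed.

Lemma kron_det n (x y : 'I_n -> C) (l : R) a :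
  K a != 0 -> (forall i j, K (x i - y j) != 0) ->
  \det (\matrix_(i, j) kron tau l a (x i - y j)) =
  cexp (l%:C * (\sum_i x i - \sum_j y j)) * K (\sum_i x i - \sum_j y j + a) / K a *
  ((\prod_(i < n) \prod_(k < n | (i < k)%N) (K (x k - x i) * K (y i - y k)))
   / \prod_i \prod_j K (x i - y j)).
Proof.
move=> ka kxy.
have -> : \matrix_(i, j) kron tau l a (x i - y j) =
   \matrix_(i, j) ((K a)^-1 * cexp (l%:C * x i) * cexp (- (l%:C * y j)) *
     (\matrix_(i, j) (K (x i - y j + a) / K (x i - y j))) i j).
  apply/matrixP => i j; rewrite !mxE kron_prime_form mulrBr cexpD; ring.
rewrite det_scale_entries.
have iso z (e : R) : 0 < e -> exists h, [/\ h != 0, nm h < e & K (z + h) != 0].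
  by move=> /(halfTheta_isolated htau z)[h [? ? ?]]; exists h; rewrite prime_form_neq0.
have := frobenius_det prime_form_entire iso prime_form_three_term a kxy.
cbv beta; set D := \det _ => hD.
have -> : D = (K a)^-1 * (K a * D) by field.
rewrite hD mulrBr cexpD -mulrN.
have -> : cexp (l%:C * \sum_i x i) = \prod_i cexp (l%:C * x i) by rewrite mulr_sumr cexp_sum.
have -> : cexp (l%:C * - \sum_i y i) = \prod_i cexp (- (l%:C * y i)).
  by rewrite -cexp_sum sumrN mulrN mulr_sumr.
have -> : a + \sum_i x i - \sum_j y j = \sum_i x i - \sum_j y j + a by ring.
rewrite exprVn; move: (expf_neq0 n ka).
move: (K a ^+ n) (K a) ka (\prod_i \prod_j _)^-1 => kn k k0 P kn0.
by field; rewrite k0 kn0.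
Qed.

End PrimeFormIdentities.

(** * Confluence of points *)

Section FiniteDifferences.
Context {F : comNzRingType}.
Implicit Types (g : F -> F) (x : F).

(** The sign is that of [p - i], written without truncated subtraction, so that [fd_coef p i] also
    makes sense, as [0], for [i > p]. *)
Definition fd_coef p i : F := (-1) ^+ (p + i) * 'C(p, i)%:R.

Definition fd p g x := \sum_(i < p.+1) fd_coef p i * g (x + i%:R).

Lemma fdS p g x : fd p.+1 g x = fd p (fun t => g (t + 1) - g t) x.
Proof.
rewrite /fd; under [RHS]eq_bigr do rewrite mulrBr -addrA natr1.
rewrite big_ord_recl sumrB [X in _ = _ - X]big_ord_recl /= !addr0.
have E (i : nat) : fd_coef p.+1 i.+1 = fd_coef p i - fd_coef p i.+1.
  rewrite /fd_coef binS natrD addSn addnS !exprS; ring.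
under eq_bigr do rewrite E mulrBl.
rewrite sumrB [X in _ + (_ - X)]big_ord_recr /=.
have -> : fd_coef p p.+1 = 0 by rewrite /fd_coef bin_small // mulr0.
have -> : fd_coef p.+1 0 = - fd_coef p 0 by rewrite /fd_coef !bin0 addSn exprS; ring.
by rewrite mul0r addr0 mulNr opprD addrCA addrA.
Qed.

Lemma fd_sum (I : Type) (s : seq I) p (c : I -> F) (g : I -> F -> F) x :
  fd p (fun t => \sum_(k <- s) c k * g k t) x = \sum_(k <- s) c k * fd p (g k) x.
Proof.
rewrite /fd; under eq_bigr do rewrite mulr_sumr.
rewrite exchange_big; apply: eq_bigr => k _; rewrite mulr_sumr.
by apply: eq_bigr => i _; rewrite mulrCA.
Qed.

(** A unit difference lowers the degree by one and multiplies the leading coefficient by the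
    degree. *)
Lemma fd_exp p n x : (n <= p)%N -> fd p (fun t => t ^+ n) x = (p`! * (n == p))%:R.
Proof.
elim: p n x => [|p IH] n x np.
  move: np; rewrite leqn0 => /eqP ->.
  by rewrite /fd big_ord1 /fd_coef bin0 !expr0 !mulr1.
rewrite fdS; have -> : (fun t : F => (t + 1) ^+ n - t ^+ n) =
    (fun t => \sum_(k < n) 'C(n, k)%:R * t ^+ k).
  apply/funext => t; rewrite [t + 1]addrC exprDn big_ord_recr /= binn subnn expr0 mul1r mulr1n addrK.
  by apply: eq_bigr => k _; rewrite expr1n mul1r mulr_natl.
rewrite (fd_sum _ _ (fun k : 'I_n => 'C(n, k)%:R) (fun (k : 'I_n) t => t ^+ k)).
case: (eqVneq n p.+1) => [->|ne].
  rewrite big_ord_recr /= big1 => [|k _]; last first.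
    by rewrite IH ?(ltnW (ltn_ord k)) // (ltn_eqF (ltn_ord k)) muln0 mulr0.
  by rewrite IH // eqxx !muln1 add0r binSn -natrM factS.
rewrite muln0; apply: big1 => k _.
have kp : (k < p)%N by have := ltn_ord k; lia.
by rewrite IH ?(ltnW kp) // (ltn_eqF kp) muln0 mulr0.
Qed.

Lemma fd_fd r p g x : fd r (fd p g) x = fd (r + p) g x.
Proof.
elim: r g x => [|r IH] g x.
  by rewrite {1}/fd big_ord1 /fd_coef addr0 bin0 expr0 !mul1r.
rewrite fdS addSn fdS -IH; congr (fd _ _ _); apply/funext => t.
rewrite /fd -sumrB; apply: eq_bigr => i _; rewrite mulrBr.
by congr (_ * g _ - _); ring.
Qed.

(** Reversing [j] turns the difference in [- j] into a forward difference starting at [- r], at the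
    cost of [(-1) ^+ r]; the two differences then compose to one of order [p + r]. This is the sign
    [(-1) ^+ r] of [twisted_DE]. *)
Lemma fd_power p r n : (n <= p + r)%N ->
  \sum_(i < p.+1) \sum_(j < r.+1) fd_coef p i * fd_coef r j * (i%:R - j%:R) ^+ n =
  (-1) ^+ r * ((p + r)`! * (n == p + r))%:R.
Proof.
move=> np; rewrite exchange_big /= (reindex_inj rev_ord_inj) /=.
transitivity ((-1) ^+ r * fd r (fd p (fun t => t ^+ n)) (- r%:R)); last first.
  by rewrite fd_fd addnC fd_exp // addnC.
rewrite /fd mulr_sumr; apply: eq_bigr => j _; rewrite subSS.
have jr : (j <= r)%N by have := ltn_ord j.
have -> : fd_coef r (r - j) = (-1) ^+ r * fd_coef r j.
  rewrite /fd_coef bin_sub // mulrA -exprD; congr (_ * _).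
  by rewrite -[LHS]signr_odd -[RHS]signr_odd; congr (_ ^+ nat_of_bool _); lia.
rewrite natrB // [RHS]mulrA; transitivity ((-1) ^+ r * fd_coef r j *
   \sum_(i < p.+1) fd_coef p i * (i%:R - (r%:R - j%:R)) ^+ n).
  by rewrite mulr_sumr; apply: eq_bigr => i _; ring.
congr (_ * _); apply: eq_bigr => i _.
by congr (_ * _ ^+ _); ring.
Qed.

Lemma prod_lt_diff (g : nat -> F) n :
  \prod_(i < n) \prod_(k < n | (i < k)%N) g (k - i)%N = \prod_(k < n) \prod_(j < k) g j.+1.
Proof.
elim: n => [|n IH]; first by rewrite !big_ord0.
rewrite big_ord_recl big_ord_recr mulrC -IH; congr (_ * _).
  apply: eq_bigr => i _; rewrite big_mkcond big_ord_recl /= mul1r [RHS]big_mkcond.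
  by apply: eq_bigr => k _; rewrite /bump !leq0n !add1n ltnS subSS.
rewrite big_mkcond big_ord_recl /= mul1r; apply: eq_bigr => k _.
by rewrite /bump leq0n add1n subn0.
Qed.

Lemma prod_lt_cst (c : F) n :
  \prod_(i < n) \prod_(k < n | (i < k)%N) c = c ^+ 'C(n, 2).
Proof.
rewrite (prod_lt_diff (fun=> c)); under eq_bigr do rewrite prodr_const card_ord.
by rewrite prodrXr -bin2_sum big_mkord.
Qed.

End FiniteDifferences.

Section Labelling.
Context {N r : nat} (m : 'I_r -> nat) (a : 'I_N -> 'I_r) (p : 'I_N -> nat).

(* The row of index i of a block matrix is the row p i of the block a i, rows being numbered
   lexicographically. *)
Definition labelling := [/\
  forall i, (p i < m (a i))%N,
  forall i k : 'I_N, (i < k)%N = (a i < a k)%N || ((a i == a k) && (p i < p k)%N) &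
  forall (S : Type) (idx : S) (op : Monoid.com_law idx) (G : 'I_r -> nat -> S),
    \big[op/idx]_k G (a k) (p k) = \big[op/idx]_b \big[op/idx]_(q < m b) G b q].

Context (hl : labelling).

Lemma labelling_pairs (F : comNzRingType) (H : 'I_r -> nat -> 'I_r -> nat -> F) :
  \prod_(i < N) \prod_(k < N | (i < k)%N) H (a i) (p i) (a k) (p k) =
  (\prod_b \prod_(q < m b) \prod_(q' < m b | (q < q')%N) H b q b q') *
  (\prod_(b < r) \prod_(c < r | (b < c)%N) \prod_(q < m b) \prod_(q' < m c) H b q c q').
Proof.
case: hl => hp ho hr.
pose H' (b : 'I_r) q (c : 'I_r) q' := if (b < c)%N || ((b == c) && (q < q')%N) then H b q c q' else 1.
transitivity (\prod_b \prod_(q < m b) \prod_c \prod_(q' < m c) H' b q c q').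
  transitivity (\prod_k (fun b q => \prod_c \prod_(q' < m c) H' b q c q') (a k) (p k)).
    apply: eq_bigr => i _; rewrite -(hr _ _ _ (fun c q' => H' (a i) (p i) c q')) big_mkcond.
    by apply: eq_bigr => k _; rewrite /H' ho.
  by rewrite (hr _ _ _ (fun b q => \prod_c \prod_(q' < m c) H' b q c q')).
rewrite -big_split; apply: eq_bigr => b _ /=; rewrite [X in _ * X]exchange_big -big_split.
apply: eq_bigr => q _ /=; rewrite (bigD1 b) //=; congr (_ * _).
  by rewrite [RHS]big_mkcond; apply: eq_bigr => q' _; rewrite /H' ltnn eqxx.
rewrite [RHS]big_mkcond [RHS](bigD1 b) //= ltnn mul1r; apply: eq_bigr => c bc.
have cb : (b == c) = false by rewrite eq_sym (negbTE bc).
by case: ifP => h; [apply: eq_bigr|apply: big1] => q' _; rewrite /H' h cb.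
Qed.

Lemma labelling_prod_const (F : comNzRingType) (g : 'I_r -> F) :
  \prod_i g (a i) = \prod_b g b ^+ m b.
Proof.
case: hl => hp ho hr; rewrite (hr _ _ _ (fun b _ => g b)).
by apply: eq_bigr => b _; rewrite prodr_const card_ord.
Qed.

Lemma labelling_sum_const (F : comNzRingType) (g : 'I_r -> F) :
  \sum_i g (a i) = \sum_b (m b)%:R * g b.
Proof.
case: hl => hp ho hr; rewrite (hr _ _ _ (fun b _ => g b)).
by apply: eq_bigr => b _; rewrite sumr_const card_ord mulr_natl.
Qed.

Lemma labelling_prod_diff (F : comNzRingType) (g : nat -> F) :
  \prod_(i < N) \prod_(k < N | (i < k)%N) (if a i == a k then g (p k - p i)%N else 1) =
  \prod_k \prod_(j < p k) g j.+1.
Proof.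
rewrite (labelling_pairs (fun b q c q' => if b == c then g (q' - q)%N else 1)).
case: hl => hp ho hr; rewrite (hr _ _ _ (fun _ q => \prod_(j < q) g j.+1)).
rewrite [X in _ * X]big1 ?mulr1 => [|b _].
  apply: eq_bigr => b _; rewrite -prod_lt_diff; apply: eq_bigr => q _.
  by apply: eq_bigr => q' _; rewrite eqxx.
rewrite big1 // => c bc; rewrite big1 // => q _; rewrite big1 // => q' _.
by rewrite -val_eqE (ltn_eqF bc).
Qed.

(* Row i takes the (p i)-th finite difference, at position 0, of the values attached to block a i. *)
Definition fd_mx (F : comNzRingType) : 'M[F]_N :=
  \matrix_(i, k) (if a k == a i then fd_coef (p i) (p k) else 0).

Lemma det_fd_mx (F : comNzRingType) : \det (fd_mx F) = 1.
Proof.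
case: hl => hp ho hr; rewrite det_trig.
  apply: big1 => i _; rewrite mxE eqxx /fd_coef binn mulr1 addnn.
  by rewrite -signr_odd odd_double.
apply/is_trig_mxP => i k ik; rewrite mxE; case: eqP => // aki.
move: ik; rewrite ho -aki ltnn eqxx /= => pik.
by rewrite /fd_coef bin_small ?mulr0.
Qed.

Lemma fd_mx_sum (F : comNzRingType) i (g : 'I_r -> nat -> F) :
  \sum_k fd_mx F i k * g (a k) (p k) = \sum_(q < (p i).+1) fd_coef (p i) q * g (a i) q.
Proof.
case: hl => hp ho hr.
pose G b q := (if b == a i then fd_coef (p i) q else 0) * g b q.
transitivity (\sum_k G (a k) (p k)); first by apply: eq_bigr => k _; rewrite mxE.
rewrite hr (bigD1 (a i)) //= [X in _ + X]big1 ?addr0 => [|b ba]; last first.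
  by apply: big1 => q _; rewrite /G (negbTE ba) mul0r.
rewrite (big_ord_widen _ (fun q => fd_coef (p i) q * g (a i) q) (hp i)) [RHS]big_mkcond.
apply: eq_bigr => q _; rewrite /G eqxx; case: ifP => // /negbT.
by rewrite -leqNgt => pq; rewrite /fd_coef bin_small // mulr0 mul0r.
Qed.

End Labelling.

(** [tagnat] numbers the rows of [mxblock], and its order is the lexicographic one of the sigma
    type. *)
Lemma labelling_tagnat r (m : 'I_r -> nat) :
  labelling m (@tagnat.sig1 r m) (fun k => tagnat.sig2 k).
Proof.
split=> [i|i k|S idx op G]; first exact: ltn_ord.
- have <- : (i < k)%O = (i < k)%N by rewrite ltEord.
  rewrite -tagnat.lt_sig ltEsig /tagnat.sig2 /tagnat.sig1.
  case: (tagnat.sig i) (tagnat.sig k) => [b q] [c q'] /=; rewrite !leEord ltEord.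
  case: (ltngtP b c) => // [lt|/val_inj eq]; first by rewrite -val_eqE (gtn_eqF lt).
  by case: c / eq q' => q'; rewrite tagged_asE eqxx.
- rewrite sig_big_dep /= (reindex (@tagnat.sig r m)) //=.
  exact: tagnat.sig_bij_on.
Qed.

Lemma labelling_cast N N' r (m : 'I_r -> nat) (e : N = N') a p :
  @labelling N' r m a p -> labelling m (fun i => a (cast_ord e i)) (fun i => p (cast_ord e i)).
Proof.
case: N' / e a p => a p h.
by have -> : cast_ord (erefl N) = id by apply/funext => i; apply/val_inj.
Qed.

Section Confluence.
Context {R : realType}.
Local Notation C := R[i].

Lemma lim0_eq (f g : C -> C) l :
  (forall h, h != 0 -> f h = g h) -> lim0 f l -> lim0 g l.
Proof.
move=> fg hf e /hf[d d0 hd]; exists d => // h h0 hh.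
by rewrite -fg //; exact: hd.
Qed.

Lemma lim0_eventually_neq0 (f : C -> C) l : l != 0 -> lim0 f l ->
  exists2 d : R, 0 < d & forall h, h != 0 -> nm h < d -> f h != 0.
Proof.
rewrite -nm_gt0 => l0 /(_ _ l0)[d d0 hd]; exists d => // h h0 /(hd h h0).
by apply: contraTneq => ->; rewrite sub0r nmN ltxx.
Qed.

Lemma has_ps_lim (f : C -> C) z c n (w : C) : has_ps f z c ->
  lim0 (fun h => (f (z + w * h) - \sum_(i < n.+1) c i * (w * h) ^+ i) / h ^+ n) 0.
Proof.
move=> [r r0 [hc hf]] e e0; have [B B0 hB] := pse_remainder n.+1 r0 hc.
have w0 := nm_ge0 w.
pose D := B * nm w ^+ n.+1 + 1.
have D0 : 0 < D by rewrite ltr_wpDl // mulr_ge0 // exprn_ge0.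
exists (Num.min (e / D) (r / (nm w + 1))).
  by rewrite lt_min !divr_gt0 //; lra.
move=> h h0; rewrite lt_min ltr_pdivlMr // ltr_pdivlMr; last by lra.
move=> /andP[h1 h2]; have nh : 0 < nm h by rewrite nm_gt0.
have wh : nm (w * h) <= r by rewrite nmM; lra.
rewrite subr0 hf // nmM nmV nmX ltr_pdivrMr ?exprn_gt0 //.
apply: le_lt_trans (hB _ wh) _; rewrite nmM.
have -> : B * (nm w * nm h) ^+ n.+1 = (B * nm w ^+ n.+1 * nm h) * nm h ^+ n.
  by rewrite exprMn (exprSr (nm h)); ring.
rewrite ltr_pM2r ?exprn_gt0 //; apply: lt_trans h1.
by rewrite /D mulrDr mulr1 [X in X < _]mulrC ltrDl.
Qed.

(** The double difference annihilates the Taylor terms of degree below [p + q] and evaluates the one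
    of degree [p + q] by [fd_power]; the remainder is negligible against [h ^+ (p + q)]. *)
Lemma fd_lim (f : C -> C) z c p q : has_ps f z c ->
  lim0 (fun h => h^-1 ^+ p * h^-1 ^+ q *
    \sum_(i < p.+1) \sum_(j < q.+1) fd_coef p i * fd_coef q j * f (z + (i%:R - j%:R) * h))
    ((-1) ^+ q * (p + q)`!%:R * c (p + q)%N).
Proof.
move=> hf; set n := (p + q)%N; pose l := (-1) ^+ q * n`!%:R * c n.
pose rem (i j : nat) h := (f (z + (i%:R - j%:R) * h)
   - \sum_(k < n.+1) c k * ((i%:R - j%:R) * h) ^+ k) / h ^+ n.
apply: (@lim0_eq (fun h => l + \sum_(i < p.+1) \sum_(j < q.+1) fd_coef p i * fd_coef q j * rem i j h)).
  move=> h h0; have hn : h ^+ n != 0 by rewrite expf_neq0.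
  apply: (mulIf hn); rewrite -exprD exprVn -/n [RHS]mulrAC mulVf // mul1r.
  have E : l * h ^+ n = \sum_(i < p.+1) \sum_(j < q.+1) fd_coef p i * fd_coef q j *
      \sum_(k < n.+1) c k * ((i%:R - j%:R) * h) ^+ k.
    under eq_bigr => i _ do under eq_bigr => j _ do rewrite mulr_sumr.
    under eq_bigr => i _ do rewrite exchange_big.
    rewrite exchange_big /=.
    transitivity (\sum_(k < n.+1) c k * h ^+ k * ((-1) ^+ q * (n`! * (k == n :> nat))%:R)).
      rewrite big_ord_recr /= eqxx muln1 big1 ?add0r => [|k _]; first by rewrite /l; ring.
      by rewrite (ltn_eqF (ltn_ord k)) muln0 !mulr0.
    apply: eq_bigr => k _; rewrite -fd_power; last by rewrite -ltnS.
    rewrite mulr_sumr; apply: eq_bigr => i _; rewrite mulr_sumr; apply: eq_bigr => j _.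
    rewrite exprMn; ring.
  rewrite mulrDl E mulr_suml -big_split; apply: eq_bigr => i _.
  rewrite mulr_suml -big_split; apply: eq_bigr => j _ /=.
  by rewrite /rem -(mulrA (fd_coef _ _ * fd_coef _ _)) divfK // mulrBr addrC subrK.
have Z : lim0 (fun h => \sum_(i < p.+1) \sum_(j < q.+1) fd_coef p i * fd_coef q j * rem i j h)
    (\sum_(i < p.+1) \sum_(j < q.+1) fd_coef p i * fd_coef q j * 0).
  apply: lim0_sum => i _; apply: lim0_sum => j _; apply: lim0M; first exact: lim0_cst.
  exact: has_ps_lim.
have := lim0D (lim0_cst l) Z; rewrite [X in l + X]big1 ?addr0 // => i _.
by rewrite big1 // => j _; rewrite mulr0.
Qed.

Lemma det_scale_lines N (u v : 'I_N -> C) (M : 'M[C]_N) :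
  \det (\matrix_(i, j) (u i * v j * M i j)) = (\prod_i u i) * (\prod_j v j) * \det M.
Proof.
have := det_scale_entries 1 u v M; rewrite expr1n mul1r => <-.
by congr determinant; apply/matrixP => i j; rewrite !mxE mul1r.
Qed.

Section Blocks.
Context (N r s : nat) (m : 'I_r -> nat) (n : 'I_s -> nat).
Context (a : 'I_N -> 'I_r) (p : 'I_N -> nat) (b : 'I_N -> 'I_s) (q : 'I_N -> nat).
Context (hr : labelling m a p) (hs : labelling n b q).

Lemma det_fd (g : 'I_r -> nat -> 'I_s -> nat -> C) :
  \det (\matrix_(i, j) g (a i) (p i) (b j) (q j)) =
  \det (\matrix_(i, j) \sum_(k < (p i).+1) \sum_(l < (q j).+1)
    fd_coef (p i) k * fd_coef (q j) l * g (a i) k (b j) l).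
Proof.
set M := \matrix_(i, j) g _ _ _ _.
transitivity (\det (fd_mx a p C *m M *m (fd_mx b q C)^T)).
  by rewrite !det_mulmx det_tr (det_fd_mx hr) (det_fd_mx hs) mul1r mulr1.
congr determinant; apply/matrixP => i j; rewrite [LHS]mxE [RHS]mxE.
pose G c l := \sum_(k < (p i).+1) fd_coef (p i) k * g (a i) k c l.
transitivity (\sum_l fd_mx b q C j l * G (b l) (q l)).
  apply: eq_bigr => l _; rewrite mxE [X in _ * X]mxE mulrC; congr (_ * _).
  have := fd_mx_sum hr i (fun c k => g c k (b l) (q l)); rewrite -/(G (b l) (q l)) => <-.
  by apply: eq_bigr => k _; rewrite [X in _ * X]mxE.
rewrite (fd_mx_sum hs) exchange_big /=; apply: eq_bigr => l _.
by rewrite mulr_sumr; apply: eq_bigr => k _; ring.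
Qed.

(* The finite differences of rows and columns do not change the determinant, and each of them
   is asymptotically a power of h times a Taylor coefficient. *)
Lemma confluent_lim (f : C -> C) (x : 'I_r -> C) (y : 'I_s -> C) (c : 'I_N -> 'I_N -> nat -> C) :
  (forall i j, has_ps f (x (a i) - y (b j)) (c i j)) ->
  lim0 (fun h => (\prod_i h^-1 ^+ p i) * (\prod_j h^-1 ^+ q j) *
     \det (\matrix_(i, j) f (x (a i) + (p i)%:R * h - (y (b j) + (q j)%:R * h))))
   ((\prod_i (p i)`!%:R) * (\prod_j (q j)`!%:R) *
     \det (\matrix_(i, j) ((-1) ^+ q j * 'C(p i + q j, p i)%:R * c i j (p i + q j)%N))).
Proof.
move=> hf.
apply: (@lim0_eq (fun h => \det (\matrix_(i, j) (h^-1 ^+ p i * h^-1 ^+ q j *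
    \sum_(k < (p i).+1) \sum_(l < (q j).+1) fd_coef (p i) k * fd_coef (q j) l *
      f (x (a i) - y (b j) + (k%:R - l%:R) * h))))).
  move=> h h0; rewrite (det_fd (fun c k d l => f (x c + k%:R * h - (y d + l%:R * h)))).
  rewrite -det_scale_lines; congr determinant.
  apply/matrixP => i j; rewrite !mxE; congr (_ * _).
  by do 2 apply: eq_bigr => ? _; congr (_ * f _); ring.
(* The binomial coefficients in the matrix, times [p!] for rows and [q!] for columns, are the
   factorials [(p + q)!] left by the differences. *)
have -> : (\prod_i (p i)`!%:R) * (\prod_j (q j)`!%:R) *
     \det (\matrix_(i, j) ((-1) ^+ q j * 'C(p i + q j, p i)%:R * c i j (p i + q j)%N)) =
   \det (\matrix_(i, j) ((-1) ^+ q j * (p i + q j)`!%:R * c i j (p i + q j)%N)) :> C.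
  rewrite -det_scale_lines; congr determinant.
  apply/matrixP => i j; rewrite !mxE -(bin_fact (leq_addr (q j) (p i))) addKn !natrM; ring.
apply: lim0_det => i j; rewrite mxE; under [X in lim0 X]funext do rewrite mxE.
exact: fd_lim.
Qed.

End Blocks.

Section ThetaBlocks.
Context (tau : C) (htau : 0 < complex.Im tau).
Local Notation om := (half_period tau).
Local Notation K z := (@prime_form R z tau).

Lemma prime_form_cont z (w : C) : lim0 (fun h => K (z + w * h)) (K z).
Proof.
apply: (analytic_lim0 (f := @prime_form R ^~ tau)); first exact: prime_form_entire.
exact: lim0_id.
Qed.

(* Two points of the same block collide as h -> 0; the h^-1 for each such pair are collected in
   the product of the h^-1 ^+ p k. *)
Lemma prime_form_pairs_lim N r (m : 'I_r -> nat) (a : 'I_N -> 'I_r) (p : 'I_N -> nat)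
    (x : 'I_r -> C) : labelling m a p ->
  lim0 (fun h => (\prod_k h^-1 ^+ p k) * \prod_(i < N) \prod_(k < N | (i < k)%N)
      K (x (a i) + (p i)%:R * h - (x (a k) + (p k)%:R * h)))
    ((-1) ^+ (\sum_b 'C(m b, 2))%N * (\prod_k (p k)`!%:R) *
     \prod_(b < r) \prod_(c < r | (b < c)%N) K (x b - x c) ^+ (m b * m c)).
Proof.
move=> hl; have [hp ho hs] := hl.
(* The limit of each factor: within a block, [K] of a multiple of [h] divided by [h], with
   [p i < p k] making it negative; otherwise a plain value by continuity. *)
pose L i k : C := if a i == a k then - ((p k - p i)%N%:R) else K (x (a i) - x (a k)).
have -> : (-1) ^+ (\sum_b 'C(m b, 2))%N * (\prod_k (p k)`!%:R) *
     \prod_(b < r) \prod_(c < r | (b < c)%N) K (x b - x c) ^+ (m b * m c) =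
     \prod_(i < N) \prod_(k < N | (i < k)%N) L i k.
  transitivity ((\prod_(i < N) \prod_(k < N | (i < k)%N)
      (if a i == a k then - ((p k - p i)%N%:R) else 1 : C)) *
    (\prod_(i < N) \prod_(k < N | (i < k)%N)
      (if a i == a k then 1 else K (x (a i) - x (a k))))); last first.
    rewrite -big_split; apply: eq_bigr => i _; rewrite -big_split; apply: eq_bigr => k _ /=.
    by rewrite /L; case: ifP => _; rewrite ?mulr1 ?mul1r.
  rewrite (labelling_prod_diff hl (fun d => - d%:R : C)).
  rewrite (labelling_pairs hl (fun b q c q' => if b == c then 1 else K (x b - x c))).
  rewrite [X in _ = _ * (X * _)]big1 => [|b _]; last first.
    by rewrite big1 // => q _; rewrite big1 // => q' _; rewrite eqxx.
  rewrite mul1r; congr (_ * _).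
    (* The point [k] collides with [p k] earlier points of its block, each giving a sign; over a
       block of size [m] these numbers add up to ['C(m, 2)]. *)
    have -> : (-1) ^+ (\sum_b 'C(m b, 2))%N = \prod_k (-1) ^+ p k :> C.
      rewrite (hs _ _ _ (fun _ q => (-1) ^+ q)) -prodrXr; apply: eq_bigr => b _.
      by rewrite prodrXr -bin2_sum big_mkord.
    rewrite -big_split; apply: eq_bigr => k _ /=.
    under [RHS]eq_bigr do rewrite -mulN1r.
    by rewrite big_split /= prodr_const card_ord fact_prod natr_prod big_add1 big_mkord.
  apply: eq_bigr => b _; apply: eq_bigr => c bc.
  rewrite -val_eqE (ltn_eqF bc) (eq_bigr (fun=> K (x b - x c) ^+ m c)) => [|q _]; last first.
    by rewrite prodr_const card_ord.
  by rewrite prodr_const card_ord -exprM mulnC.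
apply: (@lim0_eq (fun h => \prod_(i < N) \prod_(k < N | (i < k)%N)
   ((if a i == a k then h^-1 else 1) * K (x (a i) + (p i)%:R * h - (x (a k) + (p k)%:R * h))))).
  move=> h h0 /=; have <- : \prod_(i < N) \prod_(k < N | (i < k)%N) (if a i == a k then h^-1 else 1)
      = \prod_k h^-1 ^+ p k.
    rewrite (labelling_prod_diff hl (fun=> h^-1)).
    by apply: eq_bigr => k _; rewrite prodr_const card_ord.
  by rewrite -big_split; apply: eq_bigr => i _; rewrite -big_split.
apply: lim0_prod => i _; apply: lim0_prod => k ik; rewrite /L.
case: eqP => [aik|_].
  have pik : (p i < p k)%N by move: ik; rewrite ho -aik ltnn eqxx.
  apply: lim0_eq (prime_form_lim htau _) => h h0; rewrite mulrC aik; congr (_ * K _).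
  by rewrite natrB ?(ltnW pik) //; ring.
apply: lim0_eq (prime_form_cont (x (a i) - x (a k)) ((p i)%:R - (p k)%:R)) => h h0.
by rewrite mul1r; congr (K _); ring.
Qed.

Theorem confluent_det N r s (m : 'I_r -> nat) (n : 'I_s -> nat)
    (a : 'I_N -> 'I_r) (p : 'I_N -> nat) (b : 'I_N -> 'I_s) (q : 'I_N -> nat)
    (x : 'I_r -> C) (y : 'I_s -> C) (l : R) (t : C) :
  labelling m a p -> labelling n b q -> nonlattice om t ->
  (forall i j, nonlattice om (x (a i) - y (b j))) ->
  let S := \sum_i (m i)%:R * x i - \sum_j (n j)%:R * y j in
  \det (\matrix_(i, j) ((-1) ^+ q j * 'C(p i + q j, p i)%:R *
     taylor (kron tau l t) (x (a i) - y (b j)) (p i + q j))) =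
  (-1) ^+ ('C(N, 2) + \sum_i 'C(m i, 2) + \sum_j 'C(n j, 2))%N *
  (cexp (l%:C * S) * K (S + t) / K t) *
  ((\prod_(i < r) \prod_(k < r | (i < k)%N) K (x i - x k) ^+ (m i * m k)) *
   (\prod_(j < s) \prod_(k < s | (j < k)%N) K (y j - y k) ^+ (n j * n k)) /
   (\prod_(i < r) \prod_(j < s) K (x i - y j) ^+ (m i * n j))).
Proof.
move=> hr hs ht hxy S.
have Kt : K t != 0 by rewrite prime_form_neq0 // halfTheta_neq0.
pose X i h := x (a i) + (p i)%:R * h; pose Y j h := y (b j) + (q j)%:R * h.
have hps i j : has_ps (kron tau l t) (x (a i) - y (b j)) (taylor (kron tau l t) (x (a i) - y (b j))).
  by have [c hc] := kron_has_ps htau l t (hxy i j); rewrite (taylorE hc).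
have Llim := confluent_lim hr hs hps.
set W := \prod_i \prod_j K (x i - y j) ^+ (m i * n j).
have WE : W = \prod_i \prod_j K (x (a i) - y (b j)).
  rewrite (labelling_prod_const hr (fun c => \prod_j K (x c - y (b j)))).
  apply: eq_bigr => c _; rewrite (labelling_prod_const hs (fun d => K (x c - y d))).
  by rewrite -prodrXl; apply: eq_bigr => d _; rewrite -exprM mulnC.
have W0 : W != 0.
  rewrite WE; apply/prodf_neq0 => i _; apply/prodf_neq0 => j _.
  by rewrite prime_form_neq0 // halfTheta_neq0.
have Wlim : lim0 (fun h => \prod_i \prod_j K (X i h - Y j h)) W.
  rewrite WE; apply: lim0_prod => i _; apply: lim0_prod => j _.
  apply: lim0_eq (prime_form_cont (x (a i) - y (b j)) ((p i)%:R - (q j)%:R)) => h h0.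
  by congr (K _); rewrite /X /Y; ring.
(* For small nonzero [h] no displaced difference is a zero of [K], so the determinant with simple
   points applies. *)
have [d d0 hd] := lim0_eventually_neq0 W0 Wlim.
have Xlim := prime_form_pairs_lim x hr; have Ylim := prime_form_pairs_lim y hs.
(* The rate at which the argument [S] drifts with [h]. *)
pose k := \sum_i (p i)%:R - \sum_j (q j)%:R : C.
have Elim : lim0 (fun h => cexp (l%:C * (S + k * h)) * K (S + k * h + t)) (cexp (l%:C * S) * K (S + t)).
  apply: lim0M.
    apply: (analytic_lim0 (f := fun z => cexp (l%:C * z))); last exact: lim0_id.
    exact: entire_cexp.
  apply: lim0_eq (prime_form_cont (S + t) k) => h h0.
  by congr (K _); ring.
have SE h : \sum_i X i h - \sum_j Y j h = S + k * h.
  rewrite /X /Y !big_split /= (labelling_sum_const hr) (labelling_sum_const hs) -!mulr_suml.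
  by rewrite /S /k; ring.
have Rlim := lim0M (lim0M (lim0M (lim0_cst ((-1) ^+ 'C(N, 2) / K t)) Elim) (lim0M Xlim Ylim)) (lim0V W0 Wlim).
(* The factorials from the differences and those from colliding [K] factors are the same and
   cancel. *)
have pf0 : (\prod_i (p i)`!%:R) * (\prod_j (q j)`!%:R) != 0 :> C.
  by apply: mulf_neq0; apply/prodf_neq0 => i _; rewrite pnatr_eq0 -lt0n fact_gt0.
apply: (mulfI pf0).
rewrite (lim0_frequently Llim Rlim); last first.
  move=> e e0; have e1 : 0 < Num.min e d / 2 by rewrite divr_gt0 // lt_min e0.
  exists (Num.min e d / 2)%:C; have ne : nm (Num.min e d / 2)%:C = Num.min e d / 2.
    by rewrite nm_real ger0_norm // ltW.
  have lt1 : nm (Num.min e d / 2)%:C < Num.min e d by rewrite ne; lra.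
  have h0 : (Num.min e d / 2)%:C != 0 :> C by rewrite -nm_gt0 ne.
  move: lt1; rewrite lt_min => /andP[l1 l2]; split => //.
  move: (_%:C) h0 l2 => h h0 /(hd h h0) Wh.
  have Kxy i j : K (X i h - Y j h) != 0.
    by move/prodf_neq0: Wh => /(_ i isT)/prodf_neq0/(_ j isT).
  have := kron_det htau l Kt Kxy; rewrite /X /Y => ->.
  rewrite -/(X _ h) -/(Y _ h) SE.
  have -> : \prod_(i < N) \prod_(k < N | (i < k)%N)
      (K (X k h - X i h) * K (Y i h - Y k h)) =
    (-1) ^+ 'C(N, 2) * ((\prod_(i < N) \prod_(k < N | (i < k)%N) K (X i h - X k h)) *
      (\prod_(i < N) \prod_(k < N | (i < k)%N) K (Y i h - Y k h))).
    rewrite -prod_lt_cst -!big_split; apply: eq_bigr => i _; rewrite -!big_split.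
    by apply: eq_bigr => j _ /=; rewrite -opprB prime_formN // mulNr mulN1r.
  ring.
rewrite !exprD; ring.
Qed.

End ThetaBlocks.
End Confluence.

Theorem corollary6p10 (R : realType) (alpha beta : R) (theta phi tau : R[i])
    (htheta : theta = cexp (- (two_pi_i R * alpha%:C)))
    (hphi : phi = cexp (- (two_pi_i R * beta%:C)))
    (htwist : (theta, phi) <> (1, 1))
    (htau : 0 < complex.Im tau)
    (r s : nat) (m : 'I_r -> nat) (n : 'I_s -> nat)
    (hmn : (\sum_i m i = \sum_j n j)%N)
    (x : 'I_r -> R[i]) (y : 'I_s -> R[i])
    (hxy : forall (a : 'I_r) (b : 'I_s), (0 < m a)%N -> (0 < n b)%N ->
       ~ period_lattice tau (x a - y b)) :
  \det (castmx (erefl (\sum_i m i)%N, esym hmn)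
    (\mxblock_(a < r, b < s)
       \matrix_(i < m a, j < n b)
         twisted_D theta phi i.+1 j.+1 tau (x a - y b)))
  =
  (-1) ^+ ('C(\sum_i m i, 2) + \sum_i 'C(m i, 2) + \sum_j 'C(n j, 2))%N *
  (vartheta (- beta + 2^-1) (alpha + 2^-1)
     (\sum_i (m i)%:R * x i - \sum_j (n j)%:R * y j) tau
   / vartheta (- beta + 2^-1) (alpha + 2^-1) 0 tau) *
  ((\prod_(i < r) \prod_(k < r | (i < k)%N)
      prime_form (x i - x k) tau ^+ (m i * m k)) *
   (\prod_(j < s) \prod_(l < s | (j < l)%N)
      prime_form (y j - y l) tau ^+ (n j * n l)) /
   (\prod_(i < r) \prod_(j < s)
      prime_form (x i - y j) tau ^+ (m i * n j))).
Proof.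
have lr := labelling_tagnat m; have ls := labelling_cast hmn (labelling_tagnat n).
have ht := twist_nonlattice htheta hphi htwist htau.
(* An entry only occurs in a block with [m_a] and [n_b] positive, which is the range of [hxy]. *)
have hl (i j : 'I_(\sum_i m i)) : nonlattice (half_period tau)
    (x (tagnat.sig1 i) - y (tagnat.sig1 (cast_ord hmn j))).
  apply: nonlatticeP; apply: hxy.
  - by case: lr => /(_ i) + _ _; apply: leq_ltn_trans.
  - by case: ls => /(_ j) + _ _; apply: leq_ltn_trans.
have c0 := Tcoef1_neq0 htau; have t0 := halfTheta_neq0 htau ht.
have ratioE z : vartheta (- beta + 2^-1) (alpha + 2^-1) z tau
    / vartheta (- beta + 2^-1) (alpha + 2^-1) 0 tau =
    cexp ((twist_exponent phi)%:C * z) * prime_form (z + twist_shift alpha phi tau) tau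
    / prime_form (twist_shift alpha phi tau) tau.
  rewrite (vartheta_ratio htheta hphi htwist htau) !prime_formE //.
  by move: (halfTheta _ _) (halfTheta _ _) t0 => u v v0; field; rewrite c0.
rewrite ratioE -(confluent_det htau (twist_exponent phi) lr ls ht hl).
congr determinant; apply/matrixP => i j; rewrite castmxE !mxE esymK cast_ord_id.
by rewrite (twisted_DE htheta hphi htwist htau).
Qed.
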